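(* Let $\Omega\subseteq\mathbb{R}^n$ be a connected open set and $\bar L(\cdot):=b(x)\partial_\mu(a^{\mu\nu}(x)\partial_\nu(\cdot))$ with $b\in C^\infty(\Omega,\mathbb{R})$, $b>0$, and $a\in C^\infty(\Omega,M_{n\times n}(\mathbb{C}))$ pointwise symmetric with $\mathrm{Re}(a^{\mu\nu}(x)\xi^*_\mu\xi_\nu)\ge\ell(x)\delta^{\mu\nu}\xi^*_\mu\xi_\nu$ for all $\xi\in\mathbb{C}^n$ and some continuous $\ell:\Omega\to\mathbb{R}_{>0}$. Let $(f_j)_{j\in\mathbb{N}_0}$ be a sequence in $L^2_{\mathrm{loc}}(\Omega)$ and $k\in\mathbb{N}$ such that $f_j,\bar Lf_j,\dots,\bar L^kf_j\in L^2_{\mathrm{loc}}(\Omega)$ for all $j$. Suppose $F:B_S(0)\to L^2_{\mathrm{loc}}(\Omega)$, $B_S(0)=\{\zeta\in\mathbb{C}:|\zeta|<S\}$, is analytic and for each $\zeta\in B_S(0)$: (i) $F(\zeta)=\sum_{j=0}^\infty\frac{\zeta^j}{j!}f_j$ with convergence in $L^2_{\mathrm{loc}}(\Omega)$; (ii) $F(\zeta),\bar LF(\zeta),\dots,\bar L^kF(\zeta)\in L^2_{\mathrm{loc}}(\Omega)$; (iii) for each $l\in\{1,\dots,k\}$, $\bar L^lF(\zeta)=\sum_{j=0}^\infty\frac{\zeta^j}{j!}\bar L^lf_j$ with convergence in $L^2_{\mathrm{loc}}(\Omega)$. If there is $m\in\mathbb{N}_0$ with $k>m/2+n/4$, then for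 each $\zeta\in B_S(0)$ there is a $C^m(\Omega)$ representative $F(\zeta,\cdot)$ of $F(\zeta)$, and the map $B_S(0)\times\Omega\ni(\zeta,x)\mapsto F(\zeta,x)\in\mathbb{C}$ is jointly $C^m$.
   Context: $L^2_{\mathrm{loc}}(\Omega)$ is defined with respect to Lebesgue measure, with convergence meaning $L^2$-convergence on every relatively compact open subset of $\Omega$; $\bar L^j$ acts distributionally. *)

(* Defs.v *)
From HB Require Import structures.
From mathcomp Require Import all_boot all_order all_algebra.
From mathcomp Require Import all_classical all_reals all_analysis.
From mathcomp Require Import complex.
Set Implicit Arguments.
Unset Strict Implicit.
Unset Printing Implicit Defensive.
Import Order.TTheory GRing.Theory Num.Theory.
Import numFieldNormedType.Exports.
Local Open Scope classical_set_scope.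
Local Open Scope ring_scope.
Local Open Scope complex_scope.

Section Defs.
Context {R : realType}.
Local Notation C := (R[i]).

Definition cRe (z : C) : R := complex.Re z.
Definition cIm (z : C) : R := complex.Im z.

Definition cabs (z : C) : R := Num.sqrt (cRe z ^+ 2 + cIm z ^+ 2).

Definition ev {n : nat} (i : 'I_n) : 'rV[R]_n := delta_mx 0 i.

Definition partial {n : nat} (i : 'I_n) (h : 'rV[R]_n -> R) : 'rV[R]_n -> R :=
  fun x => derive h x (ev i).

Fixpoint dpartial {n : nat} (l : seq 'I_n) (h : 'rV[R]_n -> R) : 'rV[R]_n -> R :=
  match l with
  | [::] => h
  | i :: l' => partial i (dpartial l' h)
  end.

Definition CmR {n : nat} (m : nat) (O : set 'rV[R]_n) (h : 'rV[R]_n -> R) : Prop :=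
  forall l : seq 'I_n, (size l <= m)%N ->
    (forall x, O x -> {for x, continuous (dpartial l h)}) /\
    ((size l < m)%N -> forall (i : 'I_n) x, O x -> derivable (dpartial l h) x (ev i)).

Definition Cm {n : nat} (m : nat) (O : set 'rV[R]_n) (h : 'rV[R]_n -> C) : Prop :=
  CmR m O (fun x => cRe (h x)) /\ CmR m O (fun x => cIm (h x)).

Definition cpartial {n : nat} (i : 'I_n) (h : 'rV[R]_n -> C) : 'rV[R]_n -> C :=
  fun x => (partial i (fun y => cRe (h y)) x) +i* (partial i (fun y => cIm (h y)) x).

(* Lebesgue integral on R^n, written as the iterated integral of
   one-dimensional Lebesgue integrals (Fubini/Tonelli) *)
Fixpoint iint (n : nat) : ('rV[R]_n -> \bar R) -> \bar R :=
  match n with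
  | 0 => fun g => g 0
  | n'.+1 => fun g =>
      (\int[@lebesgue_measure R]_(t in setT)
         iint (fun y : 'rV[R]_n' => g (row_mx (\row_(_ < 1) t) y)))%E
  end.

Definition borelRn (n : nat) : set (set 'rV[R]_n) := <<s [set A | open A] >>.

Definition borel_on {n : nat} (Om : set 'rV[R]_n) (h : 'rV[R]_n -> C) : Prop :=
  (forall A : set R, open A -> borelRn (Om `&` (fun x => cRe (h x)) @^-1` A)) /\
  (forall A : set R, open A -> borelRn (Om `&` (fun x => cIm (h x)) @^-1` A)).

Definition ae_eq_on {n : nat} (Om : set 'rV[R]_n) (g h : 'rV[R]_n -> C) : Prop :=
  iint (fun x => ((\1_[set y | Om y /\ g y <> h y] x : R))%:E) = 0%E.

Definition relcpt {n : nat} (Om U : set 'rV[R]_n) : Prop :=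
  open U /\ compact (closure U) /\ closure U `<=` Om.

Definition sqnorm {n : nat} (U : set 'rV[R]_n) (h : 'rV[R]_n -> C) : \bar R :=
  iint (fun x => ((\1_U x : R) * (cRe (h x) ^+ 2 + cIm (h x) ^+ 2))%:E).

(* h (a representative of) an element of L^2_loc(Omega) *)
Definition L2loc {n : nat} (Om : set 'rV[R]_n) (h : 'rV[R]_n -> C) : Prop :=
  borel_on Om h /\ forall U, relcpt Om U -> (sqnorm U h < +oo)%E.

Definition L2loc_cvg {n : nat} (Om : set 'rV[R]_n)
    (s : nat -> 'rV[R]_n -> C) (h : 'rV[R]_n -> C) : Prop :=
  forall U, relcpt Om U ->
    (fun N => sqnorm U (fun x => s N x - h x)) @ \oo --> (0 : \bar R).

Definition test_fun {n : nat} (Om : set 'rV[R]_n) (phi : 'rV[R]_n -> R) : Prop :=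
  (forall m, CmR m setT phi) /\
  compact (closure [set x | phi x <> 0]) /\ closure [set x | phi x <> 0] `<=` Om.

(* formal adjoint of Lbar = b d_mu (a^{mu nu} d_nu .) applied to a test
   function: d_nu (a^{mu nu} d_mu (b phi)) (summed over mu, nu) *)
Definition Lbar_adj {n : nat} (a : 'rV[R]_n -> 'M[C]_n) (b : 'rV[R]_n -> R)
    (phi : 'rV[R]_n -> R) : 'rV[R]_n -> C :=
  fun x => \sum_(mu < n) \sum_(nu < n)
    cpartial nu (fun y => a y mu nu * (partial mu (fun z => b z * phi z) y)%:C) x.

Definition weakL {n : nat} (Om : set 'rV[R]_n) (a : 'rV[R]_n -> 'M[C]_n)
    (b : 'rV[R]_n -> R) (u g : 'rV[R]_n -> C) : Prop :=
  forall phi, test_fun Om phi ->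
    iint (fun x => (cRe (g x) * phi x)%:E) =
      iint (fun x => (cRe (u x * Lbar_adj a b phi x))%:E) /\
    iint (fun x => (cIm (g x) * phi x)%:E) =
      iint (fun x => (cIm (u x * Lbar_adj a b phi x))%:E).

Definition psum {n : nat} (z : C) (g : nat -> 'rV[R]_n -> C) (N : nat) :
    'rV[R]_n -> C :=
  fun x => \sum_(j < N) z ^+ j / (j`!)%:R * g j x.

Definition L2loc_analytic {n : nat} (Om : set 'rV[R]_n) (S : R)
    (F : C -> 'rV[R]_n -> C) : Prop :=
  forall z0, cabs z0 < S -> exists D : 'rV[R]_n -> C, L2loc Om D /\
    forall U, relcpt Om U -> forall e : R, 0 < e -> exists2 d : R, 0 < d &
      forall z, cabs z < S -> 0 < cabs (z - z0) < d ->
        (sqnorm U (fun x => ((F z x - F z0 x) / (z - z0) - D x)%R) < e%:E)%E.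

Definition joint {n : nat} (G : C -> 'rV[R]_n -> C) : 'rV[R]_(2 + n) -> C :=
  fun v => G ((lsubmx v) ord0 ord0 +i* (lsubmx v) ord0 ord_max) (rsubmx v).

Definition joint_dom {n : nat} (S : R) (Om : set 'rV[R]_n) : set 'rV[R]_(2 + n) :=
  [set v | cabs ((lsubmx v) ord0 ord0 +i* (lsubmx v) ord0 ord_max) < S /\
           Om (rsubmx v)].

End Defs.

(* Main.v *)
(** Fix a cube Q of half-width rho centred at a point of Omega, a cutoff chi supported in Q and equal to 1 near the
    centre, and the exponentials e_xi(x) = exp(-i pi xi.x / rho), xi in Z^n, which are orthogonal and complete on Q.
    Since a is elliptic, the adjoint L* of Lbar multiplies e_xi by a symbol of size |xi|^2 up to lower order
    terms, so an amplitude times e_xi equals |xi|^-2 L*(amplitude' e_xi) + |xi|^-1 amplitude'' e_xi. Iterating and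
    moving L* onto f_j trades each factor |xi|^-2 for one power of Lbar, until only |xi|^-2k times pairings with
    functions bounded in L^2 remain; these are summed over xi by almost orthogonality (the Gram matrix of the functions
    amplitude e_xi decays rapidly off the diagonal) and by convergence of sum |xi|^(2m-4k), which is where 4k > 2m + n enters.
    The outcome is that sum_xi |xi|^m |c_j(xi)| r^j/j! is bounded in j for every r < S, where c_j(xi) are the Fourier
    coefficients of chi f_j: the L^2 convergence of the series at zeta = r bounds r^j/j! Lbar^l f_j in L^2(Q).
    Hence sum_(j, xi) zeta^j/j! c_j(xi) e_(-xi)(x) can be differentiated m times termwise in (zeta, x), and it equals
    F(zeta) almost everywhere near the centre of Q. Two such local representatives are continuous and agree almost
    everywhere where both are defined, so they agree there and can be glued. *)

(* The coefficients vary, so Lbar is not diagonal in the exponentials, and at most [k] powers of it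
   may be put on f_j. The parametrix step respects this budget: its main term costs one power of
   Lbar and gains two powers of |xi|, its remainder costs none and gains one. Once the gain reaches
   2k, at most k powers of Lbar have been spent. Constants must not depend on xi or j: amplitudes
   and data are carried as indexed families with one bound for the whole family. Weighted absolute
   summability takes the place of a Sobolev embedding. Completeness of the exponentials serves only
   to identify the sum of the series; slicing reduces it to one dimension, where square waves,
   obtained as limits of polynomials in sines, isolate intervals. Integrals in the statement are
   iterated one-dimensional ones, hence a measure [lam n] built by the same recursion. *)
Require Import Defs.
From HB Require Import structures.
From mathcomp Require Import all_boot all_order all_algebra.
From mathcomp Require Import all_classical all_reals all_analysis.
From mathcomp Require Import complex.
From mathcomp Require Import measurable_realfun zify ring lra.
Set Implicit Arguments.
Unset Strict Implicit.
Unset Printing Implicit Defensive.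
Import Order.TTheory GRing.Theory Num.Theory.
Import numFieldNormedType.Exports.
Local Open Scope classical_set_scope.
Local Open Scope ring_scope.

(** * Lebesgue measure on R^n and its iterated integral *)

Section LebesgueRn.
Context {R : realType}.

(** Measurable sets of [BV n] are by definition the [borelRn n] of the statement, so [borel_on]
    hypotheses transfer without proof. *)
Definition BV (n : nat) := g_sigma_algebraType [set A : set 'rV[R]_n | open A].

(** The new coordinate goes to the head, matching the order of integration in [iint]. *)
Definition rcons_row n (p : R * 'rV[R]_n) : 'rV[R]_n.+1 :=
  row_mx (\row_(_ < 1) p.1) p.2 : 'rV[R]_(1 + n).
Definition split_row n (v : 'rV[R]_n.+1) : R * 'rV[R]_n :=
  (v ord0 ord0, rsubmx (v : 'rV[R]_(1 + n))).

Lemma rcons_rowK n : cancel (@rcons_row n) (@split_row n).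
Proof.
move=> [t y]; rewrite /split_row /rcons_row /=; congr pair; last first.
  exact: row_mxKr.
have -> : ord0 = lshift n (ord0 : 'I_1) by apply: val_inj.
by apply: etrans (row_mxEl (\row_(_ < 1) t) y ord0 ord0) _; rewrite mxE.
Qed.

Lemma ball_rVE n (x : 'rV[R]_n) e : 0 < e ->
  ball x e = [set y | forall i, `|x ord0 i - y ord0 i| < e].
Proof.
move=> e0; apply/seteqP; split => [y [_ H] i|y H]; first exact: H.
by split=> // i j; rewrite ord1; exact: H.
Qed.

(** Cubes with rational centre and half-width 1/(k+1) form a countable base; this makes
    measurability of row-valued maps checkable coordinate by coordinate. *)
Definition qcube n (c : 'rV[rat]_n) (k : nat) : set 'rV[R]_n :=
  [set y | forall i, `|ratr (c ord0 i) - y ord0 i| < k.+1%:R^-1].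

Lemma qcube_in_open n (O : set 'rV[R]_n) x : open O -> O x ->
  exists c k, qcube c k x /\ qcube c k `<=` O.
Proof.
rewrite openE => OO Ox; have /nbhs_ballP[e /= e0 He] := OO _ Ox.
(* Half of [e] leaves room for two errors: from [x] to the rational centre, and from the centre to a
   point of the cube. *)
have [k Hk] : exists k : nat, k.+1%:R^-1 < e / 2.
  have e20 : 0 < e / 2 by rewrite divr_gt0.
  exists (Num.truncn (e / 2)^-1).
  by rewrite invf_plt ?posrE ?ltr0Sn // truncnS_gt.
have k0 : 0 < k.+1%:R^-1 :> R by rewrite invr_gt0 ltr0Sn.
suff Hd (d : R) : 0 < d -> d < e / 2 -> exists c : 'rV[rat]_n,
    (forall i, `|ratr (c ord0 i) - x ord0 i| < d) /\
    [set y : 'rV[R]_n | forall i, `|ratr (c ord0 i) - y ord0 i| < d] `<=` O.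
  by have [c Hc] := Hd _ k0 Hk; exists c, k.
move=> d0 de.
have Hr i : exists q : rat, `|ratr q - x ord0 i| < d.
  have : x ord0 i - d < x ord0 i + d by lra.
  move=> /rat_in_itvoo[q]; rewrite in_itv /= => /andP[h1 h2].
  by exists q; rewrite ltr_norml; apply/andP; split; lra.
have [c Hc] := choice Hr.
exists (\row_i c i); split => [i|y /= Hy]; first by rewrite mxE.
apply: He; rewrite ball_rVE // => i /=.
have := Hy i; have := Hc i; rewrite mxE !ltr_norml => /andP[? ?] /andP[? ?].
apply/andP; split; lra.
Qed.

Lemma open_qcubes n (O : set 'rV[R]_n) : open O ->
  O = \bigcup_(p in [set p : 'rV[rat]_n * nat | qcube p.1 p.2 `<=` O])
        qcube p.1 p.2.
Proof.
move=> OO; apply/seteqP; split => [x /(qcube_in_open OO)[c [k [? ?]]]|x [p ? ?]].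
  by exists (c, k).
by auto.
Qed.

Lemma open_measurable_BV n (O : set 'rV[R]_n) : open O -> measurable (O : set (BV n)).
Proof. by move=> OO; apply: sub_sigma_algebra. Qed.

Lemma measurable_fun_open_BV d (T : measurableType d) n (f : T -> BV n) :
  (forall O : set 'rV[R]_n, open O -> measurable (f @^-1` O)) -> measurable_fun setT f.
Proof.
move=> H; apply: (@measurability _ _ _ (BV n) _ _ [set A : set 'rV[R]_n | open A]) => //.
by move=> _ [A OA <-]; rewrite setTI; apply: H.
Qed.

Lemma measurable_fun_openR d (T : measurableType d) (f : T -> R) :
  (forall O : set R, open O -> measurable (f @^-1` O)) -> measurable_fun setT f.
Proof.
move=> H; apply: (measurability _ (measurable_realfun.RGenOpens.measurableE R)).
by move=> _ [_ [a [b ->] <-]]; rewrite setTI; apply/H/interval_open.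
Qed.

Lemma continuous_measurable_BV n (f : 'rV[R]_n -> R) : continuous f ->
  measurable_fun setT (f : BV n -> R).
Proof.
move=> /continuousP cf; apply: measurable_fun_openR => O OO.
by apply: open_measurable_BV; apply: cf.
Qed.

Lemma measurable_coord n i : measurable_fun setT (fun x : BV n => x ord0 i).
Proof. by apply: continuous_measurable_BV; exact: coord_continuous. Qed.

Lemma measurable_qcube d (T : measurableType d) n (g : T -> 'rV[R]_n) c k :
  (forall i, measurable_fun setT (fun t => g t ord0 i)) ->
  measurable (g @^-1` qcube c k).
Proof.
move=> mg.
have -> : g @^-1` qcube c k = \bigcap_(i in [set: 'I_n])
   (setT `&` (fun t => g t ord0 i) @^-1` ball (ratr (c ord0 i) : R) (k.+1%:R^-1)).
  apply/seteqP; split => [t /= H i _|t H i]; first by split => //; exact: H.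
  by case: (H i I).
apply: fin_bigcap_measurable => // i _; apply: mg => //.
exact: measurable_realfun.measurable_ball.
Qed.

Lemma measurable_fun_rV d (T : measurableType d) n (g : T -> BV n) :
  (forall i, measurable_fun setT (fun t => (g t : 'rV[R]_n) ord0 i)) ->
  measurable_fun setT g.
Proof.
move=> mg; apply: measurable_fun_open_BV => O /open_qcubes ->.
rewrite preimage_bigcup bigcup_mkcond.
apply: (@countable_bigcupT_measurable _ _ ('rV[rat]_n * nat)%type) => // p.
by case: ifP => // _; exact: measurable_qcube.
Qed.

Lemma measurable_rcons_row n :
  measurable_fun setT (@rcons_row n : measurableTypeR R * BV n -> BV n.+1).
Proof.
apply: measurable_fun_rV => i; rewrite /rcons_row.
have [j|j] := splitP (i : 'I_(1 + n)) => ij.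
  have -> : i = lshift n j by apply: val_inj.
  apply: (eq_measurable_fun fst) => [t _|]; last exact: measurable_fst.
  by apply/esym; apply: etrans (row_mxEl _ _ _ _) _; rewrite mxE.
have -> : i = rshift 1 j by apply: val_inj.
apply: (eq_measurable_fun ((fun y : BV n => y ord0 j) \o snd)) => [t _|].
  exact/esym/row_mxEr.
exact: (measurableT_comp (measurable_coord j) measurable_snd).
Qed.

Lemma measurable_split_row n :
  measurable_fun setT (@split_row n : BV n.+1 -> measurableTypeR R * BV n).
Proof.
apply/measurable_fun_pairP; split; first exact: measurable_coord.
apply: measurable_fun_rV => j.
apply: (eq_measurable_fun (fun t : BV n.+1 => t ord0 (rshift 1 j))) => [t _|].
  by rewrite /= mxE.
exact: measurable_coord.
Qed.

Section step.
Variables (n : nat) (m : {sigma_finite_measure set (BV n) -> \bar R}).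

(** Sigma-finiteness is carried along the recursion because Tonelli and Fubini in the next dimension
    ask it of the second factor. *)
Definition lam_step_fun : set (BV n.+1) -> \bar R :=
  pushforward (@lebesgue_measure R \x m)%E
    (@rcons_row n : measurableTypeR R * BV n -> BV n.+1).

HB.instance Definition _ := Measure.copy lam_step_fun
  (measure_function_pushforward__canonical__measure_function_Measure
     (@lebesgue_measure R \x m)%E (@measurable_rcons_row n)).

Lemma lam_step_sigma_finite : sigma_finite setT lam_step_fun.
Proof.
have /sigma_finiteP[F [TF ndF Foo]] := sigma_finiteT (@lebesgue_measure R).
have /sigma_finiteP[G [TG ndG Goo]] := sigma_finiteT m.
exists (fun k => @split_row n @^-1` (F k `*` G k)).
  rewrite -preimage_bigcup; apply/esym/seteqP; split => // x _ /=.
  have [i _ Fi] : (\bigcup_i F i) (split_row x).1 by rewrite -TF.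
  have [j _ Gj] : (\bigcup_i G i) (split_row x).2 by rewrite -TG.
  exists (maxn i j) => //; split.
    by move: Fi; apply/subsetPset/ndF/leq_maxl.
  by move: Gj; apply/subsetPset/ndG/leq_maxr.
move=> k; have [? ?] := Foo k; have [? ?] := Goo k; split.
  rewrite -[X in measurable X]setTI; apply: measurable_split_row => //.
  exact: measurableX.
rewrite /lam_step_fun /pushforward.
rewrite (_ : _ @^-1` _ = F k `*` G k); last first.
  by apply/seteqP; split => x; rewrite /preimage /mkset rcons_rowK.
by rewrite product_measure1E// lte_mul_pinfty// ge0_fin_numE.
Qed.

HB.instance Definition _ :=
  Measure_isSigmaFinite.Build _ _ _ lam_step_fun lam_step_sigma_finite.

Definition lam_step : {sigma_finite_measure set (BV n.+1) -> \bar R} := lam_step_fun.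
End step.

Lemma dirac_sigma_finite : sigma_finite setT (@dirac _ (BV 0) 0 R).
Proof.
apply: fin_num_fun_sigma_finite; first by rewrite diracE ltry.
by move=> A mA; rewrite diracE.
Qed.

HB.instance Definition _ :=
  Measure_isSigmaFinite.Build _ _ _ (@dirac _ (BV 0) 0 R) dirac_sigma_finite.

(** Lebesgue measure on R^n by the recursion of [iint]; dimension 0 is the unit mass at the only
    point, in agreement with [iint g = g 0]. *)
Fixpoint lam (n : nat) : {sigma_finite_measure set (BV n) -> \bar R} :=
  match n with
  | 0 => @dirac _ (BV 0) 0 R
  | n'.+1 => lam_step (lam n')
  end.

(** Tonelli gives this for nonnegative integrands; the integral of [h] is by definition the
    difference of those of its positive and negative parts, so no integrability is involved. *)
Lemma measurable_integral_param d (X : measurableType d) (h : X * measurableTypeR R -> \bar R) :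
  measurable_fun setT h ->
  measurable_fun setT (fun x => \int[@lebesgue_measure R]_t h (x, t))%E.
Proof.
move=> mh.
have -> : (fun x => \int[@lebesgue_measure R]_t h (x, t))%E =
  (fun x => \int[@lebesgue_measure R]_t h^\+ (x, t) -
            \int[@lebesgue_measure R]_t h^\- (x, t))%E.
  apply/funext => x; rewrite integralE.
  by rewrite funepos_comp funeneg_comp.
apply: emeasurable_funB.
  apply: (@measurable_fun_fubini_tonelli_F _ _ _ _ _ (@lebesgue_measure R) (h^\+)%E) => //.
  exact: measurable_funepos.
apply: (@measurable_fun_fubini_tonelli_F _ _ _ _ _ (@lebesgue_measure R) (h^\-)%E) => //.
exact: measurable_funeneg.
Qed.

(** The parameter space has to vary in the induction: each coordinate peeled off becomes one more
    parameter. *)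
Lemma measurable_iint_param n d (X : measurableType d) (g : X * BV n -> \bar R) :
  measurable_fun setT g ->
  measurable_fun setT (fun x => iint (fun y : 'rV[R]_n => g (x, y))).
Proof.
elim: n d X g => [|n IH] d X g mg /=.
  exact: (measurableT_comp mg (pair2_measurable _)).
apply: (@measurable_integral_param _ X
  (fun p => iint (fun y : 'rV_n => g (p.1, @rcons_row n (p.2, y))))).
apply: (IH _ (X * measurableTypeR R)%type (fun q => g (q.1.1, @rcons_row n (q.1.2, q.2)))).
apply: (measurableT_comp mg); apply/measurable_fun_pairP; split.
  exact: (measurableT_comp measurable_fst measurable_fst).
apply: (measurableT_comp (@measurable_rcons_row n)).
apply/measurable_fun_pairP; split; last exact: measurable_snd.
exact: (measurableT_comp measurable_snd measurable_fst).
Qed.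

Lemma lamS_integral_ge0 n (g : BV n.+1 -> \bar R) : measurable_fun setT g ->
  (forall x, (0 <= g x)%E) ->
  (\int[lam n.+1]_x g x =
   \int[@lebesgue_measure R]_t \int[lam n]_y g (rcons_row (t, y)))%E.
Proof.
move=> mg g0.
transitivity (\int[pushforward (@lebesgue_measure R \x lam n)
    (@rcons_row n : measurableTypeR R * BV n -> BV n.+1)]_x g x)%E => //.
have mr := @measurable_rcons_row n.
rewrite (ge0_integral_pushforward mr) //.
rewrite preimage_setT.
have mgr := measurableT_comp mg mr.
by rewrite (@fubini_tonelli1 _ _ _ _ _ (@lebesgue_measure R) (lam n) _ mgr) // => x; exact: g0.
Qed.

Lemma iint_ge0_integral n (g : BV n -> \bar R) : measurable_fun setT g ->
  (forall x, (0 <= g x)%E) -> iint (g : 'rV[R]_n -> \bar R) = (\int[lam n]_x g x)%E.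
Proof.
elim: n g => [|n IH] g mg g0.
  by rewrite /= integral_dirac // diracT mul1e.
rewrite lamS_integral_ge0 //=; apply: eq_integral => t _.
rewrite -IH //.
apply: (measurableT_comp mg).
exact: (measurableT_comp (@measurable_rcons_row n) (pair1_measurable _)).
Qed.

Lemma lamS_integrable n (g : BV n.+1 -> \bar R) : (lam n.+1).-integrable setT g ->
  (@lebesgue_measure R \x lam n)%E.-integrable setT (g \o @rcons_row n).
Proof.
move=> /integrableP[mg ig]; apply/integrableP; split.
  exact: (measurableT_comp mg (@measurable_rcons_row n)).
have mabse d (T : measurableType d) (h : T -> \bar R) : measurable_fun setT h -> measurable_fun setT (abse \o h).
  by move=> mh; apply: measurableT_comp.
move: ig; rewrite lamS_integral_ge0; [|exact: (mabse _ _ _ mg)|by []].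
have mgr := mabse _ _ _ (measurableT_comp mg (@measurable_rcons_row n)).
by have -> := @fubini_tonelli1 _ _ _ _ _ (@lebesgue_measure R) (lam n) _ mgr (fun=> abse_ge0 _).
Qed.

Lemma lamS_integral n (g : BV n.+1 -> \bar R) : (lam n.+1).-integrable setT g ->
  (\int[lam n.+1]_x g x =
   \int[@lebesgue_measure R]_t \int[lam n]_y g (rcons_row (t, y)))%E.
Proof.
move=> ig.
transitivity (\int[pushforward (@lebesgue_measure R \x lam n)
    (@rcons_row n : measurableTypeR R * BV n -> BV n.+1)]_x g x)%E => //.
have mr := @measurable_rcons_row n.
have /integrableP[mg _] := ig.
have ig' := lamS_integrable ig.
by rewrite (integral_pushforward mr) // preimage_setT -integral12_prod_meas1.
Qed.

(** Slices of an integrable function are integrable only for almost every head coordinate, and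
    [iint] of the other slices is uncontrolled. The two outer integrands agree almost everywhere
    only, and measurability of the inner [iint] allows exchanging them. *)
Lemma iint_integral n (g : BV n -> \bar R) : (lam n).-integrable setT g ->
  iint (g : 'rV[R]_n -> \bar R) = (\int[lam n]_x g x)%E.
Proof.
elim: n g => [|n IH] g ig.
  by rewrite /= integral_dirac // ?diracT ?mul1e //; case/integrableP: ig.
rewrite lamS_integral //=.
have ig' := lamS_integrable ig.
have /integrableP[mg _] := ig'.
apply: ae_eq_integral => //.
- exact: (@measurable_iint_param n _ (measurableTypeR R) (g \o @rcons_row n)).
- exact: (@measurable_fubini_F _ _ _ _ _ _ _ _ ig').
- have := ae_integrable1 ig'; apply: filterS => t /= it _.
  exact: IH.
Qed.
End LebesgueRn.

(** * Real integrals on R^n and vanishing of the integral of a derivative *)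

Section IntegralRn.
Context {R : realType}.
Implicit Types n : nat.

Definition rnint n (g : 'rV[R]_n -> R) : R := \int[lam n]_(x in setT) (g x).
Definition Intg n (g : 'rV[R]_n -> R) : Prop := (lam n).-integrable setT (EFin \o g).

Lemma iint_rnint n (g : 'rV[R]_n -> R) : Intg g ->
  iint (fun x => (g x)%:E) = (rnint g)%:E.
Proof.
move=> ig; rewrite (iint_integral ig) /rnint /Rintegral fineK //.
exact: integrable_fin_num.
Qed.

Lemma lam_ball n (c : 'rV[R]_n) (r : R) : 0 < r -> lam n (ball c r) = ((2 * r) ^+ n)%:E.
Proof.
move=> r0; elim: n c => [|n IH] c.
  rewrite /= diracE mem_set ?expr0 // ball_rVE // => i /=.
  by case: i.
have -> : ball c r = @split_row R n @^-1`
    (ball (c ord0 ord0) r `*` ball (rsubmx (c : 'rV_(1 + n))) r).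
  rewrite !ball_rVE //; apply/seteqP; split => y /= H.
    by split; [exact: (H ord0)|move=> i; have := H (rshift 1 i); rewrite !mxE].
  case: H => H1 H2 i.
  have [j|j] := splitP (i : 'I_(1 + n)) => ij.
    have -> : i = ord0 by apply: val_inj; rewrite /= ij ord1.
    exact: H1.
  have -> : i = rshift 1 j by apply: val_inj.
  by have := H2 j; rewrite !mxE.
rewrite [lam _]/= /lam_step /= /lam_step_fun /pushforward.
rewrite (_ : _ @^-1` _ = ball (c ord0 ord0) r `*` ball (rsubmx (c : 'rV_(1 + n))) r); last first.
  by apply/seteqP; split => x; rewrite /preimage /mkset rcons_rowK.
rewrite product_measure1E; last 2 first.
- exact: measurable_ball.
- by apply: open_measurable_BV; exact: ball_open.
transitivity ((r *+ 2)%:E * ((2 * r) ^+ n)%:E)%E; last by rewrite -EFinM exprS mulr_natl.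
congr (_ * _)%E; [exact: lebesgue_measure_ball (ltW r0)|exact: IH].
Qed.

Lemma Intg_bounded n (g : 'rV[R]_n -> R) c (r M : R) : 0 < r ->
  measurable_fun setT (g : BV n -> R) ->
  (forall x, ~ ball c r x -> g x = 0) -> (forall x, `|g x| <= M) -> Intg g.
Proof.
move=> r0 mg g0 gM.
have mB : measurable (ball c r : set (BV n)).
  by apply: open_measurable_BV; exact: ball_open.
have lB : (lam n (ball c r) < +oo)%E by rewrite lam_ball ?ltry.
have : (lam n).-integrable (ball c r) (EFin \o g).
  apply: measurable_bounded_integrable => //.
  - exact: measurable_funS mg.
  - by exists M; split; [exact: num_real|] => y My x Bx; exact: le_trans (gM x) (ltW My).
rewrite integrable_mkcond // => H.
rewrite /Intg (_ : EFin \o g = (EFin \o g) \_ (ball c r)) //.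
by apply/funext => x; rewrite patchE; case: ifPn => // /negP; rewrite inE => /g0 /= ->.
Qed.

Lemma IntgD n (f g : 'rV[R]_n -> R) : Intg f -> Intg g -> Intg (fun x => f x + g x).
Proof. by move=> If Ig; have := integrableD measurableT If Ig. Qed.
Lemma IntgZ n k (f : 'rV[R]_n -> R) : Intg f -> Intg (fun x => k * f x).
Proof. by move=> If; have := integrableZl measurableT k If. Qed.
Lemma IntgN n (f : 'rV[R]_n -> R) : Intg f -> Intg (fun x => - f x).
Proof. by move=> If; have := integrableN If. Qed.
Lemma IntgB n (f g : 'rV[R]_n -> R) : Intg f -> Intg g -> Intg (fun x => f x - g x).
Proof. by move=> If Ig; apply: IntgD => //; apply: IntgN. Qed.
Lemma Intg_cst0 n : Intg (fun _ : 'rV[R]_n => 0).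
Proof. exact: integrable0. Qed.
Lemma Intg_meas n (f : 'rV[R]_n -> R) : Intg f -> measurable_fun setT (f : BV n -> R).
Proof. by move=> /integrableP[/measurable_EFinP]. Qed.
Lemma Intg_le n (f g : 'rV[R]_n -> R) : measurable_fun setT (f : BV n -> R) ->
  (forall x, `|f x| <= g x) -> Intg g -> Intg f.
Proof.
move=> mf fg; apply: le_integrable => //; first exact/measurable_EFinP.
by move=> x _ /=; rewrite lee_fin (le_trans (fg x)) // ler_norm.
Qed.

Lemma rnintD n (f g : 'rV[R]_n -> R) : Intg f -> Intg g ->
  rnint (fun x => f x + g x) = rnint f + rnint g.
Proof. by move=> If Ig; rewrite /rnint RintegralD. Qed.
Lemma rnintZ n k (f : 'rV[R]_n -> R) : Intg f -> rnint (fun x => k * f x) = k * rnint f.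
Proof. by move=> If; rewrite /rnint RintegralZl. Qed.
Lemma rnintN n (f : 'rV[R]_n -> R) : Intg f -> rnint (fun x => - f x) = - rnint f.
Proof.
move=> If; rewrite -mulN1r -rnintZ //; congr rnint.
by apply/funext => x; rewrite mulN1r.
Qed.
Lemma rnintB n (f g : 'rV[R]_n -> R) : Intg f -> Intg g ->
  rnint (fun x => f x - g x) = rnint f - rnint g.
Proof. by move=> If Ig; rewrite rnintD ?rnintN //; apply: IntgN. Qed.
Lemma rnint0 n : rnint (fun _ : 'rV[R]_n => 0) = 0.
Proof. by rewrite /rnint Rintegral_cst //= mul0r. Qed.
Lemma rnint_le n (f g : 'rV[R]_n -> R) : Intg f -> Intg g ->
  (forall x, f x <= g x) -> rnint f <= rnint g.
Proof. by move=> If Ig fg; apply: le_Rintegral. Qed.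
Lemma rnint_ge0 n (f : 'rV[R]_n -> R) : (forall x, 0 <= f x) -> 0 <= rnint f.
Proof. by move=> H; apply: Rintegral_ge0. Qed.

(** A directional derivative sees only the restriction to a line; passages between partial
    derivatives, derivatives of slices and one-variable derivatives rest on this. *)
Lemma derive_line (V W : normedModType R) (g : V -> R) (f : W -> R) a v b w :
  (forall h : R, g (h *: v + a) = f (h *: w + b)) ->
  (derivable g a v <-> derivable f b w) /\ derive g a v = derive f b w.
Proof.
move=> H; rewrite /derivable /derive.
suff -> : (fun h : R => h^-1 *: ((g \o shift a) (h *: v) - g a)) =
  (fun h => h^-1 *: ((f \o shift b) (h *: w) - f b)) by [].
apply/funext => h /=; rewrite H.
by have := H 0; rewrite !scale0r !add0r => ->.
Qed.

Lemma rcons_row0 n (p : R * 'rV[R]_n) : rcons_row p ord0 ord0 = p.1.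
Proof.
have -> : ord0 = lshift n (ord0 : 'I_1) :> 'I_(1 + n) by apply: val_inj.
by apply: etrans (row_mxEl _ _ _ _) _; rewrite mxE.
Qed.

Lemma rcons_rowS n (p : R * 'rV[R]_n) j : rcons_row p ord0 (lift ord0 j) = p.2 ord0 j.
Proof.
have -> : lift ord0 j = rshift 1 j by apply: val_inj.
exact: row_mxEr.
Qed.

Lemma rcons_row_ev0 n h t (y : 'rV[R]_n) :
  rcons_row (h *: 1 + t, y) = h *: ev ord0 + rcons_row (t, y).
Proof.
apply/rowP => i; rewrite [RHS]mxE [X in _ = X + _]mxE [X in _ = _ * X + _]mxE.
have [j ->|->] := unliftP ord0 i; rewrite ?rcons_row0 ?rcons_rowS /=.
  by rewrite mulr0 add0r.
by rewrite mulr1 /GRing.scale /= mulr1.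
Qed.

Lemma rcons_row_ev n h t j (y : 'rV[R]_n) :
  rcons_row (t, h *: ev j + y) = h *: ev (lift ord0 j) + rcons_row (t, y).
Proof.
apply/rowP => i; rewrite [RHS]mxE [X in _ = X + _]mxE [X in _ = _ * X + _]mxE.
have [k ->|->] := unliftP ord0 i; rewrite ?rcons_row0 ?rcons_rowS /=.
  by rewrite !mxE /= (inj_eq (@lift_inj _ _)).
by rewrite mulr0 add0r.
Qed.

Lemma ball_rcons_row n (p q : R * 'rV[R]_n) e : 0 < e ->
  ball p e q -> ball (rcons_row p) e (rcons_row q).
Proof.
move=> e0 [H1]; rewrite ball_rVE // => H2; rewrite ball_rVE // => i.
by have [k ->|->] := unliftP ord0 i; rewrite ?rcons_row0 ?rcons_rowS.
Qed.

Lemma cvg_ball_at (T U : pseudoMetricType R) (f : T -> U) x :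
  (forall e : R, 0 < e -> exists2 d : R, 0 < d & forall y, ball x d y -> ball (f x) e (f y)) ->
  {for x, continuous f}.
Proof.
move=> H; apply/cvg_ballP => e e0; have [d d0 Hd] := H e e0.
by apply/nbhs_ballP; exists d.
Qed.

Lemma continuous_rcons_rowl n (y : 'rV[R]_n) : continuous (fun t : R => rcons_row (t, y)).
Proof.
move=> t; apply: cvg_ball_at => e e0; exists e => // q tq.
by apply: ball_rcons_row => //; split => //; exact: ballxx.
Qed.

Lemma continuous_rcons_rowr n (t : R) : continuous (fun y : 'rV[R]_n => rcons_row (t, y)).
Proof.
move=> y; apply: cvg_ball_at => e e0; exists e => // q tq.
by apply: ball_rcons_row => //; split => //; exact: ballxx.
Qed.

Lemma lam_integral_swap n (g : 'rV[R]_n.+1 -> R) : Intg g ->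
  (\int[lam n.+1]_x (g x)%:E =
   \int[lam n]_y \int[@lebesgue_measure R]_t (g (rcons_row (t, y)))%:E)%E.
Proof.
move=> ig; have ig' := lamS_integrable ig.
rewrite lamS_integral //.
have -> := @Fubini _ _ _ _ R (@lebesgue_measure R) (lam n) _ ig'.
by [].
Qed.

Lemma integral_deriv_compact (f F : R -> R) (r : R) : 0 < r ->
  (forall t : R, is_derive t 1 F (f t)) -> continuous f ->
  (forall t : R, r <= `|t| -> F t = 0) -> (forall t : R, r <= `|t| -> f t = 0) ->
  (\int[@lebesgue_measure R]_t (f t)%:E)%E = 0%E.
Proof.
move=> r0 dF cf F0 f0.
rewrite (_ : (fun t => (f t)%:E) = (EFin \o f) \_ `[- r, r]); last first.
  apply/funext => t; rewrite patchE; case: ifPn => // /negP; rewrite inE /= in_itv /= => H.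
  rewrite f0 // leNgt; apply/negP; rewrite ltr_norml => /andP[h1 h2].
  by apply: H; rewrite !ltW.
rewrite -integral_mkcond.
rewrite (@continuous_FTC2 _ f F (- r) r).
- by rewrite !F0 ?subee // ?normrN ger0_norm // ltW.
- by rewrite gtrN.
- exact: continuous_subspaceT.
- have cF t : {for t, continuous F}.
    by apply: differentiable_continuous; apply/derivable1_diffP; exact: ex_derive.
  split => [t _|  |].
  + exact: ex_derive.
  + exact/cvg_at_right_filter/cF.
  + exact/cvg_at_left_filter/cF.
- by move=> t _; rewrite derive1E; apply: derive_val.
Qed.

Lemma continuous_supp_bounded n (f : 'rV[R]_n -> R) c (r : R) : continuous f ->
  (forall x, ~ ball c r x -> f x = 0) -> exists M, forall x, `|f x| <= M.
Proof.
move=> cf f0.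
have cK : compact (closed_ball c r).
  apply: bounded_closed_compact; last exact: closed_ball_closed.
  have [r0|r0] := ltP 0 r; last first.
    by rewrite closed_ball0 //; exists 0; split => // M M0 x.
  exists (`|c| + r); split; first exact: num_real.
  move=> M cM x; rewrite closed_ballE // /closed_ball_ /= => H.
  rewrite (le_trans _ (ltW cM)) //.
  by rewrite -[x](subKr c) (le_trans (ler_normB _ _)) // lerD2l.
have : compact (f @` closed_ball c r).
  by apply: continuous_compact => //; exact: continuous_subspaceT.
move=> /compact_bounded[M [_ HM]]; exists (`|M| + 1) => x.
have M1 : M < `|M| + 1 by rewrite (le_lt_trans (ler_norm _)) // ltrDl.
have [xK|xK] := pselect (ball c r x).
  by apply: (HM _ M1); exists x => //; exact: subset_closed_ball.
by rewrite f0 // normr0 addr_ge0.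
Qed.

Lemma Intg_continuous_supp n (f : 'rV[R]_n -> R) c (r : R) : 0 < r -> continuous f ->
  (forall x, ~ ball c r x -> f x = 0) -> Intg f.
Proof.
move=> r0 cf f0; have [M HM] := continuous_supp_bounded cf f0.
exact: (Intg_bounded r0 (continuous_measurable_BV cf) f0 HM).
Qed.

Lemma not_ball_rcons n (c : 'rV[R]_n.+1) (r t : R) (y : 'rV[R]_n) :
  0 < r -> r <= `|t - c ord0 ord0| -> ~ ball c r (rcons_row (t, y)).
Proof.
move=> r0 rt; rewrite ball_rVE // => /(_ ord0) /=.
by rewrite rcons_row0 /= distrC ltNge rt.
Qed.

Lemma not_ball_rconsr n (c : 'rV[R]_n.+1) (r t : R) (y : 'rV[R]_n) :
  0 < r -> ~ ball (split_row c).2 r y -> ~ ball c r (rcons_row (t, y)).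
Proof.
move=> r0; rewrite !ball_rVE // => H H2; apply: H => i /=.
have := H2 (lift ord0 i); rewrite rcons_rowS /= mxE.
by congr (`|c _ _ - _| < _); apply: val_inj.
Qed.

(** Induction on the dimension. A derivative along a later coordinate is handled by the induction
    hypothesis on slices with fixed head; a derivative along the head by integrating over the head
    first and applying the fundamental theorem of calculus on each line. *)
Lemma rnint_partial n (i : 'I_n) (f : 'rV[R]_n -> R) c (r : R) : 0 < r ->
  (forall x, derivable f x (ev i)) -> continuous (partial i f) ->
  (forall x, ~ ball c r x -> f x = 0) -> (forall x, ~ ball c r x -> partial i f x = 0) ->
  (\int[lam n]_x (partial i f x)%:E)%E = 0%E.
Proof.
move=> r0; elim: n i f c => [[]//|n IH] i f c df cpf f0 pf0.
have ig : Intg (partial i f) by exact: Intg_continuous_supp cpf pf0.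
have [j Ei|Ei] := unliftP ord0 i.
  rewrite (lamS_integral ig) integral0_eq // => t _.
  have E y h : f (rcons_row (t, h *: ev j + y)) = f (h *: ev i + rcons_row (t, y)).
    by rewrite rcons_row_ev Ei.
  have D y := @derive_line 'rV[R]_n 'rV[R]_n.+1 (fun y => f (rcons_row (t, y))) f y (ev j)
    (rcons_row (t, y)) (ev i) (E y).
  have pE : partial j (fun y => f (rcons_row (t, y))) =
      (fun y => partial i f (rcons_row (t, y))).
    by apply/funext => y; have [_] := D y.
  rewrite -[RHS](IH j (fun y => f (rcons_row (t, y))) (split_row c).2).
  - by apply: eq_integral => y _; rewrite pE.
  - by move=> y; apply/(D y).1.
  - rewrite pE => y.
    by apply: continuous_comp; [exact: continuous_rcons_rowr|exact: cpf].
  - by move=> y Hy; apply/f0/not_ball_rconsr.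
  - by move=> y Hy; rewrite pE; apply/pf0/not_ball_rconsr.
rewrite lam_integral_swap // integral0_eq // => y _.
have D t := @derive_line R 'rV[R]_n.+1 (fun t => f (rcons_row (t, y))) f t 1
  (rcons_row (t, y)) (ev ord0) (fun h => congr1 f (rcons_row_ev0 h t y)).
(* [integral_deriv_compact] works on an interval symmetric about 0, so the radius is enlarged by the
   distance of the centre from 0. *)
have far t : `|c ord0 ord0| + r <= `|t| -> ~ ball c r (rcons_row (t, y)).
  move=> H; apply: not_ball_rcons => //.
  by have := lerB_dist t (c ord0 ord0); lra.
apply: (@integral_deriv_compact (fun t => partial i f (rcons_row (t, y)))
  (fun t => f (rcons_row (t, y))) (`|c ord0 ord0| + r)).
- by rewrite ltr_wpDl.
- move=> t; rewrite Ei; split; first by apply/(D t).1; rewrite -Ei.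
  by have [_ ->] := D t.
- move=> t.
  by apply: continuous_comp; [exact: continuous_rcons_rowl|exact: cpf].
- by move=> t /far/f0.
- by move=> t /far/pf0.
Qed.
End IntegralRn.

(** * Families bounded in C^m *)

Section SmoothFamilies.
Context {R : realType} {n : nat}.
Local Notation V := 'rV[R]_n.
Implicit Types (O : set V) (j : 'I_n).

Definition drv j (f : V -> R) x := derivable f x (ev j).

Lemma drvD j f g x : drv j f x -> drv j g x -> drv j (fun y => f y + g y) x.
Proof. by move=> df dg; have := derivableD df dg. Qed.
Lemma drvN j f x : drv j f x -> drv j (fun y => - f y) x.
Proof. by move=> df; have := derivableN df. Qed.
Lemma drvM j f g x : drv j f x -> drv j g x -> drv j (fun y => f y * g y) x.
Proof. by move=> df dg; have := derivableM df dg. Qed.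
Lemma drv_cst j k x : drv j (fun=> k) x.
Proof. exact: derivable_cst. Qed.
Lemma partialD j f g x : drv j f x -> drv j g x ->
  partial j (fun y => f y + g y) x = partial j f x + partial j g x.
Proof. by move=> df dg; have := deriveD df dg. Qed.
Lemma partialN j f x : drv j f x -> partial j (fun y => - f y) x = - partial j f x.
Proof. by move=> df; have := deriveN df. Qed.
Lemma partialM j f g x : drv j f x -> drv j g x ->
  partial j (fun y => f y * g y) x = partial j f x * g x + f x * partial j g x.
Proof.
move=> df dg; have := deriveM df dg; rewrite /partial => ->.
by rewrite /GRing.scale /= addrC mulrC.
Qed.
Lemma partial_cst j k x : partial j (fun=> k) x = 0 :> R.
Proof. exact: derive_cst. Qed.

Lemma near_drv j (f g : V -> R) x : {near x, f =1 g} -> drv j f x -> drv j g x.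
Proof. exact: near_eq_derivable. Qed.
Lemma near_partial j (f g : V -> R) x : {near x, f =1 g} -> partial j f x = partial j g x.
Proof. exact: near_eq_derive. Qed.

Lemma open_eq_near O (f g : V -> R) x : open O -> O x -> (forall y, O y -> f y = g y) ->
  {near x, f =1 g}.
Proof. by move=> OO Ox H; apply: filterS (open_nbhs_nbhs (conj OO Ox)). Qed.

Lemma cont_cst (k : R) (x : V) : {for x, continuous (fun=> k)}.
Proof. exact: cst_continuous. Qed.

Lemma contD (f g : V -> R) x : {for x, continuous f} -> {for x, continuous g} ->
  {for x, continuous (fun y => f y + g y)}.
Proof. by move=> cf cg; have := continuousD cf cg. Qed.

Lemma contM (f g : V -> R) x : {for x, continuous f} -> {for x, continuous g} ->
  {for x, continuous (fun y => f y * g y)}.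
Proof. by move=> cf cg; have := continuousM cf cg. Qed.

Lemma contV (f : V -> R) x : f x != 0 -> {for x, continuous f} ->
  {for x, continuous (fun y => (f y)^-1)}.
Proof. by move=> f0 cf; have := continuousV f0 cf. Qed.

Lemma near_continuous (f g : V -> R) x : {near x, f =1 g} ->
  {for x, continuous f} -> {for x, continuous g}.
Proof.
move=> fg cf; rewrite /prop_for /continuous_at.
have <- : f x = g x by have := nbhs_singleton fg.
exact: cvg_trans (near_eq_cvg fg) cf.
Qed.

(* Boundedness in C^m, uniformly over the index set of a family: estimates stated for families of
   amplitudes are automatically uniform in the frequency. *)
Fixpoint UB (I : Type) (O : set V) (m : nat) (h : I -> V -> R) : Prop :=
  [/\ exists M : R, forall i x, O x -> `|h i x| <= M,
      forall i x, O x -> {for x, continuous (h i)} &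
      match m with
      | 0 => True
      | m'.+1 => (forall i j x, O x -> drv j (h i) x) /\
                 (forall j, UB O m' (fun i => partial j (h i)))
      end].

Section UBtheory.
Variables (I : Type) (O : set V) (OO : open O).
Implicit Types (f g h : I -> V -> R).

Lemma UB_bounded m h : UB O m h -> exists M : R, forall i x, O x -> `|h i x| <= M.
Proof. by case: m => [|m] []. Qed.
Lemma UB_continuous m h : UB O m h -> forall i x, O x -> {for x, continuous (h i)}.
Proof. by case: m => [|m] []. Qed.
Lemma UB_drv m h : UB O m.+1 h -> forall i j x, O x -> drv j (h i) x.
Proof. by case=> _ _ []. Qed.
Lemma UB_partial m h j : UB O m.+1 h -> UB O m (fun i => partial j (h i)).
Proof. by case=> _ _ [_]; apply. Qed.

Lemma UBS m h : UB O m.+1 h -> UB O m h.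
Proof.
elim: m h => [|m IH] h; first by case.
case=> B C [D P]; split => //; split => // j.
exact: IH (P j).
Qed.

Lemma eq_UB m f g : (forall i x, O x -> f i x = g i x) -> UB O m f -> UB O m g.
Proof.
elim: m f g => [|m IH] f g fg [B C D].
  split => // [|i x Ox].
    by have [M HM] := B; exists M => i x Ox; rewrite -fg // HM.
  by apply: near_continuous (C i x Ox); apply: open_eq_near Ox _ => // y; exact: fg.
have fgn i x : O x -> {near x, f i =1 g i}.
  by move=> Ox; apply: open_eq_near Ox _ => // y; exact: fg.
split => // [|i x Ox|].
- by have [M HM] := B; exists M => i x Ox; rewrite -fg // HM.
- by apply: near_continuous (C i x Ox); exact: fgn.
- case: D => D P; split => [i j x Ox|j].
    by apply: near_drv (D i j x Ox); exact: fgn.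
  by apply: IH (P j) => i x Ox; apply: near_partial; exact: fgn.
Qed.

Lemma UB_cst m (k : I -> R) M : (forall i, `|k i| <= M) -> UB O m (fun i _ => k i).
Proof.
have UB0 m' : UB O m' (fun (i : I) _ => 0).
  elim: m' => [|m' IH]; split => //.
  - by exists 0 => i x _; rewrite normr0.
  - by move=> i x _; exact: cont_cst.
  - by exists 0 => i x _; rewrite normr0.
  - by move=> i x _; exact: cont_cst.
  - split => [i j x _|j]; first exact: drv_cst.
    by apply: eq_UB IH => i x _; rewrite partial_cst.
move=> kM; case: m => [|m]; split => //.
- by exists M => i x _.
- by move=> i x _; exact: cont_cst.
- by exists M => i x _.
- by move=> i x _; exact: cont_cst.
- split => [i j x _|j]; first exact: drv_cst.
  by apply: eq_UB (UB0 m) => i x _; rewrite partial_cst.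
Qed.

Lemma UBD m f g : UB O m f -> UB O m g -> UB O m (fun i x => f i x + g i x).
Proof.
elim: m f g => [|m IH] f g [[M1 B1] C1 D1] [[M2 B2] C2 D2]; split => //.
- by exists (M1 + M2) => i x Ox; rewrite (le_trans (ler_normD _ _)) // lerD ?B1 ?B2.
- by move=> i x Ox; apply: contD; [exact: C1|exact: C2].
- by exists (M1 + M2) => i x Ox; rewrite (le_trans (ler_normD _ _)) // lerD ?B1 ?B2.
- by move=> i x Ox; apply: contD; [exact: C1|exact: C2].
- case: D1 => D1 P1; case: D2 => D2 P2; split => [i j x Ox|j].
    by apply: drvD; [exact: D1|exact: D2].
  by apply: eq_UB (IH _ _ (P1 j) (P2 j)) => i x Ox; rewrite partialD //; auto.
Qed.

Lemma UBM m f g : UB O m f -> UB O m g -> UB O m (fun i x => f i x * g i x).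
Proof.
elim: m f g => [|m IH] f g Uf Ug; have := Uf; have := Ug;
  move=> [[M1 B1] C1 D1] [[M2 B2] C2 D2]; split => //.
- by exists (M2 * M1) => i x Ox; rewrite normrM ler_pM ?B1 ?B2.
- by move=> i x Ox; apply: contM; [exact: C2|exact: C1].
- by exists (M2 * M1) => i x Ox; rewrite normrM ler_pM ?B1 ?B2.
- by move=> i x Ox; apply: contM; [exact: C2|exact: C1].
- case: D1 => D1 P1; case: D2 => D2 P2; split => [i j x Ox|j].
    by apply: drvM; [exact: D2|exact: D1].
  apply: (eq_UB (f := fun i x => partial j (f i) x * g i x + f i x * partial j (g i) x)).
    by move=> i x Ox; rewrite partialM //; auto.
  exact: UBD (IH _ _ (UB_partial j Uf) (UBS Ug)) (IH _ _ (UBS Uf) (UB_partial j Ug)).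
Qed.

Lemma UBZ m k f : UB O m f -> UB O m (fun i x => k * f i x).
Proof. by move=> Uf; apply: UBM Uf; apply: (@UB_cst _ _ `|k|). Qed.

Lemma UBN m f : UB O m f -> UB O m (fun i x => - f i x).
Proof. by move=> Uf; apply: eq_UB (UBZ (-1) Uf) => i x _; rewrite mulN1r. Qed.

Lemma UBB m f g : UB O m f -> UB O m g -> UB O m (fun i x => f i x - g i x).
Proof. by move=> Uf Ug; apply: UBD => //; exact: UBN. Qed.

Lemma UB_sum m (J : Type) (r : seq J) (f : J -> I -> V -> R) :
  (forall k, UB O m (f k)) -> UB O m (fun i x => \sum_(k <- r) f k i x).
Proof.
move=> Uf; elim: r => [|k r IH].
  have Z : UB O m (fun (_ : I) _ => 0) by apply: (@UB_cst _ _ 0) => i; rewrite normr0.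
  by apply: eq_UB Z => i x _; rewrite big_nil.
by apply: eq_UB (UBD (Uf k) IH) => i x _; rewrite big_cons.
Qed.

(** The derivative of 1/f is -(1/f)(1/f)f', so order m for 1/f and order m+1 for f give order m+1
    for 1/f; the lower bound [d] supplies the sup norm. *)
Lemma UBV m f d : 0 < d -> (forall i x, O x -> d <= `|f i x|) ->
  UB O m f -> UB O m (fun i x => (f i x)^-1).
Proof.
move=> d0 fd; have fn0 i x : O x -> f i x != 0.
  by move=> /(fd i) H; rewrite -normr_gt0 (lt_le_trans d0).
have BV : exists M : R, forall i x, O x -> `|(f i x)^-1| <= M.
  exists d^-1 => i x Ox; rewrite normfV lef_pV2 ?posrE ?fd //.
  by rewrite normr_gt0 fn0.
elim: m f fd fn0 BV => [|m IH] f fd fn0 BV Uf; have := Uf; move=> [B C D]; split => //.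
- by move=> i x Ox; apply: contV; [exact: fn0|exact: C].
- by move=> i x Ox; apply: contV; [exact: fn0|exact: C].
- case: D => D P; split => [i j x Ox|j].
    by apply: derivableV; [exact: fn0|exact: D].
  have UV := IH f fd fn0 BV (UBS Uf).
  apply: (eq_UB (f := fun i x => - ((f i x)^-1 * ((f i x)^-1 * partial j (f i) x)))).
    move=> i x Ox; rewrite /partial deriveV ?fn0 //; last exact: D.
    by rewrite /GRing.scale /= mulNr mulrA expr2 invfM.
  exact: UBN (UBM UV (UBM UV (UB_partial j Uf))).
Qed.
End UBtheory.

Lemma UB_subset I O O' m (h : I -> V -> R) : O' `<=` O -> UB O m h -> UB O' m h.
Proof.
move=> OO; elim: m h => [|m IH] h [[M B] C D]; split => //.
- by exists M => i x /OO; exact: B.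
- by move=> i x /OO; exact: C.
- by exists M => i x /OO; exact: B.
- by move=> i x /OO; exact: C.
- case: D => D P; split => [i j x /OO|j]; first exact: D.
  exact: IH (P j).
Qed.

Lemma UB_reindex I J (s : J -> I) O m (h : I -> V -> R) : UB O m h ->
  UB O m (fun k => h (s k)).
Proof.
elim: m h => [|m IH] h [[M B] C D]; split => //.
- by exists M => i x; exact: B.
- by move=> i x; exact: C.
- by exists M => i x; exact: B.
- by move=> i x; exact: C.
- case: D => D P; split => [i j x|j]; first exact: D.
  exact: IH (P j).
Qed.

Lemma vanish_partial (K : set V) j (f : V -> R) : closed K ->
  (forall x, ~ K x -> f x = 0) -> forall x, ~ K x -> partial j f x = 0.
Proof.
move=> cK f0 x Kx; rewrite -[RHS](partial_cst j 0 x); apply: near_partial.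
by apply: (open_eq_near (O := ~` K)) => //; rewrite openC.
Qed.

(** [O] and the complement of [K] are open and cover the space. Near a point outside [O] the
    functions are identically 0, so extension by zero stays smooth. *)
Lemma UB_vanish I (K O : set V) m (h : I -> V -> R) : closed K -> K `<=` O ->
  (forall i x, ~ K x -> h i x = 0) -> UB O m h -> UB setT m h.
Proof.
move=> cK KO.
have near0 (f : V -> R) : (forall x, ~ K x -> f x = 0) ->
    forall x, ~ O x -> {near x, (fun=> 0) =1 f}.
  move=> f0 x Ox; apply: (open_eq_near (O := ~` K)); rewrite ?openC //.
    by move=> Kx; apply: Ox; exact: KO.
  by move=> y Ky; rewrite f0.
have bd (f : I -> V -> R) : (forall i x, ~ K x -> f i x = 0) ->
    (exists M : R, forall i x, O x -> `|f i x| <= M) ->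
    exists M : R, forall i x, setT x -> `|f i x| <= M.
  move=> f0 [M B]; exists `|M| => i x _.
  have [Kx|Kx] := pselect (K x); last by rewrite f0 // normr0.
  by rewrite (le_trans (B i x (KO x Kx))) // ler_norm.
have ct (f : I -> V -> R) : (forall i x, ~ K x -> f i x = 0) ->
    (forall i x, O x -> {for x, continuous (f i)}) ->
    (forall i x, setT x -> {for x, continuous (f i)}).
  move=> f0 C i x _; have [Ox|Ox] := pselect (O x); first exact: C.
  by apply: near_continuous (near0 _ (f0 i) x Ox) _; exact: cont_cst.
elim: m h => [|m IH] h h0 [B C D]; split; [exact: bd|exact: ct|by []|exact: bd|exact: ct|].
case: D => D P; split => [i j x _|j]; last first.
  by apply: IH (P j) => i; exact: (vanish_partial j cK (h0 i)).
have [Ox|Ox] := pselect (O x); first exact: D.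
by apply: near_drv (near0 _ (h0 i) x Ox) _; exact: drv_cst.
Qed.

(** [dpartial] applies the last index of the list first, which is the derivative that [UB] peels
    off; inductions on lists therefore run from the right end. *)
Lemma dpartial_rcons l j (h : V -> R) : dpartial (rcons l j) h = dpartial l (partial j h).
Proof. by elim: l => //= i l ->. Qed.

Lemma UB_CmR I O m (h : I -> V -> R) i : UB O m h -> CmR m O (h i).
Proof.
move=> + l; elim/last_ind: l m h => [|l j IH] m h U.
  move=> _ /=; split; first by move=> x Ox; exact: (UB_continuous U).
  by case: m U => // m U _ j x Ox; exact: (UB_drv U).
rewrite size_rcons dpartial_rcons; case: m U => // m U lm.
exact: (IH m (fun i => partial j (h i)) (UB_partial j U)).
Qed.

Lemma CmRS m O (h : V -> R) j : CmR m.+1 O h -> CmR m O (partial j h).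
Proof. move=> H l lm; have := H (rcons l j); rewrite size_rcons dpartial_rcons !ltnS.
exact. Qed.

Lemma continuous_compact_bounded (K : set V) (h : V -> R) : compact K ->
  (forall x, K x -> {for x, continuous h}) -> exists M : R, forall x, K x -> `|h x| <= M.
Proof.
move=> cK ch.
have : compact (h @` K).
  apply: continuous_compact => //; apply: continuous_in_subspaceT => x.
  by rewrite inE; exact: ch.
move=> /compact_bounded[M [_ HM]]; exists (`|M| + 1) => x Kx.
have M1 : M < `|M| + 1 by rewrite (le_lt_trans (ler_norm _)) // ltrDl.
by apply: (HM _ M1); exists x.
Qed.

Lemma CmR_UB (I : Type) m O Q (h : V -> R) : CmR m O h -> compact (closure Q) ->
  closure Q `<=` O -> UB Q m (fun _ : I => h).
Proof.
move=> + cQ QO; elim: m h => [|m IH] h H; have [C D] := H [::] isT.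
  split => // [|_ x Qx]; last exact/C/QO/subset_closure.
  have [M HM] := continuous_compact_bounded cQ (fun x Qx => C x (QO x Qx)).
  by exists M => _ x Qx; apply/HM/subset_closure.
split => // [|_ x Qx|].
- have [M HM] := continuous_compact_bounded cQ (fun x Qx => C x (QO x Qx)).
  by exists M => _ x Qx; apply/HM/subset_closure.
- exact/C/QO/subset_closure.
- split => [_ j x Qx|j]; last exact/IH/CmRS.
  by apply: D => //; exact/QO/subset_closure.
Qed.
End SmoothFamilies.

(** * Complex-valued families through real and imaginary parts *)

Section ComplexCalculus.
Context {R : realType} {n : nat}.
Local Notation V := 'rV[R]_n.
Local Notation C := R[i].
Implicit Types (O : set V) (j : 'I_n) (x : V).

Lemma cReD (z w : C) : cRe (z + w) = cRe z + cRe w. Proof. by case: z; case: w. Qed.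
Lemma cImD (z w : C) : cIm (z + w) = cIm z + cIm w. Proof. by case: z; case: w. Qed.
Lemma cReN (z : C) : cRe (- z) = - cRe z. Proof. by case: z. Qed.
Lemma cImN (z : C) : cIm (- z) = - cIm z. Proof. by case: z. Qed.
Lemma cReB (z w : C) : cRe (z - w) = cRe z - cRe w. Proof. by rewrite cReD cReN. Qed.
Lemma cImB (z w : C) : cIm (z - w) = cIm z - cIm w. Proof. by rewrite cImD cImN. Qed.
Lemma cReM (z w : C) : cRe (z * w) = cRe z * cRe w - cIm z * cIm w.
Proof. by case: z; case: w. Qed.
Lemma cImM (z w : C) : cIm (z * w) = cRe z * cIm w + cIm z * cRe w.
Proof. by case: z; case: w. Qed.
Lemma cRe0 : cRe (0 : C) = 0. Proof. by []. Qed.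
Lemma cRe_real (r : R) : cRe (real_complex R r) = r. Proof. by []. Qed.
Lemma cIm_real (r : R) : cIm (real_complex R r) = 0. Proof. by []. Qed.
Lemma cRe_sum (J : Type) (r : seq J) (P : pred J) (F : J -> C) :
  cRe (\sum_(k <- r | P k) F k) = \sum_(k <- r | P k) cRe (F k).
Proof. by apply: (big_morph (@cRe R)) => // z w; exact: cReD. Qed.
Lemma cIm_sum (J : Type) (r : seq J) (P : pred J) (F : J -> C) :
  cIm (\sum_(k <- r | P k) F k) = \sum_(k <- r | P k) cIm (F k).
Proof. by apply: (big_morph (@cIm R)) => // z w; exact: cImD. Qed.
Lemma eq_cReIm (z w : C) : cRe z = cRe w -> cIm z = cIm w -> z = w.
Proof. by case: z => a b; case: w => c d /= -> ->. Qed.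

Definition cdrv j (h : V -> C) x :=
  drv j (fun y => cRe (h y)) x /\ drv j (fun y => cIm (h y)) x.

Lemma eq_drv j (f g : V -> R) x : f =1 g -> drv j f x -> drv j g x.
Proof. by move=> /funext ->. Qed.
Lemma eq_partial j (f g : V -> R) x : f =1 g -> partial j f x = partial j g x.
Proof. by move=> /funext ->. Qed.

Lemma cdrvM j f g x : cdrv j f x -> cdrv j g x -> cdrv j (fun y => f y * g y) x.
Proof.
move=> [f1 f2] [g1 g2]; split.
  by apply: eq_drv (drvD (drvM f1 g1) (drvN (drvM f2 g2))) => y; rewrite cReM.
by apply: eq_drv (drvD (drvM f1 g2) (drvM f2 g1)) => y; rewrite cImM.
Qed.

Lemma cdrv_cst j k x : cdrv j (fun=> k) x.
Proof. by split; exact: drv_cst. Qed.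

Lemma cpartialD j f g x : cdrv j f x -> cdrv j g x ->
  cpartial j (fun y => f y + g y) x = cpartial j f x + cpartial j g x.
Proof.
move=> [f1 f2] [g1 g2]; apply: eq_cReIm; rewrite ?cReD ?cImD /=.
  by rewrite -(partialD f1 g1); apply: eq_partial => y; rewrite cReD.
by rewrite -(partialD f2 g2); apply: eq_partial => y; rewrite cImD.
Qed.

Lemma cpartialM j f g x : cdrv j f x -> cdrv j g x ->
  cpartial j (fun y => f y * g y) x = cpartial j f x * g x + f x * cpartial j g x.
Proof.
move=> [f1 f2] [g1 g2]; apply: eq_cReIm; rewrite ?cReD ?cImD ?cReM ?cImM /=.
  transitivity (partial j (fun y => cRe (f y) * cRe (g y) + - (cIm (f y) * cIm (g y))) x).
    by apply: eq_partial => y; rewrite cReM.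
  rewrite (partialD (drvM f1 g1) (drvN (drvM f2 g2))) (partialN (drvM f2 g2)).
  rewrite (partialM f1 g1) (partialM f2 g2).
  by rewrite /cRe /cIm /=; ring.
transitivity (partial j (fun y => cRe (f y) * cIm (g y) + cIm (f y) * cRe (g y)) x).
  by apply: eq_partial => y; rewrite cImM.
rewrite (partialD (drvM f1 g2) (drvM f2 g1)) (partialM f1 g2) (partialM f2 g1).
by rewrite /cRe /cIm /=; ring.
Qed.

Lemma cpartial_cst j k x : cpartial j (fun=> k) x = 0.
Proof. by apply: eq_cReIm; rewrite /= partial_cst. Qed.

Definition CUB (I : Type) O m (h : I -> V -> C) : Prop :=
  UB O m (fun i x => cRe (h i x)) /\ UB O m (fun i x => cIm (h i x)).

Section CUBtheory.
Variables (I : Type) (O : set V) (OO : open O).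
Implicit Types (f g h : I -> V -> C).

Lemma eq_CUB m f g : (forall i x, O x -> f i x = g i x) -> CUB O m f -> CUB O m g.
Proof. by move=> fg [U1 U2]; split; [move: U1|move: U2]; apply: eq_UB => // i x Ox; rewrite fg. Qed.

Lemma CUBD m f g : CUB O m f -> CUB O m g -> CUB O m (fun i x => f i x + g i x).
Proof.
move=> [f1 f2] [g1 g2]; split.
  by apply: (eq_UB OO) (UBD OO f1 g1) => i x _; rewrite cReD.
by apply: (eq_UB OO) (UBD OO f2 g2) => i x _; rewrite cImD.
Qed.

Lemma CUBM m f g : CUB O m f -> CUB O m g -> CUB O m (fun i x => f i x * g i x).
Proof.
move=> [f1 f2] [g1 g2]; split.
  by apply: (eq_UB OO) (UBB OO (UBM OO f1 g1) (UBM OO f2 g2)) => i x _; rewrite cReM.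
by apply: (eq_UB OO) (UBD OO (UBM OO f1 g2) (UBM OO f2 g1)) => i x _; rewrite cImM.
Qed.

Lemma CUBN m f : CUB O m f -> CUB O m (fun i x => - f i x).
Proof.
move=> [f1 f2]; split.
  by apply: (eq_UB OO) (UBN OO f1) => i x _; rewrite cReN.
by apply: (eq_UB OO) (UBN OO f2) => i x _; rewrite cImN.
Qed.

Lemma CUB_cst m (k : I -> C) M : (forall i, `|cRe (k i)| <= M /\ `|cIm (k i)| <= M) ->
  CUB O m (fun i _ => k i).
Proof. by move=> kM; split; apply: (@UB_cst _ _ _ _ OO _ _ M) => i; case: (kM i). Qed.

Lemma CUB_real m (f : I -> V -> R) : UB O m f -> CUB O m (fun i x => real_complex R (f i x)).
Proof.
move=> Uf; split; first exact: Uf.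
by apply: (@UB_cst _ _ _ _ OO _ _ 0) => i; rewrite /= normr0.
Qed.

Lemma CUB_sum m (J : Type) (r : seq J) (f : J -> I -> V -> C) :
  (forall k, CUB O m (f k)) -> CUB O m (fun i x => \sum_(k <- r) f k i x).
Proof.
move=> Uf; split.
  apply: (eq_UB OO) (UB_sum OO r (fun k => (Uf k).1)) => i x _.
  by rewrite cRe_sum.
apply: (eq_UB OO) (UB_sum OO r (fun k => (Uf k).2)) => i x _.
by rewrite cIm_sum.
Qed.

Lemma CUB_partial m f j : CUB O m.+1 f -> CUB O m (fun i => cpartial j (f i)).
Proof. by move=> [f1 f2]; split; [exact: UB_partial f1|exact: UB_partial f2]. Qed.

Lemma CUB_cdrv m f i j x : CUB O m.+1 f -> O x -> cdrv j (f i) x.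
Proof. by move=> [f1 f2] Ox; split; [exact: (UB_drv f1)|exact: (UB_drv f2)]. Qed.

Lemma CUBV m f d : 0 < d -> (forall i x, O x -> d <= cRe (f i x)) ->
  CUB O m f -> CUB O m (fun i x => (f i x)^-1).
Proof.
move=> d0 fd [f1 f2].
have N2 i x : O x -> d ^+ 2 <= `|cRe (f i x) * cRe (f i x) + cIm (f i x) * cIm (f i x)|.
  move=> Ox; rewrite ger0_norm; last by rewrite addr_ge0 // -expr2 sqr_ge0.
  rewrite -!expr2 -[leLHS]addr0 lerD ?sqr_ge0 //.
  by rewrite ler_sqr ?nnegrE ?fd // ltW // (lt_le_trans d0) // fd.
have UN := UBV OO (exprn_gt0 2 d0) N2 (UBD OO (UBM OO f1 f1) (UBM OO f2 f2)).
split.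
  apply: (eq_UB OO) (UBM OO f1 UN) => i x _.
  by case: (f i x) => a b; rewrite /cRe /cIm /= !expr2.
apply: (eq_UB OO) (UBN OO (UBM OO f2 UN)) => i x _.
by case: (f i x) => a b; rewrite /cRe /cIm /= !expr2 ?mulNr.
Qed.
End CUBtheory.

Lemma CUB_subset I O O' m (h : I -> V -> C) : O' `<=` O -> CUB O m h -> CUB O' m h.
Proof. by move=> S [h1 h2]; split; exact: UB_subset S _. Qed.

Lemma CUB_reindex I J (s : J -> I) O m (h : I -> V -> C) : CUB O m h ->
  CUB O m (fun k => h (s k)).
Proof.
by move=> [h1 h2]; split; [exact: (UB_reindex s h1)|exact: (UB_reindex s h2)].
Qed.

Lemma CUB_vanish I (K O : set V) m (h : I -> V -> C) : closed K -> K `<=` O ->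
  (forall i x, ~ K x -> h i x = 0) -> CUB O m h -> CUB setT m h.
Proof.
move=> cK KO h0 [h1 h2]; split; apply: UB_vanish cK KO _ _ => // i x Kx;
  by rewrite h0.
Qed.

Lemma vanish_cpartial (K : set V) j (f : V -> C) : closed K ->
  (forall x, ~ K x -> f x = 0) -> forall x, ~ K x -> cpartial j f x = 0.
Proof.
move=> cK f0 x Kx; apply: eq_cReIm => /=;
  by apply: (vanish_partial j cK _ Kx) => y Ky; rewrite f0.
Qed.
End ComplexCalculus.

(** * Cutoff functions *)

Section FlatFunction.
Context {R : realType}.

(* t^-k exp(-1/t) extended by 0 : the derivatives of exp(-1/t) are combinations of these *)
Definition flat (k : nat) (t : R) : R := if 0 < t then t ^- k * expR (- t^-1) else 0.

Lemma flat_ge0 k t : 0 <= flat k t.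
Proof.
rewrite /flat; case: ifP => // t0.
by rewrite mulr_ge0 ?expR_ge0 // invr_ge0 exprn_ge0 // ltW.
Qed.

(** From exp(s) >= s at s = 1/((k+1)t), raised to the power k+1: exp(1/t) is at least
    ((k+1)t)^-(k+1), which beats t^-k by one factor t. *)
Lemma flat_le k t : flat k t <= k.+1%:R ^+ k.+1 * `|t|.
Proof.
rewrite /flat; case: ifP => [t0|_]; last by rewrite mulr_ge0 // exprn_ge0.
rewrite (ger0_norm (ltW t0)) expRN ler_pdivrMl ?exprn_gt0 //.
have -> : t ^+ k * (k.+1%:R ^+ k.+1 * t) = (k.+1%:R * t) ^+ k.+1.
  by rewrite exprMn [t ^+ k.+1]exprSr; ring.
have Nt : 0 < k.+1%:R * t by rewrite mulr_gt0 ?ltr0Sn.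
rewrite -[leRHS]invrK lef_pV2 ?posrE ?expR_gt0 ?invr_gt0 ?exprn_gt0 // -exprVn.
have -> : expR t^-1 = expR (k.+1%:R * t)^-1 ^+ k.+1.
  by rewrite -expRM_natl invfM mulrA mulfV ?mul1r // pnatr_eq0.
apply: lerXn2r; rewrite ?nnegrE ?expR_ge0 ?invr_ge0 ?(ltW Nt) //.
by apply: le_trans (expR_ge1Dx _); rewrite lerDr.
Qed.

Lemma flat_is_derive k (t : R) :
  is_derive t 1 (flat k) (- k%:R * flat k.+1 t + flat k.+2 t).
Proof.
have [t0|t0|t0] := ltgtP t 0.
- have E : {near t, (fun=> 0) =1 flat k}.
    near=> s; rewrite /flat ifF //; apply/negbTE; rewrite -leNgt ltW //.
    by near: s; exact: lt_nbhsl.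
  apply: near_eq_is_derive E _; rewrite /flat !ifF ?mulr0 ?addr0; last 2 first.
  + by apply/negbTE; rewrite -leNgt ltW.
  + by apply/negbTE; rewrite -leNgt ltW.
  exact: is_derive_cst.
- have E : {near t, (fun t : R => t ^- k * expR (- t^-1)) =1 flat k}.
    near=> s; rewrite /flat ifT //.
    by near: s; exact: lt_nbhsr.
  apply: near_eq_is_derive E _; rewrite /flat !ifT //.
  have tn0 : t != 0 by rewrite gt_eqF.
  have H1 : is_derive t 1 (fun s : R => s^-1) (- t ^- 2).
    apply: DeriveDef; first by apply: derivableV => //; exact: derivable_id.
    by rewrite deriveV // ?derive_id /GRing.scale /= ?mulr1 //; exact: derivable_id.
  have H2 := is_deriveM (is_deriveX k H1)
    (@is_derive1_comp R expR (- (fun s : R => s^-1)) t _ _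
      (is_derive_expR (- t^-1)) (is_deriveN H1)).
  have -> : (fun s : R => s ^- k * expR (- s^-1)) =
      ((fun s : R => s^-1) ^+ k * (expR \o - (fun s : R => s^-1))).
    by apply/funext => s; rewrite /= -exprVn fctE exprfctE /=.
  apply: is_derive_eq.
  rewrite exprfctE /GRing.scale /= opprK.
  have -> : (- (fun s : R => s^-1)) t = - t^-1 by [].
  clear H2; rewrite -!exprVn.
  have [k0|k0] := posnP k; first by rewrite k0 mulr0n oppr0 !mul0r mulr0 addr0 add0r expr0; ring.
  move: (t^-1) (expR _) => u E; case: (k) k0 => // j _ /=.
  rewrite !exprS expr0.
  have ringE (N u0 E0 v : R) : u0 * v * (E0 * (u0 * (u0 * 1))) +
    E0 * (N * v * - (u0 * (u0 * 1))) = - N * (u0 * (u0 * v) * E0) + u0 * (u0 * (u0 * v)) * E0.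
    ring.
  exact: ringE.
- rewrite t0; set f0 := (X in is_derive _ _ _ X).
  have -> : f0 = 0 by rewrite /f0 /flat ltxx mulr0 addr0.
  have C : h^-1 *: ((flat k \o shift 0) (h *: 1) - flat k 0) @[h --> 0^'] --> (0 : R).
    apply/cvgrPdist_le => e e0.
    near=> h; rewrite /= sub0r normrN addr0 {2}/flat ltxx subr0 /GRing.scale /= mulr1.
    (* At 0 the difference quotient of [flat k] is [flat k.+1] itself, which [flat_le] sends to
       0. *)
    have -> : h^-1 * flat k h = flat k.+1 h.
      rewrite /flat; case: ifP => [h0|]; last by rewrite mulr0.
      by rewrite mulrA -!exprVn exprS.
    rewrite ger0_norm ?flat_ge0 // (le_trans (flat_le _ _)) //.
    rewrite mulrC -ler_pdivlMr ?exprn_gt0 ?ltr0Sn //.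
    near: h; apply: dnbhs0_le; rewrite divr_gt0 ?exprn_gt0 ?ltr0Sn //.
  apply: DeriveDef; first by apply/cvg_ex; exists 0.
  by rewrite /derive; apply/cvg_lim.
Unshelve. all: by end_near. Qed.

Lemma flat_pos (t : R) : 0 < t -> 0 < flat 0 t.
Proof. by move=> t0; rewrite /flat t0 expr0 invr1 mul1r expR_gt0. Qed.

Lemma flat0 k (t : R) : t <= 0 -> flat k t = 0.
Proof. by move=> t0; rewrite /flat ltNge t0. Qed.

Lemma flat_mono (s t : R) : s <= t -> flat 0 s <= flat 0 t.
Proof.
move=> st; have [s0|s0] := leP s 0; first by rewrite flat0 ?flat_ge0.
have t0 := lt_le_trans s0 st.
rewrite /flat s0 t0 !expr0 invr1 !mul1r ler_expR lerN2.
by rewrite lef_pV2.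
Qed.
End FlatFunction.

Section LineComposition.
Context {R : realType}.

(** Affinity of [g] along one line is enough, which covers coordinates, rescaled coordinates and
    [dot w]. *)
Lemma is_derive_affine_comp (V : normedModType R) (f : R -> R) (f' : R) (g : V -> R) (x v : V) (c : R) :
  (forall h : R, g (h *: v + x) = h * c + g x) -> is_derive (g x) 1 f f' ->
  derivable (fun y => f (g y)) x v /\ derive (fun y => f (g y)) x v = c * f'.
Proof.
move=> gl df.
have dif : differentiable f (g x) by apply/derivable1_diffP; exact: ex_derive.
have [E1 E2] := @derive_line _ V R (fun y => f (g y)) f x v (g x) c
  (fun h => congr1 f (gl h)).
split; first by apply/E1; exact: diff_derivable.
rewrite E2 deriveE //.
have -> : c = c *: (1 : R) by rewrite /GRing.scale /= mulr1.
by rewrite linearZ -deriveE // derive_val /GRing.scale /= mulr1.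
Qed.
End LineComposition.

Section Bump.
Context {R : realType} {n : nat}.
Local Notation V := 'rV[R]_n.

Lemma row_line (x : V) (h : R) (i j : 'I_n) :
  (h *: ev j + x) ord0 i = h * (i == j)%:R + x ord0 i.
Proof. by rewrite !mxE. Qed.

(** Differentiation turns [flat k] into a combination of [flat k.+1] and [flat k.+2], so the
    induction on [m] runs over all [k] at once. The bound on the coordinate enters because the bound
    of [flat_le] grows linearly. *)
Lemma UB_flat I (O : set V) m k (i : 'I_n) (al be B : R) : open O ->
  (forall x, O x -> `|x ord0 i| <= B) ->
  UB O m (fun (_ : I) (x : V) => flat k (al * x ord0 i + be)).
Proof.
move=> OO OB.
have cf k' (x : V) : {for x, continuous (fun x : V => flat k' (al * x ord0 i + be))}.
  have dg := is_derive_affine_comp (V := R) (g := id) (x := al * x ord0 i + be) (v := 1) (c := 1).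
  have ctf : {for al * x ord0 i + be, continuous (flat k')}.
    apply: differentiable_continuous; apply/derivable1_diffP.
    by case: (flat_is_derive k' (al * x ord0 i + be)).
  apply: (@continuous_comp _ _ _ (fun x : V => al * x ord0 i + be) (flat k')) => //.
  apply: contD; last exact: cont_cst.
  by apply: contM; [exact: cont_cst|exact: coord_continuous].
have bf k' : exists M : R, forall (_ : I) x, O x -> `|flat k' (al * x ord0 i + be)| <= M.
  exists (k'.+1%:R ^+ k'.+1 * (`|al| * B + `|be|)) => _ x Ox.
  rewrite ger0_norm ?flat_ge0 // (le_trans (flat_le _ _)) // ler_wpM2l ?exprn_ge0 //.
  by rewrite (le_trans (ler_normD _ _)) // lerD2r normrM ler_wpM2l // OB.
have df k' (x : V) j : drv j (fun x : V => flat k' (al * x ord0 i + be)) x /\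
   partial j (fun x : V => flat k' (al * x ord0 i + be)) x =
   al * (i == j)%:R * (- k'%:R * flat k'.+1 (al * x ord0 i + be)
                       + flat k'.+2 (al * x ord0 i + be)).
  apply: (@is_derive_affine_comp _ V (flat k') _ (fun x : V => al * x ord0 i + be)).
    by move=> h; rewrite row_line; ring.
  exact: flat_is_derive.
elim: m k => [|m IH] k; split => //; split => [_ j x _|j]; first by have [] := df k x j.
have U : UB O m (fun (_ : I) (x : V) => al * (i == j)%:R *
   (- k%:R * flat k.+1 (al * x ord0 i + be) + flat k.+2 (al * x ord0 i + be))).
  exact: (UBZ OO _ (UBD OO (UBZ OO (- k%:R) (IH k.+1)) (IH k.+2))).
by apply: (eq_UB OO) U => _ x _; have [_ ->] := df k x j.
Qed.

Lemma UB_prod I (O : set V) m (J : Type) (r : seq J) (f : J -> I -> V -> R) : open O ->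
  (forall k, UB O m (f k)) -> UB O m (fun i x => \prod_(k <- r) f k i x).
Proof.
move=> OO Uf; elim: r => [|k r IH].
  have Z : UB O m (fun (_ : I) _ => 1) by apply: (@UB_cst _ _ _ _ OO _ _ 1) => i; rewrite normr1.
  by apply: (eq_UB OO) Z => i x _; rewrite big_nil.
by apply: (eq_UB OO) (UBM OO (Uf k) IH) => i x _; rewrite big_cons.
Qed.

(** A quotient P/(P+E) where P vanishes off (-2,2) and E vanishes on [-1,1]: it is 1 on [-1,1] and 0
    off (-2,2), without integrating a mollifier. *)
Definition bump1 (t : R) : R :=
  flat 0 (2 + t) * flat 0 (2 - t) /
  (flat 0 (2 + t) * flat 0 (2 - t) + (flat 0 (t - 1) + flat 0 (- t - 1))).

Lemma bump1_eq1 t : `|t| <= 1 -> bump1 t = 1.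
Proof.
rewrite ler_norml => /andP[h1 h2]; rewrite /bump1.
rewrite [flat 0 (t - 1)]flat0 ?[flat 0 (- t - 1)]flat0 ?addr0; [|lra..].
by rewrite divff // gt_eqF // mulr_gt0 // flat_pos //; lra.
Qed.

Lemma bump1_eq0 t : 2 <= `|t| -> bump1 t = 0.
Proof.
rewrite ler_normr => H; rewrite /bump1.
suff -> : flat 0 (2 + t) * flat 0 (2 - t) = 0 by rewrite mul0r.
by case/orP: H => H; [rewrite [flat 0 (2 - t)]flat0 ?mulr0|rewrite flat0 ?mul0r]; lra.
Qed.

Definition bump_den_min : R := Num.min (flat 0 (2^-1) * flat 0 (2^-1)) (flat 0 (2^-1)).

Lemma bump_den_min_gt0 : 0 < bump_den_min.
Proof.
have h : 0 < flat 0 (2^-1 : R) by apply: flat_pos; rewrite invr_gt0.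
by rewrite /bump_den_min lt_min h mulr_gt0.
Qed.

(** The threshold 3/2 lies midway between 1 and 2: below it both 2+t and 2-t are at least 1/2, above
    it |t|-1 is. *)
Lemma bump_den_ge t : bump_den_min <=
  flat 0 (2 + t) * flat 0 (2 - t) + (flat 0 (t - 1) + flat 0 (- t - 1)).
Proof.
have fp s : 0 <= flat 0 (s : R) by exact: flat_ge0.
have [H|H] := leP `|t| (2^-1 * 3).
  rewrite ge_min; apply/orP; left.
  move: H; rewrite ler_norml => /andP[h1 h2].
  rewrite -[leLHS]addr0 lerD ?addr_ge0 //.
  by rewrite ler_pM //; apply: flat_mono; lra.
rewrite ge_min; apply/orP; right.
rewrite -[leLHS]add0r lerD ?mulr_ge0 //.
move: H; rewrite lter_normr => /orP[H|H].
  by rewrite -[leLHS]addr0 lerD //; apply: flat_mono; lra.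
by rewrite -[leLHS]add0r lerD //; apply: flat_mono; lra.
Qed.

(** A product over coordinates, so that plateau and support are cubes, the shape of balls for the
    norm on rows. *)
Definition bump (c : V) (d : R) (x : V) : R :=
  \prod_(i < n) bump1 (d^-1 * x ord0 i + - d^-1 * c ord0 i).

Definition ccube (c : V) (d : R) : set V := [set x | forall i, `|x ord0 i - c ord0 i| <= d].

Lemma ball_sub_ccube c (d : R) : ball c d `<=` ccube c d.
Proof.
move=> x Bx i; have d0 : 0 < d by have [] := Bx.
by move: Bx; rewrite ball_rVE // => /(_ i) /=; rewrite distrC => /ltW.
Qed.

Lemma ccube_sub_ball c (d d' : R) : 0 < d' -> d < d' -> ccube c d `<=` ball c d'.
Proof.
move=> d0 dd x Hx; rewrite ball_rVE // => i /=; rewrite distrC.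
exact: le_lt_trans (Hx i) dd.
Qed.

Lemma ccube_closed c d : closed (ccube c d).
Proof.
have -> : ccube c d = \bigcap_(i in [set: 'I_n])
    ((fun x : V => x ord0 i - c ord0 i) @^-1` [set t | `|t| <= d]).
  by apply/seteqP; split => [x H i _|x H i]; [exact: H|exact: (H i I)].
apply: closed_bigI => i _; apply: closed_comp => [x _|].
  apply: contD; last exact: cont_cst.
  exact: coord_continuous.
rewrite (_ : [set t | _] = closed_ball_ (@Num.norm R R) 0 d); last first.
  by apply/seteqP; split => t; rewrite /closed_ball_ /= sub0r normrN.
exact: closed_closed_ball_.
Qed.

Lemma ccube_compact c d : compact (ccube c d).
Proof.
apply: bounded_closed_compact; last exact: ccube_closed.
exists (`|c| + (`|d| + 1)); split; first exact: num_real.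
move=> M cM x Hx.
have d1 : 0 < `|d| + 1 by rewrite ltr_wpDl.
have dd : d < `|d| + 1 by rewrite (le_lt_trans (ler_norm d)) // ltrDl.
have := ccube_sub_ball d1 dd Hx; rewrite -ball_normE /= => /ltW H.
rewrite (le_trans _ (ltW cM)) // -[x](subKr c) (le_trans (ler_normB _ _)) // lerD2l.
exact: H.
Qed.

Lemma closure_ball_sub c (d : R) : closure (ball c d) `<=` ccube c d.
Proof.
rewrite [X in _ `<=` X](proj1 (closure_id (ccube c d)) (@ccube_closed c d)).
exact: closureS (@ball_sub_ccube c d).
Qed.

Lemma closure_ball_compact (c : V) (d : R) : compact (closure (ball c d)).
Proof.
apply: (subclosed_compact _ (@ccube_compact c d)); first exact: closed_closure.
exact: closure_ball_sub.
Qed.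

Lemma bump_eq1 (c : V) (d : R) x : 0 < d -> ccube c d x -> bump c d x = 1.
Proof.
move=> d0 H; rewrite /bump big1 // => i _; apply: bump1_eq1.
rewrite mulNr -mulrBr normrM gtr0_norm ?invr_gt0 // ler_pdivrMl // mulr1.
exact: H.
Qed.

Lemma bump_eq0 c (d : R) x : 0 < d -> ~ ccube c (2 * d) x -> bump c d x = 0.
Proof.
move=> d0 /existsNP[i /negP]; rewrite -ltNge => H.
rewrite /bump (bigD1 i) //= bump1_eq0 ?mul0r //.
rewrite mulNr -mulrBr normrM gtr0_norm ?invr_gt0 // ler_pdivlMl // mulrC.
exact: ltW.
Qed.

Lemma UB_bump I m c (d : R) : 0 < d -> UB setT m (fun _ : I => bump c d).
Proof.
move=> d0.
have OO : open (ball c (3 * d)) by exact: ball_open.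
apply: (UB_vanish (K := ccube c (2 * d)) (O := ball c (3 * d))).
- exact: ccube_closed.
- by apply: ccube_sub_ball; rewrite ?mulr_gt0 // ltr_pM2r // ltr_nat.
- by move=> _ x; exact: bump_eq0.
apply: (@UB_prod I _ m 'I_n (index_enum _)
  (fun i _ x => bump1 (d^-1 * x ord0 i + - d^-1 * c ord0 i))) => // i.
have OB (x : V) : ball c (3 * d) x -> `|x ord0 i| <= `|c ord0 i| + 3 * d.
  move=> /ball_sub_ccube /(_ i) H.
  rewrite -[x ord0 i](subrK (c ord0 i)) addrC (le_trans (ler_normD _ _)) //.
  by rewrite lerD2l.
have F s e : UB (ball c (3 * d)) m (fun (_ : I) x =>
    flat 0 (s * (d^-1 * x ord0 i + - d^-1 * c ord0 i) + e)).
  apply: (eq_UB OO) (@UB_flat I _ m 0 i (s * d^-1) (s * (- d^-1 * c ord0 i) + e) _ OO OB).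
  by move=> _ x _; congr flat; ring.
have NU := UBM OO (F 1 2) (F (-1) 2).
have DU := UBD OO NU (UBD OO (F 1 (-1)) (F (-1) (-1))).
have ED (x : V) : let t := d^-1 * x ord0 i + - d^-1 * c ord0 i in
    flat 0 (1 * t + 2) * flat 0 (-1 * t + 2) + (flat 0 (1 * t + -1) + flat 0 (-1 * t + -1)) =
    flat 0 (2 + t) * flat 0 (2 - t) + (flat 0 (t - 1) + flat 0 (- t - 1)).
  by move=> t; congr (flat 0 _ * flat 0 _ + (flat 0 _ + flat 0 _)); ring.
have LB (x : V) : bump_den_min <= `|flat 0 (1 * (d^-1 * x ord0 i + - d^-1 * c ord0 i) + 2) *
    flat 0 (-1 * (d^-1 * x ord0 i + - d^-1 * c ord0 i) + 2) +
    (flat 0 (1 * (d^-1 * x ord0 i + - d^-1 * c ord0 i) + -1) +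
     flat 0 (-1 * (d^-1 * x ord0 i + - d^-1 * c ord0 i) + -1))|.
  rewrite ED ger0_norm ?bump_den_ge //.
  exact: le_trans (ltW bump_den_min_gt0) (bump_den_ge _).
have VU := UBV OO bump_den_min_gt0 (fun (_ : I) x _ => LB x) DU.
apply: (eq_UB OO) (UBM OO NU VU) => _ x _.
by rewrite ED /bump1; congr (_ / _); congr (flat 0 _ * flat 0 _); ring.
Qed.
End Bump.

Local Open Scope complex_scope.

(** * Exponentials and the parametrix step *)

Section Exponentials.
Context {R : realType} {n : nat}.
Local Notation V := 'rV[R]_n.
Local Notation C := R[i].

Definition dot (w x : V) : R := \sum_(i < n) w ord0 i * x ord0 i.
(** The exponential exp(-i w.x). *)
Definition wave (w x : V) : C := cos (dot w x) +i* (- sin (dot w x)).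

Lemma dotDl (v w x : V) : dot (v + w) x = dot v x + dot w x.
Proof. by rewrite /dot -big_split; apply: eq_bigr => i _; rewrite mxE mulrDl. Qed.

Lemma dotNl (w x : V) : dot (- w) x = - dot w x.
Proof. by rewrite /dot -sumrN; apply: eq_bigr => i _; rewrite mxE mulNr. Qed.

Lemma dot0l (x : V) : dot 0 x = 0.
Proof. by rewrite /dot big1 // => i _; rewrite mxE mul0r. Qed.

Lemma dot_line (w x : V) (j : 'I_n) (h : R) : dot w (h *: ev j + x) = h * w ord0 j + dot w x.
Proof.
rewrite /dot (eq_bigr (fun i => h * (w ord0 i * (i == j)%:R) + w ord0 i * x ord0 i)).
  rewrite big_split /= -mulr_sumr; congr (h * _ + _).
  rewrite (bigD1 j) //= eqxx mulr1 big1 ?addr0 // => i /negbTE ->.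
  by rewrite mulr0.
by move=> i _; rewrite row_line; ring.
Qed.

Lemma dot_continuous (w x : V) : {for x, continuous (dot w)}.
Proof.
rewrite /dot; elim: (index_enum _) => [|i r IH].
  rewrite (_ : (fun _ => _) = fun=> 0); first exact: cont_cst.
  by apply/funext => y; rewrite big_nil.
rewrite (_ : (fun _ => _) = fun y : V => w ord0 i * y ord0 i + \sum_(j <- r) w ord0 j * y ord0 j).
  apply: contD IH; apply: contM; first exact: cont_cst.
  exact: coord_continuous.
by apply/funext => y; rewrite big_cons.
Qed.

Lemma partial_cos_dot (w x : V) (j : 'I_n) : drv j (fun y => cos (dot w y)) x /\
  partial j (fun y => cos (dot w y)) x = - w ord0 j * sin (dot w x).
Proof.
have [D E] := @is_derive_affine_comp R V cos _ (dot w) x (ev j) (w ord0 j)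
  (dot_line w x j) (is_derive_cos _).
by split => //; rewrite /partial E mulrN mulNr.
Qed.

Lemma partial_sin_dot (w x : V) (j : 'I_n) : drv j (fun y => sin (dot w y)) x /\
  partial j (fun y => sin (dot w y)) x = w ord0 j * cos (dot w x).
Proof.
exact: (@is_derive_affine_comp R V sin _ (dot w) x (ev j) (w ord0 j)
  (dot_line w x j) (is_derive_sin _)).
Qed.

Lemma UB_cos_sin_dot I m (w : V) : UB setT m (fun (_ : I) x => cos (dot w x)) /\
  UB setT m (fun (_ : I) x => sin (dot w x)).
Proof.
have cc x : {for x, continuous (fun x : V => cos (dot w x))}.
  apply: (@continuous_comp _ _ _ (dot w) cos); first exact: dot_continuous.
  exact: continuous_cos.
have cs x : {for x, continuous (fun x : V => sin (dot w x))}.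
  apply: (@continuous_comp _ _ _ (dot w) sin); first exact: dot_continuous.
  exact: continuous_sin.
have bc : exists M : R, forall (_ : I) (x : V), setT x -> `|cos (dot w x)| <= M.
  by exists 1 => _ x _; rewrite ler_norml cos_geN1 cos_le1.
have bs : exists M : R, forall (_ : I) (x : V), setT x -> `|sin (dot w x)| <= M.
  by exists 1 => _ x _; rewrite ler_norml sin_geN1 sin_le1.
elim: m => [|m [IH1 IH2]]; first by split; split.
have oT := @openT V.
split; split => //; split => [_ j x _|j].
- by have [] := partial_cos_dot w x j.
- apply: (eq_UB oT) (UBZ oT (- w ord0 j) IH2) => _ x _.
  by have [_ ->] := partial_cos_dot w x j.
- by have [] := partial_sin_dot w x j.
- apply: (eq_UB oT) (UBZ oT (w ord0 j) IH1) => _ x _.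
  by have [_ ->] := partial_sin_dot w x j.
Qed.

Lemma CUB_wave I m (w : V) : CUB setT m (fun _ : I => wave w).
Proof.
have [h1 h2] := UB_cos_sin_dot I m w; split => //.
exact: (UBN (@openT V) h2).
Qed.

(** The number -i w_j, the symbol of differentiation along coordinate [j]. *)
Definition kap (w : V) (j : 'I_n) : C := 0 +i* (- w ord0 j).

Lemma cpartial_wave (w x : V) j : cdrv j (wave w) x /\
  cpartial j (wave w) x = kap w j * wave w x.
Proof.
have [dc Ec] := partial_cos_dot w x j; have [ds Es] := partial_sin_dot w x j.
split; first by split; [exact: dc|exact: (drvN ds)].
apply: eq_cReIm; rewrite ?cReM ?cImM /=.
  by rewrite Ec /cRe /cIm /=; ring.
have -> : partial j (fun y => - sin (dot w y)) x = - (w ord0 j * cos (dot w x)).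
  by rewrite (partialN ds) Es.
by rewrite /cRe /cIm /=; ring.
Qed.

Lemma waveD (v w x : V) : wave (v + w) x = wave v x * wave w x.
Proof.
rewrite /wave dotDl cosD sinD; apply: eq_cReIm; rewrite ?cReM ?cImM /cRe /cIm /=; ring.
Qed.

Lemma wave0 (x : V) : wave 0 x = 1.
Proof. by rewrite /wave dot0l cos0 sin0 oppr0. Qed.

Lemma wave_norm (w x : V) : cRe (wave w x) ^+ 2 + cIm (wave w x) ^+ 2 = 1.
Proof. by rewrite /cRe /cIm /= sqrrN cos2Dsin2. Qed.
End Exponentials.

(** * Inverting the adjoint on an amplitude times an exponential *)

Section ParametrixStep.
Context {R : realType} {n : nat}.
Local Notation V := 'rV[R]_n.
Local Notation C := R[i].
Variables (a : V -> 'M[C]_n) (b : V -> R) (Q K : set V).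
Hypotheses (oQ : open Q) (cK : closed K) (KQ : K `<=` Q).

(** [Lbar_adj] accepts only real test functions, while an amplitude times an exponential is
    complex. *)
Definition CLadj (phi : V -> C) : V -> C := fun x =>
  \sum_(mu < n) \sum_(nu < n)
    cpartial nu (fun y => a y mu nu * cpartial mu (fun z => (b z)%:C * phi z) y) x.

Definition sfam (I : Type) (p : I -> V -> C) : Prop :=
  (forall m, CUB Q m p) /\ (forall i x, ~ K x -> p i x = 0).

Lemma near_cpartial j (f g : V -> C) x : {near x, f =1 g} -> cpartial j f x = cpartial j g x.
Proof.
by move=> fg; apply: eq_cReIm => /=; apply: near_partial; apply: filterS fg => y ->.
Qed.

Lemma cpartialZ j (k : C) (f : V -> C) x : cdrv j f x ->
  cpartial j (fun y => k * f y) x = k * cpartial j f x.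
Proof.
by move=> df; rewrite (cpartialM (cdrv_cst j k x) df) cpartial_cst mul0r add0r.
Qed.

Lemma cpartial_wave_mul w j (f : V -> C) x : cdrv j f x ->
  cdrv j (fun y => wave w y * f y) x /\
  cpartial j (fun y => wave w y * f y) x = wave w x * (cpartial j f x + kap w j * f x).
Proof.
move=> df; have [dw Ew] := cpartial_wave w x j.
split; first exact: cdrvM.
by rewrite (cpartialM dw df) Ew; ring.
Qed.

Variables (I : Type) (w : I -> V) (h : I -> R).
Hypothesis h1 : forall i, 0 <= h i <= 1.
Variable Bth : R.
Hypothesis thB : forall i j, `|h i * w i ord0 j| <= Bth.
Hypothesis Ua : forall m mu nu, CUB Q m (fun (_ : I) x => a x mu nu).
Hypothesis Ub : forall m, UB Q m (fun (_ : I) x => b x).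
Variable d : R.
Hypothesis d0 : 0 < d.
Let th i j : R := h i * w i ord0 j.
Hypothesis ellip : forall i x, Q x -> d <=
  cRe (\sum_(mu < n) \sum_(nu < n) (b x)%:C * (a x mu nu * (th i mu)%:C * (th i nu)%:C)).

(** With [h] the reciprocal size of the frequency, [th = h * w] stays bounded. Differentiating
    through the exponential gives h^2 CLadj(wave p') = wave (-den p' + h(...)), where [den], the
    form b a(th, th), has real part at least [d]. Hence p' = -p/den cancels the leading term, and
    everything collected in [r] carries a factor [h] and at most two derivatives of p'. All bounds
    are uniform in the index, so [p'] and [r] can be fed back into the same step. *)
Lemma parametrix_step (p : I -> V -> C) : sfam p ->
  exists p' r, [/\ sfam p', sfam r & forall i x,
    wave (w i) x * p i x = (h i ^+ 2)%:C * CLadj (fun y => wave (w i) y * p' i y) x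
                           + (h i)%:C * (wave (w i) x * r i x)].
Proof.
move=> [Up p0].
pose den i x : C :=
  \sum_(mu < n) \sum_(nu < n) (b x)%:C * (a x mu nu * (th i mu)%:C * (th i nu)%:C).
have Cth (s : I -> R) M m : (forall i, `|s i| <= M) -> CUB Q m (fun i _ => (s i)%:C : C).
  move=> sM; apply: (@CUB_cst _ _ _ _ oQ _ _ `|M|) => i.
  by split; [rewrite (le_trans (sM i)) // ler_norm|rewrite cIm_real normr0].
have Ckap m mu : CUB Q m (fun i _ => (h i)%:C * kap (w i) mu).
  apply: (@CUB_cst _ _ _ _ oQ _ _ `|Bth|) => i; rewrite cReM cImM /cRe /cIm /=.
  rewrite !mul0r mulr0 subrr normr0 addr0 mulrN normrN; split=> //.
  by rewrite (le_trans (thB i mu)) // ler_norm.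
have Ch m : CUB Q m (fun i _ => (h i)%:C : C).
  by apply: (Cth _ 1) => i; have /andP[h0 hle] := h1 i; rewrite ger0_norm.
have Cb m : CUB Q m (fun (_ : I) x => (b x)%:C) by exact: CUB_real.
have Uden m : CUB Q m den.
  apply: CUB_sum => // mu; apply: CUB_sum => // nu.
  by apply: CUBM => //; apply: CUBM => //; [apply: CUBM => //|]; apply: (Cth _ Bth) => i; exact: thB.
have UdenV m : CUB Q m (fun i x => (den i x)^-1) := CUBV oQ d0 ellip (Uden m).
(* The sign compensates the product of two symbols: kap mu times kap nu is minus w_mu w_nu. *)
pose p' i x : C := - (p i x * (den i x)^-1).
have Up' m : CUB Q m p' by apply: CUBN => //; exact: CUBM.
have p'0 i x : ~ K x -> p' i x = 0 by move=> Kx; rewrite /p' p0 // mul0r oppr0.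
pose q i x : C := (b x)%:C * p' i x.
have Uq m : CUB Q m q by exact: CUBM.
have q0 i x : ~ K x -> q i x = 0 by move=> Kx; rewrite /q p'0 // mulr0.
(* [kap] alone is unbounded along the family; only together with the factor [h] does it give a
   family bounded in C^m. *)
pose A mu i x : C := (h i)%:C * cpartial mu (q i) x + (h i)%:C * kap (w i) mu * q i x.
have UA m mu : CUB Q m (A mu).
  apply: CUBD => //; first by apply: CUBM => //; exact: CUB_partial.
  exact: CUBM.
pose r i x : C := - \sum_(mu < n) \sum_(nu < n)
  (cpartial nu (fun y => a y mu nu * A mu i y) x +
   (h i)%:C * kap (w i) nu * (a x mu nu * cpartial mu (q i) x)).
have Ur m : CUB Q m r.
  apply: CUBN => //; apply: CUB_sum => // mu; apply: CUB_sum => // nu; apply: CUBD => //.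
    by apply: (@CUB_partial _ _ _ _ _ (fun i y => a y mu nu * A mu i y)); exact: CUBM.
  by apply: CUBM => //; apply: CUBM => //; exact: CUB_partial.
have dq0 i mu x : ~ K x -> cpartial mu (q i) x = 0.
  by move=> Kx; apply: (vanish_cpartial mu cK) Kx => y; exact: q0.
have A0 i mu x : ~ K x -> A mu i x = 0.
  by move=> Kx; rewrite /A dq0 // q0 // !mulr0 addr0.
have r0 i x : ~ K x -> r i x = 0.
  move=> Kx; rewrite /r big1 ?oppr0 // => mu _; rewrite big1 // => nu _.
  rewrite dq0 // !mulr0 addr0.
  by apply: (vanish_cpartial nu cK) Kx => y Ky; rewrite A0 // mulr0.
exists p', r; split => // i x.
have [Kx|Kx] := pselect (K x); last first.
  rewrite p0 // r0 // !mulr0 addr0 /CLadj big1 ?mulr0 // => mu _; rewrite big1 // => nu _.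
  apply: (vanish_cpartial nu cK) Kx => y Ky.
  rewrite (vanish_cpartial mu cK _ Ky) ?mulr0 // => z Kz.
  by rewrite p'0 // !mulr0.
have Qx := KQ Kx.
have term mu nu : (h i ^+ 2)%:C *
    cpartial nu (fun y => a y mu nu *
       cpartial mu (fun z => (b z)%:C * (wave (w i) z * p' i z)) y) x =
    wave (w i) x * ((h i)%:C * (cpartial nu (fun y => a y mu nu * A mu i y) x +
       (h i)%:C * kap (w i) nu * (a x mu nu * cpartial mu (q i) x)) -
       a x mu nu * (th i mu)%:C * (th i nu)%:C * q i x).
  (* The index is fixed here, so the derivability of [B] may be obtained from bounds that are not
     uniform in the frequency. *)
  pose B y : C := a y mu nu * (cpartial mu (q i) y + kap (w i) mu * q i y).
  have CB m : CUB Q m (fun _ : unit => B).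
    have Uqi m' : CUB Q m' (fun _ : unit => q i).
      exact: (@CUB_reindex _ _ _ _ (fun=> i) _ _ q).
    apply: CUBM => //; first exact: (@CUB_reindex _ _ _ _ (fun=> i) _ _ (fun _ x => a x mu nu)).
    apply: CUBD => //; first exact: CUB_partial.
    apply: CUBM => //.
    apply: (@CUB_cst _ _ _ _ oQ _ _ `|w i ord0 mu|) => _; rewrite /cRe /cIm /=.
    by rewrite normr0 normrN; split.
  have dB := CUB_cdrv tt nu (CB 1%N) Qx.
  have -> : cpartial nu (fun y => a y mu nu *
       cpartial mu (fun z => (b z)%:C * (wave (w i) z * p' i z)) y) x =
       cpartial nu (fun y => wave (w i) y * B y) x.
    apply: near_cpartial; apply: (@filterS _ _ _ Q); last first.
      exact: (open_nbhs_nbhs (conj oQ Qx)).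
    move=> y Qy.
    have [_ E] := cpartial_wave_mul (w i) (CUB_cdrv i mu (Uq 1%N) Qy).
    have -> : (fun z => (b z)%:C * (wave (w i) z * p' i z)) =
              (fun z => wave (w i) z * q i z).
      by apply/funext => z; rewrite /q; ring.
    by rewrite E /B; ring.
  have [_ ->] := cpartial_wave_mul (w i) dB.
  have -> : cpartial nu (fun y => a y mu nu * A mu i y) x = (h i)%:C * cpartial nu B x.
    have fE : (fun y => a y mu nu * A mu i y) = (fun y => (h i)%:C * B y).
      by apply/funext => y; rewrite /A /B; ring.
    by rewrite fE (cpartialZ (h i)%:C dB).
  have kk : kap (w i) mu * kap (w i) nu = - (w i ord0 mu * w i ord0 nu)%:C.
    apply: eq_cReIm; rewrite ?cReM ?cImM ?cReN ?cImN /cRe /cIm /=; ring.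
  have thE k : (th i k)%:C = (h i)%:C * (w i ord0 k)%:C by rewrite /th rmorphM.
  rewrite !thE [(_ * _)%:C]rmorphM /B.
  have -> : kap (w i) nu * (a x mu nu * (cpartial mu (q i) x + kap (w i) mu * q i x)) =
     kap (w i) nu * (a x mu nu * cpartial mu (q i) x) +
     (kap (w i) mu * kap (w i) nu) * (a x mu nu * q i x) by ring.
  rewrite kk rmorphM; ring.
have denn0 : den i x != 0.
  apply/eqP => H; have := ellip i Qx; rewrite -/(den i x) H.
  by rewrite leNgt d0.
rewrite /CLadj mulr_sumr.
under eq_bigr => mu _ do (rewrite mulr_sumr; under eq_bigr => nu _ do rewrite term).
under eq_bigr => mu _ do rewrite -mulr_sumr sumrB -!mulr_sumr.
rewrite -mulr_sumr sumrB -mulr_sumr.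
have -> : \sum_(mu < n) \sum_(nu < n)
      a x mu nu * (th i mu)%:C * (th i nu)%:C * q i x = - p i x.
  transitivity (den i x * p' i x).
    rewrite /den mulr_suml; apply: eq_bigr => mu _; rewrite mulr_suml.
    by apply: eq_bigr => nu _; rewrite /q; ring.
  by rewrite /p' mulrN mulrCA divff // mulr1.
rewrite /r; ring.
Qed.
End ParametrixStep.

(** * Complex integrals and L^2 pairings *)

Section ComplexIntegral.
Context {R : realType} {n : nat}.
Local Notation V := 'rV[R]_n.
Local Notation C := R[i].

Definition CIntg (g : V -> C) := Intg (fun x => cRe (g x)) /\ Intg (fun x => cIm (g x)).
Definition Cint (g : V -> C) : C := rnint (fun x => cRe (g x)) +i* rnint (fun x => cIm (g x)).

Lemma eq_Intg (f g : V -> R) : f =1 g -> Intg f -> Intg g.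
Proof. by move=> /funext ->. Qed.
Lemma eq_rnint (f g : V -> R) : f =1 g -> rnint f = rnint g.
Proof. by move=> /funext ->. Qed.
Lemma eq_Cint (f g : V -> C) : f =1 g -> Cint f = Cint g.
Proof. by move=> /funext ->. Qed.

Lemma CIntgD f g : CIntg f -> CIntg g -> CIntg (fun x => f x + g x).
Proof.
move=> [f1 f2] [g1 g2]; split.
  by apply: eq_Intg (IntgD f1 g1) => x; rewrite cReD.
by apply: eq_Intg (IntgD f2 g2) => x; rewrite cImD.
Qed.

Lemma CIntgZ k f : CIntg f -> CIntg (fun x => k * f x).
Proof.
move=> [f1 f2]; split.
  by apply: eq_Intg (IntgB (IntgZ (cRe k) f1) (IntgZ (cIm k) f2)) => x; rewrite cReM.
by apply: eq_Intg (IntgD (IntgZ (cRe k) f2) (IntgZ (cIm k) f1)) => x; rewrite cImM.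
Qed.

Lemma CIntg0 : CIntg (fun=> 0).
Proof. by split; exact: Intg_cst0. Qed.

Lemma CintD f g : CIntg f -> CIntg g -> Cint (fun x => f x + g x) = Cint f + Cint g.
Proof.
move=> [f1 f2] [g1 g2]; apply: eq_cReIm; rewrite ?cReD ?cImD /cRe /cIm /=.
  by rewrite -(rnintD f1 g1); apply: eq_rnint => x; rewrite -/(cRe _) cReD.
by rewrite -(rnintD f2 g2); apply: eq_rnint => x; rewrite -/(cIm _) cImD.
Qed.

Lemma CintZ k f : CIntg f -> Cint (fun x => k * f x) = k * Cint f.
Proof.
move=> [f1 f2]; apply: eq_cReIm; rewrite ?cReM ?cImM /Cint /=.
  rewrite -(rnintZ (cRe k) f1) -(rnintZ (cIm k) f2) -(rnintB (IntgZ _ f1) (IntgZ _ f2)).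
  by apply: eq_rnint => x; rewrite -/(cRe _) cReM.
rewrite -(rnintZ (cRe k) f2) -(rnintZ (cIm k) f1) -(rnintD (IntgZ _ f2) (IntgZ _ f1)).
by apply: eq_rnint => x; rewrite -/(cIm _) cImM.
Qed.

Lemma Cint0 : Cint (fun=> 0) = 0.
Proof. by rewrite /Cint; apply: eq_cReIm => /=; exact: rnint0. Qed.

Lemma Cint_sum (J : Type) (r : seq J) (F : J -> V -> C) : (forall k, CIntg (F k)) ->
  CIntg (fun x => \sum_(k <- r) F k x) /\
  Cint (fun x => \sum_(k <- r) F k x) = \sum_(k <- r) Cint (F k).
Proof.
move=> IF; elim: r => [|k r [IH1 IH2]].
  rewrite big_nil (_ : (fun _ => _) = fun=> 0); last by apply/funext => y; rewrite big_nil.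
  by split; [exact: CIntg0|exact: Cint0].
rewrite big_cons (_ : (fun _ => _) = fun y => F k y + \sum_(i <- r) F i y).
  split; first exact: CIntgD (IF k) IH1.
  by rewrite (CintD (IF k) IH1) IH2.
by apply/funext => y; rewrite big_cons.
Qed.

Definition csq (z : C) : R := cRe z ^+ 2 + cIm z ^+ 2.

Lemma csq_ge0 z : 0 <= csq z.
Proof. by rewrite addr_ge0 // sqr_ge0. Qed.

Lemma csqM z w : csq (z * w) = csq z * csq w.
Proof. by rewrite /csq cReM cImM; ring. Qed.

Lemma cabsE z : cabs z = Num.sqrt (csq z).
Proof. by []. Qed.

Lemma cabs_ge0 (z : C) : 0 <= cabs z.
Proof. exact: sqrtr_ge0. Qed.

Lemma cabs_sq (z : C) : cabs z ^+ 2 = csq z.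
Proof. by rewrite cabsE sqr_sqrtr // csq_ge0. Qed.

Lemma cabsM (z w : C) : cabs (z * w) = cabs z * cabs w.
Proof. by rewrite !cabsE csqM sqrtrM // csq_ge0. Qed.

Lemma cabs0 : cabs (0 : C) = 0.
Proof. by rewrite cabsE /csq expr0n /= addr0 sqrtr0. Qed.

Lemma cabs1 : cabs (1 : C) = 1.
Proof. by rewrite cabsE /csq expr1n expr0n /= addr0 sqrtr1. Qed.

Lemma cabsN (z : C) : cabs (- z) = cabs z.
Proof. by rewrite !cabsE /csq cReN cImN !sqrrN. Qed.

Lemma cabsX (z : C) k : cabs (z ^+ k) = cabs z ^+ k.
Proof. by elim: k => [|k IH]; rewrite ?expr0 ?cabs1 // !exprS cabsM IH. Qed.

Lemma cabs_real (r : R) : cabs (r%:C) = `|r|.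
Proof. by rewrite cabsE /csq /cRe /cIm /= expr0n /= addr0 sqrtr_sqr. Qed.

Lemma cRe_le_cabs (z : C) : `|cRe z| <= cabs z.
Proof. by rewrite -sqrtr_sqr cabsE ler_sqrt ?csq_ge0 // lerDl sqr_ge0. Qed.

Lemma cIm_le_cabs (z : C) : `|cIm z| <= cabs z.
Proof. by rewrite -sqrtr_sqr cabsE ler_sqrt ?csq_ge0 // lerDr sqr_ge0. Qed.

Lemma cabs_le (z : C) : cabs z <= `|cRe z| + `|cIm z|.
Proof.
rewrite -(ger0_norm (addr_ge0 (normr_ge0 (cRe z)) (normr_ge0 (cIm z)))) -sqrtr_sqr cabsE.
rewrite ler_sqrt ?sqr_ge0 // sqrrD !real_normK ?num_real // /csq.
by rewrite -addrA lerD2l lerDr mulrn_wge0 // mulr_ge0.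
Qed.

Lemma cabsD (z w : C) : cabs (z + w) <= cabs z + cabs w.
Proof.
rewrite -(@ler_sqr _ (cabs (z + w))) ?nnegrE ?addr_ge0 ?cabs_ge0 //.
rewrite sqrrD !cabs_sq -cabs_sq.
have H : cRe z * cRe w + cIm z * cIm w <= cabs z * cabs w.
  rewrite (le_trans (ler_norm _)) // -cabsM -(cabsN (z * w)).
  have -> : cabs (- (z * w)) = cabs (z * conjc w).
    by rewrite cabsN !cabsM; congr (_ * _); rewrite !cabsE /csq; case: (w) => p q; rewrite /cRe /cIm /= sqrrN.
  apply: le_trans (cRe_le_cabs _); rewrite cReM.
  by case: (w) => p q; rewrite /cRe /cIm /= mulrN opprK.
rewrite cabs_sq /csq cReD cImD.
move: H; set c := cabs z * cabs w; rewrite mulr2n; nra.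
Qed.

(* conj z / |z|, with value 0 at 0 *)
Definition cphase (z : C) : C := conjc z * ((cabs z)^-1)%:C.

Lemma cphaseE (z : C) : cphase z * z = (cabs z)%:C.
Proof.
have -> : cphase z * z = (csq z * (cabs z)^-1)%:C.
  rewrite /cphase; move: (cabs z)^-1 => s; case: z => p q.
  by apply: eq_cReIm; rewrite ?cReM ?cImM /csq /cRe /cIm /=; ring.
rewrite -cabs_sq expr2; have [->|z0] := eqVneq (cabs z) 0; first by rewrite !mul0r.
by rewrite mulfK.
Qed.

Lemma cphase_le1 (z : C) : csq (cphase z) <= 1.
Proof.
rewrite /cphase csqM.
have -> : csq (conjc z) = csq z by rewrite /csq; case: z => p q; rewrite /cRe /cIm /= sqrrN.
rewrite -cabs_sq /csq /cRe /cIm /= expr0n /= addr0 -exprMn.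
have [->|z0] := eqVneq (cabs z) 0; first by rewrite mul0r expr0n.
by rewrite divff // expr1n.
Qed.

Definition L2fun (v : V -> C) : Prop :=
  [/\ measurable_fun setT ((fun x => cRe (v x)) : BV n -> R),
      measurable_fun setT ((fun x => cIm (v x)) : BV n -> R) &
      Intg (fun x => csq (v x))].
Definition nrm2 (v : V -> C) : R := rnint (fun x => csq (v x)).

Lemma csq_mul_le (z w : C) : `|cRe (z * w)| <= (csq z + csq w) / 2 /\
  `|cIm (z * w)| <= (csq z + csq w) / 2.
Proof.
rewrite cReM cImM /csq; move: (cRe z) (cIm z) (cRe w) (cIm w) => p q r s.
have H1 := sqr_ge0 (p - r); have H2 := sqr_ge0 (p + r); have H3 := sqr_ge0 (q - s).
have H4 := sqr_ge0 (q + s); have H5 := sqr_ge0 (p - s); have H6 := sqr_ge0 (p + s).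
have H7 := sqr_ge0 (q - r); have H8 := sqr_ge0 (q + r).
rewrite !(sqrrB, sqrrD) in H1 H2 H3 H4 H5 H6 H7 H8.
by split; rewrite ler_norml; apply/andP; split; lra.
Qed.

(** The arithmetic-geometric mean inequality stands in for Cauchy-Schwarz: the estimates to come
    only ask for boundedness of pairings, not for the product of norms. *)
Lemma L2_pair u v : L2fun u -> L2fun v -> CIntg (fun x => u x * v x) /\
  cRe (Cint (fun x => u x * v x)) <= (nrm2 u + nrm2 v) / 2.
Proof.
move=> [u1 u2 u3] [v1 v2 v3].
have I2 : Intg (fun x => 2^-1 * (csq (u x) + csq (v x))) by exact/IntgZ/IntgD.
have i1 : Intg (fun x => cRe (u x * v x)).
  apply: Intg_le I2.
    apply: (eq_measurable_fun (fun x : BV n => cRe (u x) * cRe (v x) - cIm (u x) * cIm (v x))).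
      by move=> x _; rewrite cReM.
    by apply: measurable_funB; apply: measurable_funM.
  by move=> x; rewrite [leRHS]mulrC; have [] := csq_mul_le (u x) (v x).
split.
  split=> //; apply: Intg_le I2.
    apply: (eq_measurable_fun (fun x : BV n => cRe (u x) * cIm (v x) + cIm (u x) * cRe (v x))).
      by move=> x _; rewrite cImM.
    by apply: measurable_funD; apply: measurable_funM.
  by move=> x; rewrite [leRHS]mulrC; have [] := csq_mul_le (u x) (v x).
rewrite /Cint /nrm2 -(rnintD u3 v3) mulrC -(rnintZ _ (IntgD u3 v3)).
apply: rnint_le => // x; rewrite [leRHS]mulrC -/(cRe _).
by apply: le_trans (ler_norm _) _; have [] := csq_mul_le (u x) (v x).
Qed.
End ComplexIntegral.

(** * Lattice sums and almost orthogonality *)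

Section LatticeSum.
Context {R : realType} {n : nat}.
Local Notation Zn := 'rV[int]_n.

Definition absn (z : Zn) : nat := \max_(i < n) `|z ord0 i|%N.

Lemma absn_ge (z : Zn) i : (`|z ord0 i| <= absn z)%N.
Proof. exact: (leq_bigmax (F := fun i => `|z ord0 i|%N) i). Qed.

Lemma absn_eq (z : Zn) : z != 0 -> exists i, `|z ord0 i|%N = absn z.
Proof.
move=> z0; suff : (0 < #|'I_n|)%N.
  by move=> /(@bigop.eq_bigmax _ (fun i => `|z ord0 i|%N))[i Ei]; exists i.
rewrite lt0n; apply/eqP => c0; case/eqP: z0; apply/rowP => i.
by have := card0_eq c0 i; rewrite inE.
Qed.

Lemma absn_gt0 (z : Zn) : z != 0 -> (0 < absn z)%N.
Proof.
move=> z0; rewrite lt0n; apply/eqP => H; case/eqP: z0; apply/rowP => i; rewrite mxE.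
by apply/eqP; rewrite -absz_eq0 -leqn0; have := absn_ge z i; rewrite H.
Qed.

Lemma absn0 : absn 0 = 0%N.
Proof. by apply/eqP; rewrite -leqn0; apply/bigmax_leqP => i _; rewrite mxE. Qed.

Lemma absnN z : absn (- z) = absn z.
Proof. by apply: eq_bigr => i _; rewrite mxE abszN. Qed.

(** Adding [L] to every coordinate embeds [A] into the maps from [n] indices to 2L+1 values. *)
Lemma count_lattice (A : seq Zn) (L : nat) : uniq A ->
  (forall z, z \in A -> (absn z <= L)%N) -> (size A <= (2 * L).+1 ^ n)%N.
Proof.
move=> uA AL.
pose f (z : Zn) := [ffun i : 'I_n => inord (absz (z ord0 i + L%:Z)) : 'I_(2 * L).+1].
have fi : {in A &, injective f}.
  move=> y z /AL yL /AL zL /ffunP H; apply/rowP => i.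
  have b (u : Zn) : (absn u <= L)%N -> (absz (u ord0 i + L%:Z)%R <= 2 * L)%N /\ 0 <= u ord0 i + L%:Z.
    move=> /(leq_trans (absn_ge u i)); lia.
  have [y1 y2] := b y yL; have [z1 z2] := b z zL.
  have := congr1 val (H i); rewrite !ffunE /= !inordK // => /(congr1 Posz).
  by rewrite !gez0_abs // => /addIr.
have : uniq (map f A) by rewrite map_inj_in_uniq.
move=> /card_uniqP; rewrite size_map => <-.
by apply: leq_trans (max_card _) _; rewrite card_ffun !card_ord.
Qed.

(** The exponent n+1 is the least integer for which the sum over the lattice converges. *)
Definition lat_weight (z : Zn) : R := ((absn z).+1%:R^-1) ^+ n.+1.

Lemma lat_weight_ge0 z : 0 <= lat_weight z.
Proof. by rewrite exprn_ge0 // invr_ge0. Qed.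

(* dyadic shells: at most (6 2^i)^n points have norm < 2^(i+1) *)
Lemma lattice_sum : exists Z : R, forall A : seq Zn, uniq A ->
  \sum_(z <- A) lat_weight z <= Z.
Proof.
exists (6 ^+ n * 2) => A uA.
pose lg (z : Zn) := trunc_log 2 (absn z).+1.
pose J := (\max_(z <- A) lg z).+1.
have lgJ z : z \in A -> (lg z < J)%N.
  by move=> zA; rewrite ltnS; exact: (leq_bigmax_seq _ zA).
have lw z : lat_weight z <= ((2 ^+ lg z)^-1) ^+ n.+1.
  apply: lerXn2r; rewrite ?nnegrE ?invr_ge0 ?exprn_ge0 //.
  rewrite lef_pV2 ?posrE ?exprn_gt0 ?ltr0Sn // -natrX ler_nat.
  exact: trunc_logP.
have : \sum_(z <- A) lat_weight z <=
    \sum_(z <- A) \sum_(i < J) (if lg z == i then ((2 ^+ i)^-1) ^+ n.+1 else 0 : R).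
  rewrite big_seq [leRHS]big_seq; apply: ler_sum => z zA.
  rewrite (bigD1 (Ordinal (lgJ z zA))) //= eqxx big1 ?addr0 // => i ni.
  by rewrite ifF //; apply/negbTE; apply: contra ni => /eqP E; apply/eqP/val_inj.
move/le_trans; apply; rewrite exchange_big /=.
have : forall i : 'I_J, true -> \sum_(z <- A) (if lg z == i then ((2 ^+ i)^-1) ^+ n.+1 else 0 : R)
    <= 6 ^+ n * (2^-1) ^+ i.
  move=> i _; rewrite -big_mkcond /= -big_filter big_const_seq count_predT iter_addr_0.
  set S := size _.
  have Sle : (S <= (6 * 2 ^ i) ^ n)%N.
    apply: leq_trans (count_lattice (L := (2 ^ i.+1).-1) _ _) _.
    - exact: filter_uniq.
    - move=> z; rewrite mem_filter => /andP[/eqP <- _].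
      by rewrite -ltnS prednK ?expn_gt0 //; apply: ltnW; exact: trunc_log_ltn.
    - case: (posnP n) => [->|n0]; first by rewrite !expn0.
      by rewrite leq_exp2r // expnS; have := expn_gt0 2 i; lia.
  rewrite -[leLHS]mulr_natl.
  apply: (@le_trans _ _ (((6 * 2 ^ i) ^ n)%:R * ((2 ^+ i)^-1) ^+ n.+1)).
    by rewrite ler_wpM2r ?exprn_ge0 ?invr_ge0 ?exprn_ge0 // ler_nat.
  rewrite natrX natrM exprMn natrX exprS -exprVn.
  have e2 : (2 ^+ i : R) != 0 by rewrite expf_neq0.
  rewrite -!mulrA ler_wpM2l ?exprn_ge0 //.
  rewrite mulrCA -exprMn -exprMn divff // !expr1n mulr1 //.
move=> /ler_sum /le_trans; apply; rewrite -mulr_sumr ler_wpM2l ?exprn_ge0 //.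
have S0 : \sum_(i < J) (2^-1 : R) ^+ i = 2 * (1 - 2^-1 ^+ J).
  elim: (J) => [|k IH]; first by rewrite big_ord0 expr0 subrr mulr0.
  by rewrite big_ord_recr /= IH exprS; field.
by rewrite S0 -[leRHS]mulr1 ler_wpM2l // gerBl exprn_ge0.
Qed.
End LatticeSum.

(** * Decay of oscillatory integrals *)

Section Gram.
Context {R : realType} {n : nat}.
Local Notation V := 'rV[R]_n.
Local Notation C := R[i].
Variables (K : set V) (c : V) (rho : R).
Hypotheses (cK : closed K) (rho0 : 0 < rho) (KB : K `<=` ball c rho).

Definition dfam (I : Type) (p : I -> V -> C) : Prop :=
  (forall m, CUB setT m p) /\ (forall i x, ~ K x -> p i x = 0).

Lemma sfam_dfam Q I (p : I -> V -> C) : K `<=` Q -> sfam Q K p -> dfam p.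
Proof.
move=> KQ [Up p0]; split => // m.
exact: CUB_vanish cK KQ p0 (Up m).
Qed.

Lemma dfam_partial j I (p : I -> V -> C) : dfam p -> dfam (fun i => cpartial j (p i)).
Proof.
move=> [Up p0]; split => [m|i x Kx]; first exact: CUB_partial (Up m.+1).
exact: (vanish_cpartial j cK (p0 i)).
Qed.

Lemma dfam_mul I (p : I -> V -> C) (q : I -> V -> C) : (forall m, CUB setT m q) ->
  dfam p -> dfam (fun i x => q i x * p i x).
Proof.
move=> Uq [Up p0]; split => [m|i x Kx]; first exact: (CUBM (@openT V) (Uq m) (Up m)).
by rewrite p0 // mulr0.
Qed.

Lemma dfam_reindex I J (s : J -> I) (p : I -> V -> C) : dfam p -> dfam (fun k => p (s k)).
Proof. by move=> [Up p0]; split => [m|k x]; [exact: CUB_reindex|exact: p0]. Qed.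

Lemma dfam_wave I (w : V) (p : I -> V -> C) : dfam p -> dfam (fun i x => wave w x * p i x).
Proof. by apply: dfam_mul => m; exact: CUB_wave. Qed.

Lemma off_ball x : ~ ball c rho x -> ~ K x.
Proof. by move=> H /KB. Qed.

Lemma dfam_Intg I (p : I -> V -> C) i : dfam p -> CIntg (p i).
Proof.
move=> [Up p0]; have [U1 U2] := Up 0%N.
split; apply: (Intg_continuous_supp rho0).
- by move=> x; exact: (UB_continuous U1).
- by move=> x /off_ball Kx; rewrite p0.
- by move=> x; exact: (UB_continuous U2).
- by move=> x /off_ball Kx; rewrite p0.
Qed.

Lemma dfam_L2fun I (p : I -> V -> C) i : dfam p -> L2fun (p i).
Proof.
move=> dp; have [Up p0] := dp; have [U1 U2] := Up 0%N.
have c1 : continuous (fun x => cRe (p i x)) by move=> x; exact: (UB_continuous U1).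
have c2 : continuous (fun x => cIm (p i x)) by move=> x; exact: (UB_continuous U2).
split; [exact: continuous_measurable_BV|exact: continuous_measurable_BV|].
apply: (Intg_continuous_supp rho0) => [x|x /off_ball Kx].
  exact: (contD (contM (c1 x) (c1 x)) (contM (c2 x) (c2 x))).
by rewrite p0 // /csq /= expr0n /= addr0.
Qed.

Lemma Cint_cpartial j I (p : I -> V -> C) i : dfam p -> Cint (cpartial j (p i)) = 0.
Proof.
move=> dp; have [Up p0] := dp; have [U1 U2] := Up 1%N.
have [_ q0] := dfam_partial j dp.
have E (f : V -> R) : (forall x, drv j f x) -> continuous (partial j f) ->
    (forall x, ~ K x -> f x = 0) -> rnint (partial j f) = 0.
  move=> df cf f0; rewrite /rnint /Rintegral.
  rewrite (@rnint_partial _ _ j f c rho rho0 df cf) // => x /off_ball Kx; first exact: f0.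
  exact: (vanish_partial j cK f0).
apply: eq_cReIm; rewrite /Cint /=.
  apply: E => x; [exact: (UB_drv U1)|exact: (UB_continuous (UB_partial j U1))|].
  by move=> Kx; rewrite p0.
apply: E => x; [exact: (UB_drv U2)|exact: (UB_continuous (UB_partial j U2))|].
by move=> Kx; rewrite p0.
Qed.

Lemma rnint_bound (f : V -> R) (M : R) : Intg f -> (forall x, ~ ball c rho x -> f x = 0) ->
  (forall x, `|f x| <= M) -> `|rnint f| <= M * (2 * rho) ^+ n.
Proof.
move=> If f0 fM.
have mB : measurable (ball c rho : set (BV n)).
  by apply: open_measurable_BV; exact: ball_open.
have M0 : 0 <= M by exact: le_trans (fM 0).
have I1 : Intg (fun x => \1_(ball c rho) x : R).
  apply: (Intg_bounded (c := c) (M := 1) rho0).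
  - by apply: measurable_indic.
  - by move=> x Bx; rewrite indicE memNset.
  - by move=> x; rewrite indicE ger0_norm // lern1 leq_b1.
have E1 : rnint (fun x : V => \1_(ball c rho) x : R) = (2 * rho) ^+ n.
  rewrite /rnint /Rintegral integral_indic // setIT.
  exact: (congr1 fine (lam_ball c rho0)).
have le1 x : `|f x| <= M * \1_(ball c rho) x.
  rewrite indicE; have [Bx|Bx] := pselect (ball c rho x).
    by rewrite mem_set // mulr1.
  by rewrite f0 // normr0 mulr_ge0.
rewrite ler_norml -E1 -(rnintZ _ I1) -(rnintN (IntgZ _ I1)); apply/andP; split.
  apply: rnint_le => //; first exact/IntgN/IntgZ.
  by move=> x; have := le1 x; rewrite ler_norml => /andP[].
apply: rnint_le => //; first exact/IntgZ.
by move=> x; have := le1 x; rewrite ler_norml => /andP[].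
Qed.

(** The integral of the derivative of wave times [p] is 0, so multiplying the integral by [w_j]
    amounts, up to a unimodular factor, to differentiating the amplitude. The derived family is
    again a [dfam], hence a bound uniform in the index and in [w]. *)
Lemma oscillatory_decay j N I (p : I -> V -> C) : dfam p -> exists M : R,
  forall i (w : V), `|w ord0 j| ^+ N * cabs (Cint (fun x => wave w x * p i x)) <= M.
Proof.
elim: N I p => [|N IH] I p dp; last first.
  have [M HM] := IH _ _ (dfam_partial j dp); exists M => i w.
  have dwp := dfam_wave w dp; have dwq := dfam_wave w (dfam_partial j dp).
  have E0 := Cint_cpartial j i dwp.
  have E1 : Cint (cpartial j (fun x => wave w x * p i x)) =
     Cint (fun x => wave w x * cpartial j (p i) x) +
     kap w j * Cint (fun x => wave w x * p i x).
    rewrite -(CintZ _ (dfam_Intg i dwp)) -CintD; last 2 first.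
    - exact: (dfam_Intg i dwq).
    - exact: CIntgZ (dfam_Intg i dwp).
    apply: eq_Cint => x.
    have [Up _] := dp; have dpi : cdrv j (p i) x := CUB_cdrv i j (Up 1%N) Logic.I.
    by have [_ ->] := cpartial_wave_mul w dpi; ring.
  move: E1; rewrite E0 => /esym/eqP; rewrite addrC addr_eq0 => /eqP E1.
  apply: le_trans (HM i w); rewrite -[X in _ <= _ * X]cabsN -E1 cabsM exprSr -mulrA.
  rewrite ler_wpM2l ?exprn_ge0 // ler_wpM2r ?cabs_ge0 //.
  by have := cIm_le_cabs (kap w j); rewrite /cIm /= normrN.
have [Up p0] := dp; have [U1 U2] := Up 0%N.
have [M1 H1] := UB_bounded U1; have [M2 H2] := UB_bounded U2.
exists ((M1 + M2) * (2 * rho) ^+ n + (M1 + M2) * (2 * rho) ^+ n) => i w.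
have [I1 I2] := dfam_Intg i (dfam_wave w dp).
have b x : cabs (wave w x * p i x) <= M1 + M2.
  rewrite cabsM {1}cabsE /csq wave_norm sqrtr1 mul1r.
  by rewrite (le_trans (cabs_le _)) // lerD ?H1 ?H2.
rewrite expr0 mul1r; apply: le_trans (cabs_le _) _; rewrite /Cint.
apply: lerD; apply: rnint_bound => // x.
- by move=> /off_ball Kx; rewrite p0 // mulr0.
- exact: le_trans (cRe_le_cabs _) (b x).
- by move=> /off_ball Kx; rewrite p0 // mulr0.
- exact: le_trans (cIm_le_cabs _) (b x).
Qed.
End Gram.

(** * Gram matrix and Schur test *)

Section AlmostOrthogonality.
Context {R : realType} {n : nat}.
Local Notation V := 'rV[R]_n.
Local Notation C := R[i].
Variables (K : set V) (c : V) (rho : R).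
Hypotheses (cK : closed K) (rho0 : 0 < rho) (KB : K `<=` ball c rho).
Variable om : R.
Hypothesis om0 : 0 < om.

Local Notation Zn := 'rV[int]_n.
(** The origin is excluded because amplitudes will be weighted by negative powers of the
    frequency. *)
Definition Zs := {z : 'rV[int]_n | z != 0}.
Definition freq (z : Zn) : V := om *: \row_i (z ord0 i)%:~R.

Lemma freqB y z : freq (y - z) = freq y - freq z.
Proof.
by rewrite /freq -scalerBr; congr (_ *: _); apply/rowP => i; rewrite !mxE intrB.
Qed.

Lemma freqE (z : Zn) i : `|freq z ord0 i| = om * `|z ord0 i|%N%:R.
Proof.
by rewrite /freq !mxE normrM gtr0_norm // -intr_norm -abszE.
Qed.

Lemma conjcE (z : C) : conjc z = cRe z +i* (- cIm z).
Proof. by case: z. Qed.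

Lemma dfam_pair I (p : I -> V -> C) : dfam K p ->
  dfam K (fun (k : I * I) x => p k.1 x * conjc (p k.2 x)).
Proof.
move=> [Up p0]; split => [m|k x Kx]; last by rewrite p0 // mul0r.
have [U1 U2] := Up m; have oT := @openT V.
apply: (CUBM oT); first exact: (@CUB_reindex _ _ _ _ (fun k : I * I => k.1) _ _ p).
split.
  apply: (eq_UB oT) (UB_reindex (fun k : I * I => k.2) U1) => k x _.
  by rewrite conjcE.
apply: (eq_UB oT) (UBN oT (UB_reindex (fun k : I * I => k.2) U2)) => k x _.
by rewrite conjcE.
Qed.

Lemma wave_conj (v w x : V) : wave v x * conjc (wave w x) = wave (v - w) x.
Proof.
rewrite waveD; congr (_ * _); rewrite conjcE /wave dotNl cosN sinN.
by apply: eq_cReIm; rewrite /cRe /cIm /= ?opprK.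
Qed.

Lemma lat_weightN (z : Zn) : lat_weight (- z) = lat_weight z :> R.
Proof. by rewrite /lat_weight absnN. Qed.

(** An entry is an oscillatory integral of frequency y - z with amplitude p_y conj(p_z). Indexing
    the amplitudes by pairs makes [oscillatory_decay] uniform over all entries; n+1 integrations by
    parts are made in the coordinate where y - z is largest. *)
Lemma gram_decay (p : Zs -> V -> C) : dfam K p -> exists B : R, 0 <= B /\
  forall y z : Zs, cabs (Cint (fun x => wave (freq (val y)) x * p y x *
     conjc (wave (freq (val z)) x * p z x))) <= B * lat_weight (val y - val z).
Proof.
move=> dp; have dpp := dfam_pair dp.
have [M0 H0] := choice (fun j => oscillatory_decay cK rho0 KB j 0 dpp).
have [M1 H1] := choice (fun j => oscillatory_decay cK rho0 KB j n.+1 dpp).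
exists (\sum_(j < n) (`|M0 j| + (2 / om) ^+ n.+1 * `|M1 j|)).
have t0 j : 0 <= `|M0 j| + (2 / om) ^+ n.+1 * `|M1 j|.
  by rewrite addr_ge0 // mulr_ge0 // exprn_ge0 // divr_ge0 // ltW.
split; first exact: sumr_ge0.
have tj j : `|M0 j| + (2 / om) ^+ n.+1 * `|M1 j| <=
    \sum_(j < n) (`|M0 j| + (2 / om) ^+ n.+1 * `|M1 j|).
  by rewrite [leRHS](bigD1 j) //= lerDl sumr_ge0.
move=> y z.
have -> : Cint (fun x => wave (freq (val y)) x * p y x *
     conjc (wave (freq (val z)) x * p z x)) =
   Cint (fun x => wave (freq (val y - val z)) x * (p y x * conjc (p z x))).
  apply: eq_Cint => x; rewrite freqB -wave_conj rmorphM /=; ring.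
set G := cabs _.
have [yz|yz] := eqVneq (val y - val z) 0.
  (* On the diagonal any coordinate serves; one exists because [y] is nonzero, which rules out
     dimension 0. *)
  have [i _] := absn_eq (valP y).
  apply: le_trans (ler_wpM2r (lat_weight_ge0 _) (tj i)).
  rewrite yz /lat_weight absn0 invr1 expr1n mulr1.
  have := H0 i (y, z) (freq (val y - val z)); rewrite expr0 mul1r => H.
  apply: (le_trans H); apply: (le_trans (ler_norm _)).
  by rewrite lerDl mulr_ge0 // exprn_ge0 // divr_ge0 // ltW.
have [i Ei] := absn_eq yz.
apply: le_trans (ler_wpM2r (lat_weight_ge0 _) (tj i)).
have := H1 i (y, z) (freq (val y - val z)); rewrite freqE Ei -/G => H.
have a0 : (0 < absn (val y - val z))%N by exact: absn_gt0.
move: H a0; rewrite /lat_weight; set k := absn _ => H k0.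
have ok0 : 0 < (om * k%:R) ^+ n.+1 by rewrite exprn_gt0 // mulr_gt0 // ltr0n.
have G1 : G <= ((om * k%:R)^-1) ^+ n.+1 * `|M1 i|.
  rewrite exprVn ler_pdivlMl //; exact: le_trans H (ler_norm _).
apply: (le_trans G1).
(* The factor 2 turns 1/k into 1/(k+1), since k+1 <= 2k for k >= 1. *)
apply: (@le_trans _ _ ((2 / om) ^+ n.+1 * `|M1 i| * k.+1%:R^-1 ^+ n.+1)).
  rewrite mulrAC ler_wpM2r // -exprMn.
  apply: lerXn2r.
  - by rewrite nnegrE invr_ge0 mulr_ge0 // ltW.
  - by rewrite nnegrE mulr_ge0 ?invr_ge0 // divr_ge0 // ltW.
  rewrite invfM [2 / om]mulrC -mulrA ler_wpM2l ?invr_ge0 ?(ltW om0) //.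
  rewrite ler_pdivlMr ?ltr0Sn // mulrC ler_pdivrMr ?ltr0n //.
  by rewrite -natrM ler_nat; lia.
by rewrite ler_wpM2r ?exprn_ge0 ?invr_ge0 // lerDr.
Qed.

(** Schur's test: expand the square, bound each |d_y d_z| by the half-sum of squares, and sum the
    decaying Gram entries along rows with [lattice_sum]. The constant depends neither on [A] nor on
    [d]. *)
Lemma synthesis_bound (p : Zs -> V -> C) : dfam K p -> exists B : R, 0 <= B /\
  forall (A : seq Zs) (d : Zs -> C), uniq A ->
    L2fun (fun x => \sum_(z <- A) d z * (wave (freq (val z)) x * p z x)) /\
    nrm2 (fun x => \sum_(z <- A) d z * (wave (freq (val z)) x * p z x)) <=
      B * \sum_(z <- A) csq (d z).
Proof.
move=> dp; have [B [B0 HB]] := gram_decay dp; have [Z HZ] := @lattice_sum R n.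
have Z0 : 0 <= Z by have := HZ [::] isT; rewrite big_nil.
exists (B * Z); split; first exact: mulr_ge0.
move=> A d uA.
pose e z x : C := wave (freq (val z)) x * p z x.
have de z : dfam K (fun (_ : unit) => e z).
  apply: (dfam_wave (freq (val z))).
  exact: (@dfam_reindex _ _ _ _ _ (fun=> z) p).
have dS : dfam K (fun (_ : unit) x => \sum_(z <- A) d z * e z x).
  split => [m|_ x Kx]; last first.
    by rewrite big1 // => z _; have [_ e0] := de z; rewrite (e0 tt) // mulr0.
  apply: (CUB_sum (@openT V)) => z; apply: (CUBM (@openT V)); last by case: (de z).
  apply: (@CUB_cst _ _ _ _ (@openT V) _ _ (cabs (d z))) => _.
  by split; [exact: cRe_le_cabs|exact: cIm_le_cabs].
split; first exact: (dfam_L2fun rho0 KB tt dS).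
have L2conj (v : V -> C) : L2fun v -> L2fun (fun x => conjc (v x)).
  move=> [v1 v2 v3]; split.
  - by apply: (eq_measurable_fun (fun x : BV n => cRe (v x))) => // x _; rewrite conjcE.
  - apply: (eq_measurable_fun (fun x : BV n => - cIm (v x))) => [x _|].
      by rewrite conjcE.
    exact: measurableT_comp.
  - by apply: eq_Intg v3 => x; rewrite /csq conjcE /cRe /cIm /= sqrrN.
have Iyz y z : CIntg (fun x => e y x * conjc (e z x)).
  have [H _] := L2_pair (dfam_L2fun rho0 KB tt (de y)) (L2conj _ (dfam_L2fun rho0 KB tt (de z))).
  exact: H.
pose G y z := Cint (fun x => e y x * conjc (e z x)).
have E : nrm2 (fun x => \sum_(z <- A) d z * e z x) =
    \sum_(y <- A) \sum_(z <- A) cRe (d y * conjc (d z) * G y z).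
  transitivity (cRe (Cint (fun x => \sum_(y <- A) \sum_(z <- A)
      (d y * conjc (d z)) * (e y x * conjc (e z x))))).
    rewrite /nrm2 /Cint /=; apply: eq_rnint => x.
    transitivity (cRe ((\sum_(z <- A) d z * e z x) * conjc (\sum_(z <- A) d z * e z x))).
      by set s := (\sum_(z <- A) _); rewrite /csq cReM conjcE /cRe /cIm /=; ring.
    rewrite rmorph_sum mulr_suml; congr (cRe _); apply: eq_bigr => y _.
    rewrite mulr_sumr; apply: eq_bigr => z _; rewrite rmorphM /=; ring.
  have I1 y z : CIntg (fun x => (d y * conjc (d z)) * (e y x * conjc (e z x))).
    exact: CIntgZ (Iyz y z).
  have I2 y := Cint_sum A (I1 y).
  have [_ ->] := Cint_sum A (fun y => (I2 y).1).
  rewrite cRe_sum; apply: eq_bigr => y _.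
  have [_ ->] := I2 y.
  rewrite cRe_sum; apply: eq_bigr => z _.
  by rewrite (CintZ _ (Iyz y z)).
rewrite E.
(* The bound is split into two parts that become equal after exchanging the order of summation, so
   one row estimate treats both. *)
apply: (@le_trans _ _ (\sum_(y <- A) \sum_(z <- A)
   (2^-1 * B * (csq (d y) * lat_weight (val y - val z)) +
    2^-1 * B * (csq (d z) * lat_weight (val z - val y))))).
  apply: ler_sum => y _; apply: ler_sum => z _.
  rewrite -[val z - val y]opprB lat_weightN.
  apply: (le_trans (ler_norm _)); apply: (le_trans (cRe_le_cabs _)).
  rewrite cabsM; apply: (le_trans (ler_wpM2l (cabs_ge0 _) (HB y z))).
  have -> : 2^-1 * B * (csq (d y) * lat_weight (val y - val z)) +
    2^-1 * B * (csq (d z) * lat_weight (val y - val z)) =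
    ((csq (d y) + csq (d z)) / 2) * (B * lat_weight (val y - val z)) by ring.
  apply: ler_wpM2r; first by rewrite mulr_ge0 // lat_weight_ge0.
  rewrite cabsM.
  have -> : cabs (conjc (d z)) = cabs (d z).
    by rewrite !cabsE /csq conjcE /cRe /cIm /= sqrrN.
  rewrite -!cabs_sq; have := sqr_ge0 (cabs (d y) - cabs (d z)); rewrite sqrrB.
  by move: (cabs _) (cabs _) => p1 p2; lra.
have T (q : Zs -> Zs -> R) : (forall y, \sum_(z <- A) q y z <= Z * 1) ->
   \sum_(y <- A) \sum_(z <- A) 2^-1 * B * (csq (d y) * q y z) <=
   2^-1 * B * Z * \sum_(z <- A) csq (d z).
  move=> Hq; rewrite mulr_sumr; apply: ler_sum => y _.
  rewrite -mulr_sumr -mulr_sumr -!mulrA ler_wpM2l ?invr_ge0 //.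
  rewrite ler_wpM2l // [leRHS]mulrC ler_wpM2l ?csq_ge0 //.
  by have := Hq y; rewrite mulr1.
have W (y : Zs) : \sum_(z <- A) lat_weight (val y - val z) <= Z * 1 :> R.
  rewrite mulr1; have uB : uniq (map (fun z : Zs => val y - val z) A).
    by rewrite map_inj_uniq // => z1 z2 /addrI /oppr_inj /val_inj.
  by have := HZ _ uB; rewrite big_map.
under eq_bigr do rewrite big_split /=.
rewrite big_split /=.
rewrite [X in _ + X]exchange_big /=.
have := lerD (T (fun y z => lat_weight (val y - val z)) W)
  (T (fun y z => lat_weight (val y - val z)) W).
by move/le_trans; apply; rewrite -mulrDl; apply: ler_wpM2r; [apply: sumr_ge0 => z _; exact: csq_ge0|lra].
Qed.
End AlmostOrthogonality.

(** * Weighted summability of Fourier coefficients *)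

Section EllipticEstimate.
Context {R : realType} {n : nat}.
Local Notation V := 'rV[R]_n.
Local Notation C := R[i].
Variables (a : V -> 'M[C]_n) (b : V -> R) (c : V) (rho : R) (K : set V).
Hypothesis rho0 : 0 < rho.
Local Notation Q := (ball c rho).
Hypotheses (cK : closed K) (KQ : K `<=` Q).
Hypothesis Ua : forall I m mu nu, CUB Q m (fun (_ : I) x => a x mu nu).
Hypothesis Ub : forall I m, UB Q m (fun (_ : I) x => b x).
Let oQ : open Q. Proof. exact: ball_open. Qed.

Lemma sfam_CLadj I (p : I -> V -> C) : sfam Q K p -> sfam Q K (fun i => CLadj a b (p i)).
Proof.
move=> [Up p0].
have Ubp m : CUB Q m (fun i x => (b x)%:C * p i x).
  by apply: (CUBM oQ) (Up m); apply: (CUB_real oQ); exact: Ub.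
split => [m|i x Kx].
  apply: (CUB_sum oQ) => mu; apply: (CUB_sum oQ) => nu.
  apply: (@CUB_partial _ _ _ _ _ (fun i y => a y mu nu * cpartial mu (fun z => (b z)%:C * p i z) y)).
  apply: (CUBM oQ) (Ua _ _ _ _) _.
  exact: (@CUB_partial _ _ _ _ _ (fun i z => (b z)%:C * p i z)).
rewrite /CLadj big1 // => mu _; rewrite big1 // => nu _.
apply: (vanish_cpartial nu cK _ Kx) => y Ky.
rewrite (vanish_cpartial mu cK _ Ky) ?mulr0 // => z Kz.
by rewrite p0 // mulr0.
Qed.

Lemma dfam_sfam I (p : I -> V -> C) : dfam K p -> sfam Q K p.
Proof. by move=> [Up p0]; split => // m; apply: CUB_subset (Up m). Qed.

Lemma dfam_CLadj I (p : I -> V -> C) : dfam K p -> dfam K (fun i => CLadj a b (p i)).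
Proof. by move=> /dfam_sfam /sfam_CLadj; exact: sfam_dfam. Qed.

Variable om : R.
Hypothesis om0 : 0 < om.
Local Notation Zs := (@Zs n).
Local Notation w := (fun z : Zs => freq om (val z)).
Local Notation N := (fun z : Zs => (absn (val z))%:R : R).
Local Notation h := (fun z : Zs => (N z)^-1).
Variable dl : R.
Hypothesis dl0 : 0 < dl.
Hypothesis ellip : forall (th : V) x, Q x -> dl * \sum_i th ord0 i ^+ 2 <=
  cRe (\sum_(mu < n) \sum_(nu < n)
     (b x)%:C * (a x mu nu * (th ord0 mu)%:C * (th ord0 nu)%:C)).

Lemma N_ge1 z : 1 <= N z.
Proof. by rewrite ler1n absn_gt0 // (valP z). Qed.

Lemma N_gt0 z : 0 < N z.
Proof. exact: lt_le_trans (N_ge1 z). Qed.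

(** Here [h] is the inverse sup norm of [z]; the rescaled frequency h w has all coordinates of size
    at most [om]. *)
Lemma lattice_step (p : Zs -> V -> C) : dfam K p ->
  exists p' r, [/\ dfam K p', dfam K r & forall z x,
    wave (w z) x * p z x = (h z ^+ 2)%:C * CLadj a b (fun y => wave (w z) y * p' z y) x
                           + (h z)%:C * (wave (w z) x * r z x)].
Proof.
move=> /dfam_sfam Sp.
have hb z : 0 <= h z <= 1.
  by rewrite invr_ge0 ler0n /= invf_le1 ?N_gt0 // N_ge1.
have thb z j : `|h z * w z ord0 j| <= om.
  rewrite normrM (freqE om0) ger0_norm; last by have /andP[] := hb z.
  rewrite mulrCA -[leRHS]mulr1 ler_wpM2l ?(ltW om0) //.
  by rewrite ler_pdivrMl ?N_gt0 // mulr1 ler_nat absn_ge.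
have el z x : Q x -> dl * om ^+ 2 <=
  cRe (\sum_(mu < n) \sum_(nu < n) (b x)%:C *
     (a x mu nu * (h z * w z ord0 mu)%:C * (h z * w z ord0 nu)%:C)).
  move=> Qx; have := ellip (h z *: w z) Qx.
  under [X in cRe X]eq_bigr do under eq_bigr do rewrite !mxE.
  move=> H; have -> : cRe (\sum_(mu < n) \sum_(nu < n) (b x)%:C *
     (a x mu nu * (h z * w z ord0 mu)%:C * (h z * w z ord0 nu)%:C)) =
     cRe (\sum_(mu < n) \sum_(nu < n) (b x)%:C *
     (a x mu nu * (h z * (om * (\row_i ((val z) ord0 i)%:~R : V) ord0 mu))%:C *
       (h z * (om * (\row_i ((val z) ord0 i)%:~R : V) ord0 nu))%:C)).
    by congr (cRe _); apply: eq_bigr => mu _; apply: eq_bigr => nu _; rewrite !mxE.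
  under [X in cRe X]eq_bigr do under eq_bigr do rewrite !mxE.
  apply: le_trans H; rewrite ler_wpM2l ?(ltW dl0) //.
  (* In the coordinate realising the sup norm the rescaled frequency has modulus exactly [om],
     whence the ellipticity constant dl om^2. *)
  have [i Ei] := absn_eq (valP z).
  rewrite (bigD1 i) //= -[leLHS]addr0 lerD //; last by apply: sumr_ge0 => j _; exact: sqr_ge0.
  have -> : (h z *: w z) ord0 i = h z * w z ord0 i by rewrite mxE.
  rewrite -[leRHS]real_normK ?num_real // normrM (freqE om0) Ei ger0_norm ?invr_ge0 ?ler0n //.
  by rewrite mulrCA mulVf ?mulr1 // gt_eqF // N_gt0.
have d0 : 0 < dl * om ^+ 2 by rewrite mulr_gt0 // exprn_gt0.
have [p' [r [Sp' Sr E]]] := parametrix_step oQ cK KQ hb thb (@Ua Zs) (@Ub Zs) d0 el Sp.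
by exists p', r; split => //; exact: (sfam_dfam cK KQ).
Qed.

Variables (T : Type) (k m : nat) (v : T -> nat -> V -> C) (M : R).
Hypothesis km : (2 * m + n < 4 * k)%N.
Hypothesis vL2 : forall t l, (l <= k)%N -> L2fun (v t l) /\ nrm2 (v t l) <= M.
Hypothesis vchain : forall t l (phi : V -> C), (l < k)%N -> dfam K (fun _ : unit => phi) ->
  Cint (fun x => v t l.+1 x * phi x) = Cint (fun x => v t l x * CLadj a b phi x).

(** Two counters drive the induction: [j] is the decay already gained, [l] the number of powers of
    Lbar already placed on the data. The index [t] keeps the bounds uniform over a family of
    data. *)
Definition wsum (j l : nat) (p : Zs -> V -> C) (t : T) (A : seq Zs) : R :=
  \sum_(z <- A) N z ^+ m * h z ^+ j *
     cabs (Cint (fun x => v t l x * (wave (w z) x * p z x))).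

(** The square is h^(2(j-m)), and 2(j-m) >= 4k - 2m >= n+1: this is the only place where the size of
    [k] is used quantitatively. *)
Lemma weight_le z j : (2 * k <= j)%N -> (N z ^+ m * h z ^+ j) ^+ 2 <= 2 ^+ n.+1 * lat_weight (val z).
Proof.
move=> kj; have N0 := N_gt0 z; have N1 := N_ge1 z.
have h0 : 0 <= h z by rewrite invr_ge0 ltW.
have h1 : h z <= 1 by rewrite invf_le1.
have mj : (m <= j)%N by lia.
have -> : N z ^+ m * h z ^+ j = h z ^+ (j - m).
  rewrite -{1}(subnK mj) addnC exprD mulrA -exprMn divff ?expr1n ?mul1r //.
  by rewrite gt_eqF.
rewrite -exprM.
have H : (n.+1 <= (j - m) * 2)%N by lia.
apply: (le_trans (ler_wiXn2l h0 h1 H)).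
rewrite /lat_weight -exprMn; apply: lerXn2r.
- by rewrite nnegrE.
- by rewrite nnegrE mulr_ge0 // invr_ge0.
have := absn_gt0 (valP z); set q := absn _ => q0.
rewrite ler_pdivlMr ?ltr0Sn // ler_pdivrMl ?ltr0n //.
by rewrite mulrC -natrM ler_nat; lia.
Qed.

Definition e_ (p : Zs -> V -> C) z x : C := wave (w z) x * p z x.

Lemma dfam_e (p : Zs -> V -> C) z : dfam K p -> dfam K (fun _ : unit => e_ p z).
Proof.
move=> dp; apply: (dfam_wave (w z)).
exact: (@dfam_reindex _ _ _ _ _ (fun=> z) p).
Qed.

(** Duality: a weighted sum of moduli of pairings is one pairing of the datum with a synthesised
    function, which [synthesis_bound] controls by the sum of squared weights, a convergent lattice
    sum. *)
Lemma wsum_base j l p : (2 * k <= j)%N -> (l <= k)%N -> dfam K p ->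
  exists B : R, forall t A, uniq A -> wsum j l p t A <= B.
Proof.
move=> kj lk dp.
have [B [B0 HB]] := synthesis_bound cK rho0 KQ om0 dp.
have [Z HZ] := @lattice_sum R n.
exists ((M + B * (2 ^+ n.+1 * Z)) / 2) => t A uA.
pose Tz z := Cint (fun x => v t l x * e_ p z x).
pose W z := N z ^+ m * h z ^+ j.
have W0 z : 0 <= W z by rewrite mulr_ge0 ?exprn_ge0 ?invr_ge0 ?ler0n.
(* The phase makes each term of the pairing equal to its modulus times the weight. *)
pose d z : C := (W z)%:C * cphase (Tz z).
have [L2S NS] := HB A d uA.
have [vL vM] := vL2 t lk.
have [_ H] := L2_pair vL L2S.
have Ie z : CIntg (fun x => v t l x * e_ p z x).
  by have [] := L2_pair vL (dfam_L2fun rho0 KQ tt (dfam_e z dp)).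
have E : Cint (fun x => v t l x * (\sum_(z <- A) d z * (wave (w z) x * p z x))) =
    \sum_(z <- A) d z * Tz z.
  transitivity (Cint (fun x => \sum_(z <- A) d z * (v t l x * e_ p z x))).
    by apply: eq_Cint => x; rewrite mulr_sumr; apply: eq_bigr => z _; rewrite mulrCA.
  have [_ ->] := Cint_sum A (fun z => CIntgZ (d z) (Ie z)).
  by apply: eq_bigr => z _; rewrite CintZ.
have -> : wsum j l p t A = cRe (\sum_(z <- A) d z * Tz z).
  rewrite cRe_sum; apply: eq_bigr => z _.
  have -> : d z * Tz z = (W z * cabs (Tz z))%:C by rewrite /d -mulrA cphaseE -rmorphM.
  by rewrite cRe_real.
rewrite -E; apply: (le_trans H); rewrite ler_wpM2r ?invr_ge0 // lerD //.
apply: (le_trans NS); rewrite ler_wpM2l //.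
apply: (@le_trans _ _ (\sum_(z <- A) 2 ^+ n.+1 * lat_weight (val z))).
  apply: ler_sum => z _; rewrite /d csqM.
  rewrite -[leRHS]mulr1; apply: ler_pM; rewrite ?csq_ge0 ?cphase_le1 //.
  by rewrite /csq cRe_real cIm_real expr0n /= addr0 weight_le.
rewrite -mulr_sumr ler_wpM2l ?exprn_ge0 //.
have uB : uniq (map val A) by rewrite map_inj_uniq //; exact: val_inj.
by have := HZ _ uB; rewrite big_map.
Qed.

(** The main part of [lattice_step] passes one Lbar to the datum through [vchain] and gains h^2; the
    remainder leaves [l] unchanged and gains h. *)
Lemma wsum_step j l p : (l < k)%N -> dfam K p -> exists p' r, [/\ dfam K p', dfam K r &
  forall t A, wsum j l p t A <= wsum j.+2 l.+1 p' t A + wsum j.+1 l r t A].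
Proof.
move=> lk dp; have [p' [r [dp' dr E]]] := lattice_step dp.
exists p', r; split => // t A.
rewrite /wsum -big_split /=; apply: ler_sum => z _.
have [vL _] := vL2 t (ltnW lk).
have dep := dfam_e z dp'; have der := dfam_e z dr.
have [I1 _] := L2_pair vL (dfam_L2fun rho0 KQ tt (dfam_CLadj dep)).
have [I2 _] := L2_pair vL (dfam_L2fun rho0 KQ tt der).
have -> : Cint (fun x => v t l x * (wave (w z) x * p z x)) =
   (h z ^+ 2)%:C * Cint (fun x => v t l.+1 x * (wave (w z) x * p' z x)) +
   (h z)%:C * Cint (fun x => v t l x * (wave (w z) x * r z x)).
  rewrite (vchain t lk dep) -(CintZ _ I1) -(CintZ _ I2) -CintD; last 2 first.
  - exact: CIntgZ I1.
  - exact: CIntgZ I2.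
  by apply: eq_Cint => x; rewrite E /e_; ring.
have h0 : 0 <= h z by rewrite invr_ge0 ltW // N_gt0.
apply: (le_trans (ler_wpM2l _ (cabsD _ _))); first by rewrite mulr_ge0 ?exprn_ge0 ?ler0n.
rewrite !cabsM !cabs_real (ger0_norm h0) ger0_norm ?exprn_ge0 // mulrDr.
by apply: lerD; rewrite le_eqVlt; apply/orP; left; apply/eqP; rewrite !exprS; ring.
Qed.

(** Induction on 2k - j. The invariant 2l <= j is kept by both branches and forces l < k as long as
    j < 2k, so a further power of Lbar is always available. *)
Lemma wsum_bounded l j p : (l <= k)%N -> (2 * l <= j)%N -> dfam K p ->
  exists B : R, forall t A, uniq A -> wsum j l p t A <= B.
Proof.
move: {2}(2 * k - j)%N (erefl (2 * k - j)%N) => q.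
have [q' ] := ubnP q; elim: q' l j p q => // q' IH l j p q qq Eq lk lj dp.
have [kj|jk] := leqP (2 * k) j; first exact: wsum_base.
have lk' : (l < k)%N by lia.
have [p' [r [dp' dr E]]] := wsum_step j lk' dp.
have [B1 H1] := IH l.+1 j.+2 p' (2 * k - j.+2)%N ltac:(lia) erefl lk' ltac:(lia) dp'.
have [B2 H2] := IH l j.+1 r (2 * k - j.+1)%N ltac:(lia) erefl lk ltac:(lia) dr.
exists (B1 + B2) => t A uA; apply: (le_trans (E t A)).
by rewrite lerD ?H1 ?H2.
Qed.

Lemma fourier_bound p : dfam K p -> exists B : R, forall t A, uniq A ->
  \sum_(z <- A) N z ^+ m * cabs (Cint (fun x => v t 0 x * (wave (w z) x * p z x))) <= B.
Proof.
move=> dp; have [B HB] := wsum_bounded (leq0n k) (leq0n 0) dp.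
exists B => t A uA; apply: le_trans (HB t A uA).
by rewrite /wsum; apply: ler_sum => z _; rewrite expr0 mulr1.
Qed.
End EllipticEstimate.

(** * The weak equation restricted to a cube *)

Section Localization.
Context {R : realType} {n : nat}.
Local Notation V := 'rV[R]_n.
Local Notation C := R[i].

Definition rst (Q : set V) (u : V -> C) : V -> C := fun x => (\1_Q x : R)%:C * u x.

Lemma rst_in Q u x : Q x -> rst Q u x = u x.
Proof. by move=> Qx; rewrite /rst indicE mem_set // mul1r. Qed.

Lemma rst_out Q u x : ~ Q x -> rst Q u x = 0.
Proof. by move=> Qx; rewrite /rst indicE memNset // mul0r. Qed.

Lemma csq_rst Q u x : csq (rst Q u x) = \1_Q x * csq (u x).
Proof.
rewrite indicE; have [Qx|Qx] := pselect (Q x).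
  by rewrite rst_in // mem_set // mul1r.
by rewrite rst_out // memNset // mul0r /csq /= expr0n /= addr0.
Qed.

Lemma measurable_rst_part (Om Q : set V) (f : V -> R) : open Q -> Q `<=` Om ->
  (forall A : set R, open A -> borelRn (Om `&` f @^-1` A)) ->
  measurable_fun setT ((fun x => \1_Q x * f x) : BV n -> R).
Proof.
move=> oQ QOm bf; apply: measurable_fun_openR => A OA.
have mQ : measurable (Q : set (BV n)) by exact: open_measurable_BV.
have mA : measurable (Om `&` f @^-1` A : set (BV n)) by exact: bf.
have -> : (fun x : BV n => \1_Q x * f x) @^-1` A =
    (Q `&` (Om `&` f @^-1` A)) `|` (~` Q `&` [set x | A 0]).
  apply/seteqP; split => x; rewrite /preimage /= indicE.
    have [Qx|Qx] := pselect (Q x).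
      by rewrite mem_set // mul1r => Ax; left; split => //; split => //; exact: QOm.
    by rewrite memNset // mul0r; right.
  by move=> [[Qx [_ Ax]]|[Qx A0]]; [rewrite mem_set // mul1r|rewrite memNset // mul0r].
apply: measurableU; first exact: measurableI.
apply: measurableI; first exact: measurableC.
have [A0|A0] := pselect (A 0).
  by rewrite (_ : [set x | A 0] = setT) //; apply/seteqP; split.
by rewrite (_ : [set x | A 0] = set0) //; apply/seteqP; split.
Qed.

Lemma L2fun_rst (Om Q : set V) (u : V -> C) : relcpt Om Q -> borel_on Om u ->
  (sqnorm Q u < +oo)%E ->
  L2fun (rst Q u) /\ (nrm2 (rst Q u))%:E = sqnorm Q u.
Proof.
move=> [oQ [_ cQ]] [b1 b2] fin.
have QOm : Q `<=` Om by move=> x Qx; apply/cQ/subset_closure.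
have m1 : measurable_fun setT ((fun x => cRe (rst Q u x)) : BV n -> R).
  apply: eq_measurable_fun (measurable_rst_part oQ QOm b1) => x _.
  by rewrite /rst cReM cRe_real cIm_real mul0r subr0.
have m2 : measurable_fun setT ((fun x => cIm (rst Q u x)) : BV n -> R).
  apply: eq_measurable_fun (measurable_rst_part oQ QOm b2) => x _.
  by rewrite /rst cImM cRe_real cIm_real mul0r addr0.
have m3 : measurable_fun setT ((fun x => csq (rst Q u x)) : BV n -> R).
  by apply: measurable_funD; apply: measurable_funX.
have E : sqnorm Q u = (\int[lam n]_x (csq (rst Q u x))%:E)%E.
  rewrite -iint_ge0_integral.
  - by apply: (congr1 (@iint R n)); apply/funext => x; rewrite csq_rst.
  - exact/measurable_EFinP.
  - by move=> x; rewrite lee_fin csq_ge0.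
have I : Intg (fun x => csq (rst Q u x)).
  apply/integrableP; split; first exact/measurable_EFinP.
  have -> : (\int[lam n]_x `|(EFin \o (fun x => csq (rst Q u x))) x|)%E = sqnorm Q u => //.
  by rewrite E; apply: eq_integral => x _ /=; rewrite ger0_norm // csq_ge0.
split => //; rewrite E /nrm2 /rnint /Rintegral fineK //.
exact: integrable_fin_num.
Qed.

Variables (Om : set V) (a : V -> 'M[C]_n) (b : V -> R) (c : V) (rho : R) (K : set V).
Hypothesis rho0 : 0 < rho.
Local Notation Q := (ball c rho).
Hypotheses (cK : closed K) (KQ : K `<=` Q) (QOm : relcpt Om Q).
Hypothesis Ua : forall I m mu nu, CUB Q m (fun (_ : I) x => a x mu nu).
Hypothesis Ub : forall I m, UB Q m (fun (_ : I) x => b x).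
Let oQ : open Q. Proof. exact: ball_open. Qed.
Let QO : Q `<=` Om.
Proof. by case: QOm => _ [_ H] x Qx; apply/H/subset_closure. Qed.

Lemma test_fun_dfam (phi : V -> R) : dfam K (fun (_ : unit) x => (phi x)%:C : C) ->
  test_fun Om phi.
Proof.
move=> [Up p0].
have sub : closure [set x | phi x <> 0] `<=` K.
  rewrite [X in _ `<=` X](proj1 (closure_id K) cK); apply: closureS => x /= px.
  apply: contrapT => Kx; apply: px.
  by have := congr1 (@cRe R) (p0 tt x Kx).
split; first by move=> m; have [U1 _] := Up m; exact: (UB_CmR tt U1).
split; last by apply: subset_trans sub _; exact: subset_trans KQ QO.
apply: (subclosed_compact (@closed_closure _ _) (@closure_ball_compact _ _ c rho)).
by apply: subset_trans sub _; apply: subset_trans KQ _; exact: subset_closure.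
Qed.

Lemma Lbar_adjE (phi : V -> R) x : Lbar_adj a b phi x = CLadj a b (fun y => (phi y)%:C) x.
Proof.
apply: eq_bigr => mu _; apply: eq_bigr => nu _; congr (cpartial nu _ x).
apply/funext => y; congr (_ * _); apply: eq_cReIm => /=.
  by apply: eq_partial => z; rewrite ?mulr0 ?mul0r ?subr0.
rewrite (_ : (fun _ => _) = fun=> 0) ?partial_cst //.
by apply/funext => z; rewrite mulr0 mul0r addr0.
Qed.

(** Derivatives are additive only at points of derivability, and [a], [b] are controlled only on the
    cube. Hence the split: smooth coefficients near points of [K], and vanishing of all terms
    elsewhere. *)
Lemma CLadjD (p q : V -> C) x : dfam K (fun _ : unit => p) -> dfam K (fun _ : unit => q) ->
  CLadj a b (fun y => p y + q y) x = CLadj a b p x + CLadj a b q x.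
Proof.
move=> dp dq.
have [Kx|Kx] := pselect (K x); last first.
  have Z f : dfam K (fun _ : unit => f) -> CLadj a b f x = 0.
    by move=> df; have [_ H] := dfam_CLadj cK KQ Ua Ub df; apply: (H tt).
  rewrite !Z ?addr0 //; split => [m|_ y Ky].
    by apply: (CUBD (@openT V)); [case: dp|case: dq].
  by have [_ p0] := dp; have [_ q0] := dq; rewrite (p0 tt) // (q0 tt) // addr0.
have Qx := KQ Kx.
have Ubp f m : dfam K (fun _ : unit => f) -> CUB Q m (fun (_ : unit) y => (b y)%:C * f y).
  move=> [Uf _]; apply: (CUBM oQ); first by apply: (CUB_real oQ); exact: Ub.
  exact: CUB_subset (Uf m).
have Uap f m mu nu : dfam K (fun _ : unit => f) ->
    CUB Q m (fun (_ : unit) y => a y mu nu * cpartial mu (fun z => (b z)%:C * f z) y).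
  move=> df; apply: (CUBM oQ); first exact: Ua.
  exact: (CUB_partial mu (Ubp f m.+1 df)).
rewrite /CLadj -big_split; apply: eq_bigr => mu _; rewrite -big_split; apply: eq_bigr => nu _ /=.
rewrite -cpartialD.
- apply: near_cpartial; apply: (@filterS _ _ _ Q); last exact: (open_nbhs_nbhs (conj oQ Qx)).
  have E : (fun z => (b z)%:C * (p z + q z)) = (fun z => (b z)%:C * p z + (b z)%:C * q z).
    by apply/funext => z; rewrite mulrDr.
  move=> y Qy; rewrite E -mulrDr; congr (_ * _).
  apply: cpartialD.
  + exact: (CUB_cdrv tt mu (Ubp p 1%N dp) Qy).
  + exact: (CUB_cdrv tt mu (Ubp q 1%N dq) Qy).
- exact: (CUB_cdrv tt nu (Uap p 1%N mu nu dp) Qx).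
- exact: (CUB_cdrv tt nu (Uap q 1%N mu nu dq) Qx).
Qed.

Lemma dfamZ (k : C) (p : V -> C) : dfam K (fun _ : unit => p) ->
  dfam K (fun (_ : unit) x => k * p x).
Proof.
apply: (dfam_mul (q := fun _ _ => k)) => m.
apply: (@CUB_cst _ _ _ _ (@openT V) _ _ (cabs k)) => _.
by split; [exact: cRe_le_cabs|exact: cIm_le_cabs].
Qed.

Lemma CLadjZ (k : C) (p : V -> C) x : dfam K (fun _ : unit => p) ->
  CLadj a b (fun y => k * p y) x = k * CLadj a b p x.
Proof.
move=> dp.
have [Kx|Kx] := pselect (K x); last first.
  have Z f : dfam K (fun _ : unit => f) -> CLadj a b f x = 0.
    by move=> df; have [_ H] := dfam_CLadj cK KQ Ua Ub df; apply: (H tt).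
  by rewrite !Z ?mulr0 //; exact: dfamZ.
have Qx := KQ Kx.
have Ubp m : CUB Q m (fun (_ : unit) y => (b y)%:C * p y).
  case: dp => Uf _; apply: (CUBM oQ); first by apply: (CUB_real oQ); exact: Ub.
  exact: CUB_subset (Uf m).
have Uap m mu nu :
    CUB Q m (fun (_ : unit) y => a y mu nu * cpartial mu (fun z => (b z)%:C * p z) y).
  apply: (CUBM oQ); first exact: Ua.
  exact: (CUB_partial mu (Ubp m.+1)).
rewrite /CLadj mulr_sumr; apply: eq_bigr => mu _; rewrite mulr_sumr; apply: eq_bigr => nu _ /=.
rewrite -cpartialZ; last exact: (CUB_cdrv tt nu (Uap 1%N mu nu) Qx).
apply: near_cpartial; apply: (@filterS _ _ _ Q); last exact: (open_nbhs_nbhs (conj oQ Qx)).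
have E : (fun z => (b z)%:C * (k * p z)) = (fun z => k * ((b z)%:C * p z)).
  by apply/funext => z; rewrite mulrCA.
move=> y Qy; rewrite E mulrCA; congr (_ * _).
exact: (cpartialZ k (CUB_cdrv tt mu (Ubp 1%N) Qy)).
Qed.

Lemma weakL_rst_real (u g : V -> C) (phi : V -> R) : L2fun (rst Q u) -> L2fun (rst Q g) ->
  weakL Om a b u g -> dfam K (fun (_ : unit) x => (phi x)%:C : C) ->
  Cint (fun x => rst Q g x * (phi x)%:C) =
  Cint (fun x => rst Q u x * CLadj a b (fun y => (phi y)%:C) x).
Proof.
move=> Lu Lg W dphi; have [W1 W2] := W phi (test_fun_dfam dphi).
have dL := dfam_CLadj cK KQ Ua Ub dphi.
have [[I1 I2] _] := L2_pair Lg (dfam_L2fun rho0 KQ tt dphi).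
have [[J1 J2] _] := L2_pair Lu (dfam_L2fun rho0 KQ tt dL).
have rE (f p : V -> C) x : dfam K (fun _ : unit => p) -> f x * p x = rst Q f x * p x.
  move=> dp; have [Qx|Qx] := pselect (Q x); first by rewrite rst_in.
  have [_ p0] := dp; rewrite (p0 tt x (off_ball KQ Qx)) !mulr0 //.
apply: eq_cReIm => /=; apply: EFin_inj.
  rewrite -(iint_rnint I1) -(iint_rnint J1).
  transitivity (iint (fun x => (cRe (g x) * phi x)%:E)).
    apply: (congr1 (@iint R n)); apply/funext => x; rewrite -(rE g _ x dphi).
    by rewrite cReM cRe_real cIm_real mulr0 subr0.
  rewrite W1; apply: (congr1 (@iint R n)); apply/funext => x.
  by rewrite Lbar_adjE (rE u _ x dL).
rewrite -(iint_rnint I2) -(iint_rnint J2).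
transitivity (iint (fun x => (cIm (g x) * phi x)%:E)).
  apply: (congr1 (@iint R n)); apply/funext => x; rewrite -(rE g _ x dphi).
  by rewrite cImM cRe_real cIm_real mulr0 add0r.
rewrite W2; apply: (congr1 (@iint R n)); apply/funext => x.
by rewrite Lbar_adjE (rE u _ x dL).
Qed.

(** The weak equation is given for real test functions; complex linearity of [CLadj] on real and
    imaginary parts extends it to complex amplitudes. *)
Lemma weakL_rst (u g : V -> C) (phi : V -> C) : L2fun (rst Q u) -> L2fun (rst Q g) ->
  weakL Om a b u g -> dfam K (fun _ : unit => phi) ->
  Cint (fun x => rst Q g x * phi x) = Cint (fun x => rst Q u x * CLadj a b phi x).
Proof.
move=> Lu Lg W dphi.
have [Up p0] := dphi.
have d1 : dfam K (fun (_ : unit) x => (cRe (phi x))%:C : C).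
  split => [m|_ x Kx]; last by rewrite (p0 tt).
  by apply: (CUB_real (@openT V)); case: (Up m).
have d2 : dfam K (fun (_ : unit) x => (cIm (phi x))%:C : C).
  split => [m|_ x Kx]; last by rewrite (p0 tt).
  by apply: (CUB_real (@openT V)); case: (Up m).
pose J : C := 0 +i* 1.
have phiE : phi = (fun x => (cRe (phi x))%:C + J * (cIm (phi x))%:C).
  apply/funext => x; apply: eq_cReIm; rewrite ?cReD ?cImD ?cReM ?cImM /cRe /cIm /=; ring.
have d3 := dfamZ J d2.
have [I1 _] := L2_pair Lg (dfam_L2fun rho0 KQ tt d1).
have [I2 _] := L2_pair Lg (dfam_L2fun rho0 KQ tt d2).
have [J1 _] := L2_pair Lu (dfam_L2fun rho0 KQ tt (dfam_CLadj cK KQ Ua Ub d1)).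
have [J2 _] := L2_pair Lu (dfam_L2fun rho0 KQ tt (dfam_CLadj cK KQ Ua Ub d2)).
transitivity (Cint (fun x => rst Q g x * (cRe (phi x))%:C) +
              J * Cint (fun x => rst Q g x * (cIm (phi x))%:C)).
  rewrite -(CintZ J I2) -CintD //; last exact: CIntgZ.
  by apply: eq_Cint => x; rewrite {1}phiE; ring.
rewrite (weakL_rst_real Lu Lg W d1) (weakL_rst_real Lu Lg W d2).
rewrite -(CintZ J J2) -CintD //; last exact: CIntgZ.
apply: eq_Cint => x.
have LE : CLadj a b phi x = CLadj a b (fun y => (cRe (phi y))%:C) x +
    J * CLadj a b (fun y => (cIm (phi y))%:C) x.
  rewrite -(CLadjZ J x d2) -(CLadjD x d1 d3).
  exact: (congr1 (fun f => CLadj a b f x) phiE).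
by rewrite LE mulrDr mulrCA.
Qed.
End Localization.

(** * Completeness of the exponentials on a cube *)

Section SignIteration.
Context {R : realType}.

(* a polynomial map of [-1,1] whose iterates converge to the sign function *)
Definition sgn_poly (u : R) : R := 2^-1 * (3 * u - u * u * u).

Lemma sgn_poly_itv u : `|u| <= 1 -> `|sgn_poly u| <= 1.
Proof.
rewrite /sgn_poly !ler_norml => /andP[h1 h2]; apply/andP; split.
  have : 0 <= (1 + u) * (1 + u) * (2 - u) by rewrite !mulr_ge0 //; lra.
  lra.
have : 0 <= (1 - u) * (1 - u) * (2 + u) by rewrite !mulr_ge0 //; lra.
lra.
Qed.

Lemma iter_sgn_poly_itv N u : `|u| <= 1 -> `|iter N sgn_poly u| <= 1.
Proof. by move=> u1; elim: N => //= N IH; exact: sgn_poly_itv. Qed.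

Lemma sgn_polyN u : sgn_poly (- u) = - sgn_poly u.
Proof. by rewrite /sgn_poly; ring. Qed.

Lemma iter_sgn_polyN N u : iter N sgn_poly (- u) = - iter N sgn_poly u.
Proof. by elim: N => //= N ->; exact: sgn_polyN. Qed.

(** One step multiplies the distance 1-y to 1 by (1-y)(2+y)/2, which is at most 1 - u/2 because the
    iterates never fall below the starting value [u]. *)
Lemma iter_sgn_poly_pos N u : 0 < u <= 1 ->
  u <= iter N sgn_poly u <= 1 /\ 1 - iter N sgn_poly u <= (1 - u / 2) ^+ N.
Proof.
move=> /andP[u0 u1]; elim: N => [|N [/andP[h1 h2] h3]].
  by rewrite /= lexx u1 expr0; split => //; lra.
rewrite iterS; set y := iter N sgn_poly u in h1 h2 h3 *.
have E : 1 - sgn_poly y = (1 - y) * ((1 - y) * (2 + y) / 2) by rewrite /sgn_poly; field.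
have y0 : 0 < y by lra.
have b : (1 - y) * (2 + y) / 2 <= 1 - u / 2.
  have : 0 <= y * y by rewrite mulr_ge0 // ltW.
  lra.
split; last first.
  rewrite E exprSr; apply: ler_pM => //; first by lra.
  by rewrite !mulr_ge0 //; lra.
have : 0 <= (1 - y) * ((1 - y) * (2 + y) / 2) by rewrite !mulr_ge0 //; lra.
rewrite -E => h; apply/andP; split; last by lra.
apply: (le_trans h1); rewrite /sgn_poly.
have : 0 <= y * (1 - y) * (1 + y) by rewrite !mulr_ge0 //; lra.
lra.
Qed.

Lemma iter_sgn_poly_cvg u : `|u| <= 1 -> iter N sgn_poly u @[N --> \oo] --> Num.sg u.
Proof.
have P v : 0 < v <= 1 -> iter N sgn_poly v @[N --> \oo] --> (1 : R).
  move=> v1; have /andP[v0 vl] := v1.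
  have C : (1 - v / 2) ^+ N @[N --> \oo] --> (0 : R).
    by apply: cvg_expr; rewrite ger0_norm; lra.
  apply/cvgrPdist_le => e e0.
  have /cvgrPdist_le/(_ e e0) := C; apply: filterS => N.
  have [/andP[h1 h2] h3] := iter_sgn_poly_pos N v1.
  have q0 : 0 <= (1 - v / 2) ^+ N by apply: exprn_ge0; lra.
  rewrite sub0r normrN ger0_norm //.
  by apply: le_trans; rewrite ger0_norm //; lra.
move=> u1; have [u0|u0|->] := ltgtP u 0.
- rewrite ltr0_sg //.
  have -> : (fun N => iter N sgn_poly u) = (fun N => - iter N sgn_poly (- u)).
    by apply/funext => N; rewrite iter_sgn_polyN opprK.
  by apply: cvgN; apply: P; rewrite oppr_gt0 u0 -(ltr0_norm u0).
- by rewrite gtr0_sg //; apply: P; rewrite u0 -(gtr0_norm u0).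
- rewrite sgr0; have -> : (fun N => iter N sgn_poly 0) = (fun=> 0).
    by apply/funext => N; elim: N => //= N ->; rewrite /sgn_poly !mulr0 subrr mulr0.
  exact: cvg_cst.
Qed.
End SignIteration.

(** * Completeness in one dimension *)

Section TrigComplete1.
Context {R : realType}.
Local Notation mu := (@lebesgue_measure R).
Variables (g : R -> R) (c rho om : R).
Hypotheses (rho0 : 0 < rho) (omE : om * rho = pi).
Hypothesis ig : mu.-integrable setT (EFin \o g).
Hypothesis g0 : forall t, ~ ball c rho t -> g t = 0.
Hypothesis gcos : forall j : int, (\int[mu]_t (g t * cos (om * j%:~R * t))%:E = 0)%E.
Hypothesis gsin : forall j : int, (\int[mu]_t (g t * sin (om * j%:~R * t))%:E = 0)%E.

Let om0 : 0 < om.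
Proof. by have := @pi_gt0 R; rewrite -omE pmulr_lgt0. Qed.

Definition bounded_meas (p : R -> R) := measurable_fun setT p /\ exists M, forall t, `|p t| <= M.

Lemma bounded_measM p q : bounded_meas p -> bounded_meas q -> bounded_meas (fun t => p t * q t).
Proof.
move=> [mp [M1 H1]] [mq [M2 H2]]; split; first exact: measurable_funM.
by exists (M1 * M2) => t; rewrite normrM ler_pM.
Qed.
Lemma bounded_measD p q : bounded_meas p -> bounded_meas q -> bounded_meas (fun t => p t + q t).
Proof.
move=> [mp [M1 H1]] [mq [M2 H2]]; split; first exact: measurable_funD.
by exists (M1 + M2) => t; rewrite (le_trans (ler_normD _ _)) // lerD.
Qed.
Lemma bounded_meas_cst k : bounded_meas (fun=> k).
Proof. by split; [exact: measurable_cst|exists `|k|]. Qed.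
Lemma bounded_meas_trig (a : R) : bounded_meas (fun t => cos (a * t)) /\ bounded_meas (fun t => sin (a * t)).
Proof.
split; split.
- by apply: (measurableT_comp (continuous_measurable_fun (@continuous_cos R))); exact: mulrl_measurable.
- by exists 1 => t; rewrite ler_norml cos_geN1 cos_le1.
- by apply: (measurableT_comp (continuous_measurable_fun (@continuous_sin R))); exact: mulrl_measurable.
- by exists 1 => t; rewrite ler_norml sin_geN1 sin_le1.
Qed.

Lemma bounded_meas_int p : bounded_meas p -> mu.-integrable setT (fun t => (g t * p t)%:E).
Proof.
move=> [mp [M HM]].
apply: (@integrableMl _ _ _ mu setT measurableT (EFin \o g) p ig mp).
exists M; split; first exact: num_real.
by move=> y My x _ /=; exact: le_trans (HM x) (ltW My).
Qed.

(* Multiplication by a trig_multiplier preserves orthogonality to all exponentials. Multipliers form an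
   algebra closed under bounded pointwise limits and contain cos and sin, hence the square waves sgsin,
   whose products are, up to null sets, indicators of intervals. *)
Definition trig_null (p : R -> R) := bounded_meas p /\ forall j : int,
  (\int[mu]_t (g t * (p t * cos (om * j%:~R * t)))%:E = 0)%E /\
  (\int[mu]_t (g t * (p t * sin (om * j%:~R * t)))%:E = 0)%E.

Definition trig_multiplier (q : R -> R) := bounded_meas q /\ forall p, trig_null p -> trig_null (fun t => q t * p t).

Lemma int_lin (p q : R -> R) (a b : R) : bounded_meas p -> bounded_meas q ->
  (\int[mu]_t (g t * p t)%:E = 0)%E -> (\int[mu]_t (g t * q t)%:E = 0)%E ->
  (\int[mu]_t (g t * (a * p t + b * q t))%:E = 0)%E.
Proof.
move=> bp bq ep eq.
transitivity (\int[mu]_t (a%:E * (g t * p t)%:E + b%:E * (g t * q t)%:E))%E.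
  by apply: eq_integral => t _; rewrite -!EFinM -EFinD; congr EFin; ring.
rewrite integralD //=; [|exact/integrableZl/bounded_meas_int..].
rewrite !integralZl //; [|exact: bounded_meas_int..].
by rewrite ep eq !mule0 adde0.
Qed.

Lemma trig_null_lin p q a b : trig_null p -> trig_null q -> trig_null (fun t => a * p t + b * q t).
Proof.
move=> [bp np] [bq nq]; split.
  by apply: bounded_measD; apply: bounded_measM => //; exact: bounded_meas_cst.
move=> j; have [p1 p2] := np j; have [q1 q2] := nq j.
have [bc bs] := bounded_meas_trig (om * j%:~R).
split.
  rewrite -[RHS](int_lin a b (bounded_measM bp bc) (bounded_measM bq bc) p1 q1).
  by apply: eq_integral => t _; congr EFin; ring.
rewrite -[RHS](int_lin a b (bounded_measM bp bs) (bounded_measM bq bs) p2 q2).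
by apply: eq_integral => t _; congr EFin; ring.
Qed.

Lemma trig_multiplier_lin p q a b : trig_multiplier p -> trig_multiplier q -> trig_multiplier (fun t => a * p t + b * q t).
Proof.
move=> [bp np] [bq nq]; split; first by apply: bounded_measD; apply: bounded_measM => //; exact: bounded_meas_cst.
move=> r nr; have := trig_null_lin a b (np r nr) (nq r nr).
by congr trig_null; apply/funext => t; ring.
Qed.

Lemma trig_multiplier_mul p q : trig_multiplier p -> trig_multiplier q -> trig_multiplier (fun t => p t * q t).
Proof.
move=> [bp np] [bq nq]; split; first exact: bounded_measM.
move=> r nr; have := np _ (nq r nr).
by congr trig_null; apply/funext => t; rewrite mulrA.
Qed.

Lemma trig_multiplier_cst k : trig_multiplier (fun=> k).
Proof.
split; first exact: bounded_meas_cst.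
move=> r nr; have := trig_null_lin k 0 nr nr.
by congr trig_null; apply/funext => t; rewrite mul0r addr0.
Qed.

(** The product formulas rewrite cos times a mode [j] as a combination of the modes j+1 and j-1. *)
Lemma trig_multiplier_cos1 : trig_multiplier (fun t => cos (om * t)).
Proof.
have [bc _] := bounded_meas_trig om; split => // p [bp np]; split; first exact: bounded_measM.
move=> j; have [p1 p2] := np (j + 1); have [q1 q2] := np (j - 1).
have [bc1 bs1] := bounded_meas_trig (om * (j + 1)%:~R).
have [bc2 bs2] := bounded_meas_trig (om * (j - 1)%:~R).
split.
  rewrite -[RHS](int_lin 2^-1 2^-1 (bounded_measM bp bc1) (bounded_measM bp bc2) p1 q1).
  apply: eq_integral => t _; congr EFin.
  have -> : om * (j + 1)%:~R * t = om * j%:~R * t + om * t by rewrite intrD; ring.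
  have -> : om * (j - 1)%:~R * t = om * j%:~R * t - om * t by rewrite intrB; ring.
  by rewrite cosD cosB; field.
rewrite -[RHS](int_lin 2^-1 2^-1 (bounded_measM bp bs1) (bounded_measM bp bs2) p2 q2).
apply: eq_integral => t _; congr EFin.
have -> : om * (j + 1)%:~R * t = om * j%:~R * t + om * t by rewrite intrD; ring.
have -> : om * (j - 1)%:~R * t = om * j%:~R * t - om * t by rewrite intrB; ring.
by rewrite sinD sinB; field.
Qed.

Lemma trig_multiplier_sin1 : trig_multiplier (fun t => sin (om * t)).
Proof.
have [_ bs] := bounded_meas_trig om; split => // p [bp np]; split; first exact: bounded_measM.
move=> j; have [p1 p2] := np (j + 1); have [q1 q2] := np (j - 1).
have [bc1 bs1] := bounded_meas_trig (om * (j + 1)%:~R).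
have [bc2 bs2] := bounded_meas_trig (om * (j - 1)%:~R).
split.
  rewrite -[RHS](int_lin 2^-1 (- 2^-1) (bounded_measM bp bs1) (bounded_measM bp bs2) p2 q2).
  apply: eq_integral => t _; congr EFin.
  have -> : om * (j + 1)%:~R * t = om * j%:~R * t + om * t by rewrite intrD; ring.
  have -> : om * (j - 1)%:~R * t = om * j%:~R * t - om * t by rewrite intrB; ring.
  by rewrite sinD sinB; field.
rewrite -[RHS](int_lin (- 2^-1) 2^-1 (bounded_measM bp bc1) (bounded_measM bp bc2) p1 q1).
apply: eq_integral => t _; congr EFin.
have -> : om * (j + 1)%:~R * t = om * j%:~R * t + om * t by rewrite intrD; ring.
have -> : om * (j - 1)%:~R * t = om * j%:~R * t - om * t by rewrite intrB; ring.
by rewrite cosD cosB; field.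
Qed.

(** Dominated convergence; a uniform bound on the multipliers leaves a constant multiple of |g| as
    majorant. *)
Lemma trig_multiplier_cvg (f : nat -> R -> R) q M : (forall N, trig_multiplier (f N)) ->
  (forall N t, `|f N t| <= M) -> (forall t, `|q t| <= M) ->
  (forall t, f N t @[N --> \oo] --> q t) -> trig_multiplier q.
Proof.
move=> sf fM qM fq.
have mq : measurable_fun setT q.
  apply: (measurable_fun_cvg (h := f)) => [N|t _]; last exact: fq.
  by have [[]] := sf N.
have bq : bounded_meas q by split => //; exists M.
split => // p np; have [bp _] := np; split; first exact: bounded_measM.
have lim (r : R -> R) : bounded_meas r -> (forall N, \int[mu]_t (g t * (f N t * p t * r t))%:E = 0)%E ->
    (\int[mu]_t (g t * (q t * p t * r t))%:E = 0)%E.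
  move=> br H.
  have bpr := bounded_measM bp br; have [mpr [P HP]] := bpr.
  have [mg _] := integrableP _ _ _ ig.
  have mg' : measurable_fun setT g by exact/measurable_EFinP.
  have [mp _] := bp; have [mr _] := br.
  have c1 N : measurable_fun setT (fun t => (g t * (f N t * p t * r t))%:E).
    apply/measurable_EFinP; apply: measurable_funM => //.
    have [[mf _] _] := sf N.
    by apply: measurable_funM => //; apply: measurable_funM.
  have c2 : measurable_fun setT (fun t => (g t * (q t * p t * r t))%:E).
    apply/measurable_EFinP; apply: measurable_funM => //.
    by apply: measurable_funM => //; apply: measurable_funM.
  have c3 : {ae mu, forall t, setT t ->
      (g t * (f N t * p t * r t))%:E @[N --> \oo] --> (g t * (q t * p t * r t))%:E}.
    apply: aeW => t _; apply: cvg_EFin; first exact: nearW.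
    apply: cvgM; first exact: cvg_cst.
    apply: cvgM; last exact: cvg_cst.
    by apply: cvgM; [exact: fq|exact: cvg_cst].
  have c4 : mu.-integrable setT (fun t => ((M * P)%:E * `|(g t)%:E|)%E).
    by apply: integrableZl => //; exact: integrable_abse.
  have c5 : {ae mu, forall t N, setT t ->
      (`|(g t * (f N t * p t * r t))%:E| <= (M * P)%:E * `|(g t)%:E|)%E}.
    apply: aeW => t N _; rewrite abse_EFin -EFinM lee_fin normrM mulrC -mulrA normrM.
    by rewrite ler_wpM2r // ler_pM.
  have [_ _ C] := @dominated_convergence _ _ _ mu setT measurableT _ _ _ c1 c2 c3 c4 c5.
  have E : (fun N => (\int[mu]_t (g t * (f N t * p t * r t))%:E)%E) = (fun=> 0%E).
    by apply/funext => N; exact: H.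
  move: C; rewrite E => C.
  exact: (cvg_unique (@ereal_hausdorff R) C (cvg_cst _)).
move=> j; have [bc bs] := bounded_meas_trig (om * j%:~R); split.
  by apply: lim => // N; have [_ /(_ p np)[_ /(_ j)[]]] := sf N.
by apply: lim => // N; have [_ /(_ p np)[_ /(_ j)[]]] := sf N.
Qed.

Lemma trig_null1 : trig_null (fun=> 1).
Proof.
split; first exact: bounded_meas_cst.
move=> j; split.
  by rewrite -[RHS](gcos j); apply: eq_integral => t _; rewrite mul1r.
by rewrite -[RHS](gsin j); apply: eq_integral => t _; rewrite mul1r.
Qed.

Lemma trig_multiplier_int q : trig_multiplier q -> (\int[mu]_t (g t * q t)%:E = 0)%E.
Proof.
move=> [_ /(_ _ trig_null1)[_ /(_ 0)[H _]]]; rewrite -[RHS]H.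
by apply: eq_integral => t _; rewrite mulr0 mul0r cos0 !mulr1.
Qed.

(** The square wave of period 2 rho that jumps at [s], since om rho = pi. *)
Definition sgsin s t : R := Num.sg (sin (om * (t - s))).

Lemma trig_multiplier_sgsin s : trig_multiplier (sgsin s).
Proof.
have st : trig_multiplier (fun t => sin (om * (t - s))).
  have := trig_multiplier_lin (cos (om * s)) (- sin (om * s)) trig_multiplier_sin1 trig_multiplier_cos1.
  by congr trig_multiplier; apply/funext => t; rewrite mulrBr sinB; ring.
have sp p : trig_multiplier p -> trig_multiplier (fun t => sgn_poly (p t)).
  move=> hp; have := trig_multiplier_lin (2^-1 * 3) (- 2^-1) hp (trig_multiplier_mul (trig_multiplier_mul hp hp) hp).
  by congr trig_multiplier; apply/funext => t; rewrite /sgn_poly; ring.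
have b1 t : `|sin (om * (t - s))| <= 1 by rewrite ler_norml sin_geN1 sin_le1.
apply: (trig_multiplier_cvg (f := fun N t => iter N sgn_poly (sin (om * (t - s)))) (M := 1)).
- by elim=> // N IH; exact: sp.
- by move=> N t; exact: iter_sgn_poly_itv.
- move=> t; rewrite /sgsin; have [->|n0] := eqVneq (sin (om * (t - s))) 0.
    by rewrite sgr0 normr0.
  by rewrite normr_sg n0.
- by move=> t; exact: iter_sgn_poly_cvg.
Qed.

(** For two points of one ball of radius [rho] the difference lies in (-2 rho, 2 rho); this and
    [sgsin_neg] cover that range except for 0 and the two points at distance [rho]. *)
Lemma sgsin_pos s t : (0 < t - s < rho) \/ (- (2 * rho) < t - s < - rho) -> sgsin s t = 1.
Proof.
move=> H; rewrite /sgsin gtr0_sg //.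
have P x : 0 < x < rho -> 0 < sin (om * x).
  move=> /andP[x0 xr]; apply: sin_gt0_pi; rewrite mulr_gt0 //= -omE.
  by rewrite ltr_pM2l.
case: H => [|/andP[h1 h2]]; first exact: P.
have := P (t - s + 2 * rho); rewrite (_ : om * (t - s + 2 * rho) = om * (t - s) + pi *+ 2).
  by rewrite sinD2pi; apply; apply/andP; split; lra.
by rewrite -omE mulr2n; ring.
Qed.

Lemma sgsin_neg s t : (- rho < t - s < 0) \/ (rho < t - s < 2 * rho) -> sgsin s t = -1.
Proof.
move=> H; have := @sgsin_pos t s; rewrite /sgsin -opprB mulrN sinN sgrN => E.
by rewrite -[LHS]opprK E //; case: H => /andP[h1 h2]; [left|right]; apply/andP; split; lra.
Qed.
(** On the ball, (1 + sgsin s)/2 times (1 - sgsin s')/2 is the indicator of the interval from [s] to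
    [s'], up to the endpoints. Each square wave alone changes sign again at distance [rho], and
    there the other factor vanishes; s' - s < rho makes both factors 1 in between. *)
Lemma trig_null_itv s s' : ball c rho s -> ball c rho s' -> s < s' -> s' - s < rho ->
  \int[mu]_(t in `]s, s']) g t = 0.
Proof.
rewrite !ball_itv /= !in_itv /= => /andP[s1 s2] /andP[s1' s2'] ss' sr.
pose H t := (2^-1 + 2^-1 * sgsin s t) * (2^-1 - 2^-1 * sgsin s' t).
have sH : trig_multiplier H.
  have h1 := trig_multiplier_lin 2^-1 2^-1 (trig_multiplier_cst 1) (trig_multiplier_sgsin s).
  have h2 := trig_multiplier_lin 2^-1 (- 2^-1) (trig_multiplier_cst 1) (trig_multiplier_sgsin s').
  have := trig_multiplier_mul h1 h2; congr trig_multiplier; apply/funext => t; rewrite /H; ring.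
have bH : bounded_meas H by case: sH.
rewrite /Rintegral integral_mkcond.
suff -> : (\int[mu]_t ((EFin \o g) \_ `]s, s']) t = \int[mu]_t (g t * H t)%:E)%E by rewrite trig_multiplier_int.
have [mg _] := integrableP _ _ _ ig.
apply: ae_eq_integral => //.
- by apply/(measurable_restrictT _ _).1 => //; exact: measurable_funTS.
- by have [] := integrableP _ _ _ (bounded_meas_int bH).
have n2 : mu.-negligible [set s; s'].
  apply/negligibleP; first by apply: measurableU; exact: measurable_set1.
  by apply: countable_lebesgue_measure0; apply: finite_set_countable; exact: finite_set2.
apply: negligibleS n2 => t /= nE; apply: contrapT => /not_orP[ts ts'].
have {}ts : t != s by exact/eqP.
have {}ts' : t != s' by exact/eqP.
apply: nE => _; rewrite patchE.
have [Bt|Bt] := pselect (ball c rho t); last first.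
  by rewrite g0 // mul0r; case: ifPn => //= _; rewrite g0.
move: Bt; rewrite ball_itv /= in_itv /= => /andP[t1 t2].
case: ifPn => [|/negP]; rewrite inE /= in_itv /=.
  move=> /andP[st ts1]; have {}ts1 : t < s' by rewrite lt_neqAle ts'.
  rewrite /H sgsin_pos; last by left; apply/andP; split; lra.
  rewrite sgsin_neg; last by left; apply/andP; split; lra.
  by congr EFin; field.
move=> nI; rewrite /H.
suff -> : sgsin s t = -1 \/ sgsin s' t = 1 -> (2^-1 + 2^-1 * sgsin s t) * (2^-1 - 2^-1 * sgsin s' t) = 0.
  - by rewrite mulr0.
  - have [st|st|st] := ltgtP t s; last by rewrite st eqxx in ts.
    + have [h|h] := ltP (- rho) (t - s).
        by left; apply: sgsin_neg; left; apply/andP; split; lra.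
      by right; apply: sgsin_pos; right; apply/andP; split; lra.
    + have st' : s' < t.
        by rewrite ltNge; apply/negP => h; apply: nI; rewrite st h.
      have [h|h] := ltP (t - s') rho.
        by right; apply: sgsin_pos; left; apply/andP; split; lra.
      by left; apply: sgsin_neg; right; apply/andP; split; lra.
by move=> [->|->]; ring.
Qed.

(** The primitive of [g] is locally constant on the ball because its increments over short intervals
    vanish; by Lebesgue differentiation its derivative is [g] almost everywhere. *)
Lemma trig_complete1 : {ae mu, forall t, g t = 0}.
Proof.
have lg : locally_integrable [set: R] g by apply: open_integrable_locally ig; exact: openT.
have iS (A : set R) : measurable A -> mu.-integrable A (EFin \o g).
  by move=> mA; exact: integrableS ig.
have := FTC1Ny (fun y => iS _ (measurable_itv _)) lg.
apply: filterS => [|t [_ Ft]]; first exact: (ae_filter_ringOfSetsType mu).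
have [Bt|] := pselect (ball c rho t); last exact: g0.
rewrite -Ft derive1E; set F := fun x => _.
rewrite (@near_eq_derive _ _ _ F (cst (F t)) t 1) ?derive_cst //.
have nB : \forall y \near t, ball c rho y by apply: open_nbhs_nbhs; split => //; exact: ball_open.
have nr : \forall y \near t, ball t rho y by exact: nbhsx_ballx.
have P x y : ball c rho x -> ball c rho y -> x < y -> y - x < rho -> F y = F x.
  move=> Bx By xy yx; apply/eqP; rewrite -subr_eq0 /F; apply/eqP.
  rewrite Rintegral_itvB ?bnd_simp //; first exact: trig_null_itv; last by rewrite ltW.
  exact: iS.
apply: filterS2 nB nr => y By ty.
have [yt|yt|->//] := ltgtP y t.
- rewrite /= (P y t) //.
  by move: ty; rewrite ball_itv /= in_itv /= => /andP[h1 h2]; lra.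
- rewrite /= (P t y) //.
  by move: ty; rewrite ball_itv /= in_itv /= => /andP[h1 h2]; lra.
Qed.
End TrigComplete1.

Section AlmostEverywhere.
Context d (T : measurableType d) {R : realType} (mu : {measure set T -> \bar R}).

Lemma ae_imp (P Q : T -> Prop) : (forall x, P x -> Q x) ->
  {ae mu, forall x, P x} -> {ae mu, forall x, Q x}.
Proof. by move=> H; apply: negligibleS => x /=; apply: contra_not; exact: H. Qed.

Lemma ae_imp2 (P Q S : T -> Prop) : (forall x, P x -> Q x -> S x) ->
  {ae mu, forall x, P x} -> {ae mu, forall x, Q x} -> {ae mu, forall x, S x}.
Proof.
move=> H h1 h2; apply: negligibleS (negligibleU h1 h2) => x /= nS.
by apply: contrapT => /not_orP[/contrapT p /contrapT q]; apply: nS; exact: H.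
Qed.
End AlmostEverywhere.

(** * Slicing integrals and almost-everywhere equalities *)

Section Slices.
Context {R : realType}.
Local Notation mu := (@lebesgue_measure R).
Local Notation C := R[i].

Lemma rnint_dim0 (g : 'rV[R]_0 -> R) : rnint g = g 0.
Proof.
rewrite /rnint /Rintegral /lam integral_dirac ?diracT ?mul1e //.
rewrite (_ : (fun x => _) = cst (g 0)%:E); first exact: measurable_cst.
by apply/funext => x; rewrite (thinmx0 x).
Qed.

Lemma Cint_dim0 (g : 'rV[R]_0 -> C) : Cint g = g 0.
Proof. by apply: eq_cReIm; rewrite /Cint !rnint_dim0. Qed.

Lemma Intg_slice n (g : 'rV[R]_n.+1 -> R) : Intg g ->
  [/\ {ae mu, forall t, Intg (fun y => g (rcons_row (t, y)))},
      mu.-integrable setT (fun t => (rnint (fun y => g (rcons_row (t, y))))%:E) &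
      (\int[mu]_t (rnint (fun y => g (rcons_row (t, y))))%:E)%E = (rnint g)%:E].
Proof.
move=> ig; have ig' := lamS_integrable ig.
have A := ae_integrable1 ig'.
have If := integrable_fubini_F ig'.
have [mF _] := integrableP _ _ _ If.
have mr : measurable_fun setT (fun t => (rnint (fun y => g (rcons_row (t, y))))%:E).
  by apply/measurable_EFinP; exact: (measurableT_comp _ mF).
split => //.
  apply: le_integrable If => // t _; rewrite /rnint /Rintegral /fubini_F /=.
  by case: (\int[_]_(_ in _) _)%E => [r| |] /=; rewrite ?normr0 ?leey.
rewrite /rnint /Rintegral fineK; last exact: integrable_fin_num.
rewrite (lamS_integral ig); apply: ae_eq_integral => //.
apply: ae_imp A => t /= it _.
by rewrite fineK //; exact: integrable_fin_num.
Qed.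

Lemma CIntg_slice n (g : 'rV[R]_n.+1 -> C) : CIntg g ->
  let G t := Cint (fun y => g (rcons_row (t, y))) in
  [/\ {ae mu, forall t, CIntg (fun y => g (rcons_row (t, y)))},
      mu.-integrable setT (fun t => (cRe (G t))%:E),
      mu.-integrable setT (fun t => (cIm (G t))%:E),
      (\int[mu]_t (cRe (G t))%:E)%E = (cRe (Cint g))%:E &
      (\int[mu]_t (cIm (G t))%:E)%E = (cIm (Cint g))%:E].
Proof.
move=> [g1 g2] /=; have [A1 I1 E1] := Intg_slice g1; have [A2 I2 E2] := Intg_slice g2.
by split => //; apply: ae_imp2 A1 A2 => t; split.
Qed.

Lemma rnint_ae n (f g : 'rV[R]_n -> R) :
  measurable_fun setT (f : BV n -> R) -> measurable_fun setT (g : BV n -> R) ->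
  {ae lam n, forall x, f x = g x} -> rnint f = rnint g.
Proof.
move=> mf mg fg; rewrite /rnint /Rintegral; congr fine.
apply: ae_eq_integral => //; [exact/measurable_EFinP..|].
by apply: ae_imp fg => x -> _.
Qed.

Lemma Intg_abs n (f : 'rV[R]_n -> R) : Intg f -> Intg (fun x => `|f x|).
Proof. by move=> If; exact: integrable_norm. Qed.

Lemma rnint_eq0 n (f : 'rV[R]_n -> R) : Intg f -> (forall x, 0 <= f x) -> rnint f = 0 ->
  {ae lam n, forall x, f x = 0}.
Proof.
move=> If f0 E.
have : ae_eq (lam n) setT (EFin \o f) (cst 0%E).
  apply/(ae_eq_integral_abs _ measurableT); first by case/integrableP: If.
  transitivity (\int[lam n]_x (f x)%:E)%E.
    by apply: eq_integral => x _ /=; rewrite ger0_norm.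
  by rewrite -[LHS]fineK; [congr EFin|exact: integrable_fin_num].
by apply: ae_imp => x /(_ Logic.I) [].
Qed.

Lemma wave_measurable n (w : 'rV[R]_n) :
  measurable_fun setT ((fun x => cRe (wave w x)) : BV n -> R) /\
  measurable_fun setT ((fun x => cIm (wave w x)) : BV n -> R).
Proof.
split; apply: continuous_measurable_BV => x.
  apply: (@continuous_comp _ _ _ (dot w) cos); first exact: dot_continuous.
  exact: continuous_cos.
apply: (@continuous_comp _ _ _ (dot w) (fun t => - sin t)); first exact: dot_continuous.
by apply: cvgN; exact: continuous_sin.
Qed.

Lemma CIntg_wave n (g : 'rV[R]_n -> C) w : CIntg g -> CIntg (fun x => g x * wave w x).
Proof.
move=> [g1 g2]; have [m1 m2] := wave_measurable w.
have g12 : Intg (fun x => `|cRe (g x)| + `|cIm (g x)|).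
  have An (f : 'rV[R]_n -> R) : Intg f -> Intg (fun x => `|f x|).
    by move=> If; exact: integrable_norm.
  by apply: IntgD; exact: An.
have c1 x : `|cRe (wave w x)| <= 1 by rewrite ler_norml cos_geN1 cos_le1.
have c2 x : `|cIm (wave w x)| <= 1 by rewrite normrN ler_norml sin_geN1 sin_le1.
split; apply: Intg_le g12.
- have -> : (fun x => cRe (g x * wave w x)) = (fun x => cRe (g x) * cRe (wave w x) - cIm (g x) * cIm (wave w x)).
    by apply/funext => x; rewrite cReM.
  by apply: measurable_funB; apply: measurable_funM => //; exact: Intg_meas.
- move=> x; rewrite cReM (le_trans (ler_normB _ _)) // !normrM.
  by rewrite lerD // ler_piMr.
- have -> : (fun x => cIm (g x * wave w x)) = (fun x => cRe (g x) * cIm (wave w x) + cIm (g x) * cRe (wave w x)).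
    by apply/funext => x; rewrite cImM.
  by apply: measurable_funD; apply: measurable_funM => //; exact: Intg_meas.
- move=> x; rewrite cImM (le_trans (ler_normD _ _)) // !normrM.
  by rewrite lerD // ler_piMr.
Qed.
End Slices.

(** * Completeness in all dimensions *)

Section TrigComplete.
Context {R : realType}.
Local Notation mu := (@lebesgue_measure R).
Local Notation C := R[i].
Variables (rho om : R).
Hypotheses (rho0 : 0 < rho) (omE : om * rho = pi).

Definition zcons n (j : int) (z : 'rV[int]_n) : 'rV[int]_n.+1 :=
  \row_i (if unlift ord0 i is Some k then z ord0 k else j).

Lemma dot_zcons n j (z : 'rV[int]_n) t (y : 'rV[R]_n) :
  dot (freq om (zcons j z)) (rcons_row (t, y)) = om * j%:~R * t + dot (freq om z) y.
Proof.
rewrite /dot big_ord_recl rcons_row0 /freq !mxE unlift_none; congr (_ + _).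
by apply: eq_bigr => i _; rewrite rcons_rowS !mxE liftK.
Qed.

Lemma wave_zcons n j (z : 'rV[int]_n) t (y : 'rV[R]_n) :
  wave (freq om (zcons j z)) (rcons_row (t, y)) =
  (cos (om * j%:~R * t) +i* - sin (om * j%:~R * t)) * wave (freq om z) y.
Proof.
rewrite /wave dot_zcons cosD sinD; apply: eq_cReIm; rewrite ?cReM ?cImM /cRe /cIm /=; ring.
Qed.

Lemma integral_half (f h : R -> R) :
  mu.-integrable setT (EFin \o f) -> mu.-integrable setT (EFin \o h) ->
  (\int[mu]_t (f t + h t)%:E = 0)%E -> (\int[mu]_t (f t - h t)%:E = 0)%E ->
  (\int[mu]_t (f t)%:E = 0)%E /\ (\int[mu]_t (h t)%:E = 0)%E.
Proof.
move=> If Ih.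
have -> : (\int[mu]_t (f t + h t)%:E = \int[mu]_t (f t)%:E + \int[mu]_t (h t)%:E)%E.
  by rewrite -integralD.
have -> : (\int[mu]_t (f t - h t)%:E = \int[mu]_t (f t)%:E - \int[mu]_t (h t)%:E)%E.
  by rewrite -integralB.
have := integrable_fin_num measurableT If; have := integrable_fin_num measurableT Ih.
rewrite /comp; case: (\int[_]_(_ in _) _)%E => // x _; case: (\int[_]_(_ in _) _)%E => // y _.
by rewrite -EFinD -EFinB => -[h1] [h2]; split; congr EFin; lra.
Qed.

(** With the transverse frequency fixed, the transverse coefficient is a function v of the head
    coordinate with vanishing exponential coefficients. These mix Re v and Im v; comparing [j] with
    [-j] separates the cosine from the sine integrals, so the real one-dimensional result applies to
    each part. *)
Lemma wave_complete_slice n (w : 'rV[R]_n.+1 -> C) (c : 'rV[R]_n.+1) z : CIntg w ->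
  (forall x, ~ ball c rho x -> w x = 0) ->
  (forall z : 'rV[int]_n.+1, Cint (fun x => w x * wave (freq om z) x) = 0) ->
  {ae mu, forall t, Cint (fun y => w (rcons_row (t, y)) * wave (freq om z) y) = 0}.
Proof.
move=> Iw w0 wz; pose v t : C := Cint (fun y => w (rcons_row (t, y)) * wave (freq om z) y).
have [Aw _ _ _ _] := CIntg_slice Iw.
have [_ vR vI _ _] : [/\ True, mu.-integrable setT (fun t => (cRe (v t))%:E),
    mu.-integrable setT (fun t => (cIm (v t))%:E), True & True].
  (* Head frequency 0 yields the integrability of [v] itself. *)
  have [_ I1 I2 _ _] := CIntg_slice (CIntg_wave (freq om (zcons 0 z)) Iw).
  have E t : Cint (fun y => w (rcons_row (t, y)) * wave (freq om (zcons 0 z)) (rcons_row (t, y))) = v t.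
    apply: eq_Cint => y; rewrite wave_zcons mulr0 mul0r cos0 sin0 oppr0.
    by rewrite (_ : 1 +i* 0 = 1 :> C) // mul1r.
  split => //.
    by move: I1; under eq_fun do rewrite E.
  by move: I2; under eq_fun do rewrite E.
have mR : measurable_fun setT (fun t => cRe (v t)).
  by apply/measurable_EFinP; case/integrableP: vR.
have mI : measurable_fun setT (fun t => cIm (v t)).
  by apply/measurable_EFinP; case/integrableP: vI.
have bt (j : int) := bounded_meas_trig (om * j%:~R).
have H j : (\int[mu]_t (cRe (v t) * cos (om * j%:~R * t) + cIm (v t) * sin (om * j%:~R * t))%:E = 0)%E /\
    (\int[mu]_t (cIm (v t) * cos (om * j%:~R * t) - cRe (v t) * sin (om * j%:~R * t))%:E = 0)%E.
  have [[mc _] [ms _]] := bt j.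
  have [_ I1 I2 E1 E2] := CIntg_slice (CIntg_wave (freq om (zcons j z)) Iw).
  rewrite wz in E1 E2.
  have E : {ae mu, forall t, Cint (fun y => w (rcons_row (t, y)) * wave (freq om (zcons j z)) (rcons_row (t, y))) =
      (cos (om * j%:~R * t) +i* - sin (om * j%:~R * t)) * v t}.
    apply: ae_imp Aw => t It; rewrite /v -CintZ; last exact: CIntg_wave.
    by apply: eq_Cint => y; rewrite wave_zcons; ring.
  split.
    rewrite -[RHS]E1; apply: ae_eq_integral => //.
    - apply/measurable_EFinP; apply: measurable_funD; exact: measurable_funM.
    - by case/integrableP: I1.
    - apply: ae_imp E => t -> _; rewrite cReM; congr EFin; rewrite /cRe /cIm /=; ring.
  rewrite -[RHS]E2; apply: ae_eq_integral => //.
  - apply/measurable_EFinP; apply: measurable_funB; exact: measurable_funM.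
  - by case/integrableP: I2.
  - apply: ae_imp E => t -> _; rewrite cImM; congr EFin; rewrite /cRe /cIm /=; ring.
have N (j : int) t : cos (om * (- j)%:~R * t) = cos (om * j%:~R * t) /\
    sin (om * (- j)%:~R * t) = - sin (om * j%:~R * t).
  by rewrite mulrNz mulrN mulNr cosN sinN.
have cI (p : R -> R) := bounded_meas_int vI (p := p); have cR (p : R -> R) := bounded_meas_int vR (p := p).
have K j : ((\int[mu]_t (cRe (v t) * cos (om * j%:~R * t))%:E = 0)%E /\
    (\int[mu]_t (cIm (v t) * sin (om * j%:~R * t))%:E = 0)%E) /\
   ((\int[mu]_t (cIm (v t) * cos (om * j%:~R * t))%:E = 0)%E /\
    (\int[mu]_t (cRe (v t) * sin (om * j%:~R * t))%:E = 0)%E).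
  have [b1 b2] := bt j; have [h1 h2] := H j; have [h3 h4] := H (- j).
  split; apply: integral_half; [exact: cR|exact: cI|by []| |exact: cI|exact: cR| |by []].
  - rewrite -[RHS]h3; apply: eq_integral => t _; have [-> ->] := N j t; congr EFin; ring.
  - rewrite -[RHS]h4; apply: eq_integral => t _; have [-> ->] := N j t; congr EFin; ring.
have v0 t : ~ ball (c ord0 ord0) rho t -> v t = 0.
  move=> tB; rewrite -[RHS](Cint0 (n := n)); apply: eq_Cint => y; rewrite w0 ?mul0r //.
  by rewrite ball_rVE // => /(_ ord0); rewrite rcons_row0.
have R0 := @trig_complete1 R (fun t => cRe (v t)) (c ord0 ord0) rho om rho0 omE vR _ _ _.
have I0 := @trig_complete1 R (fun t => cIm (v t)) (c ord0 ord0) rho om rho0 omE vI _ _ _.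
have {}R0 : {ae mu, forall t, cRe (v t) = 0}.
  apply: R0 => [t /v0 ->//|j|j]; first by have [[]] := K j.
  by have [_ []] := K j.
have {}I0 : {ae mu, forall t, cIm (v t) = 0}.
  apply: I0 => [t /v0 ->//|j|j]; last by have [[]] := K j.
  by have [_ []] := K j.
by apply: ae_imp2 R0 I0 => t h1 h2; exact: eq_cReIm.
Qed.

(** Induction on the dimension: almost every slice has all coefficients 0, hence vanishes almost
    everywhere, and the nonnegative function |Re w| + |Im w| then has integral 0. *)
Lemma wave_complete n (w : 'rV[R]_n -> C) (c : 'rV[R]_n) : CIntg w ->
  (forall x, ~ ball c rho x -> w x = 0) ->
  (forall z : 'rV[int]_n, Cint (fun x => w x * wave (freq om z) x) = 0) ->
  {ae lam n, forall x, w x = 0}.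
Proof.
elim: n w c => [|n IH] w c Iw w0 wz.
  apply: aeW => x; rewrite (thinmx0 x).
  have := wz 0; rewrite Cint_dim0 /wave /dot big_ord0 cos0 sin0 oppr0.
  by rewrite (_ : 1 +i* 0 = 1 :> C) // mulr1.
pose wt t y := w (rcons_row (t, y)).
have vz : {ae mu, forall t, forall z, Cint (fun y => wt t y * wave (freq om z) y) = 0}.
  (* The exceptional null set must not depend on the frequency; countability of the lattice, through
     its enumeration, provides one for all. *)
  have H : {ae mu, forall t, forall k : nat, if @unpickle 'rV[int]_n k is Some z then
      Cint (fun y => wt t y * wave (freq om z) y) = 0 else True}.
    apply: (@ae_foralln _ _ _ mu (fun k t => if @unpickle 'rV[int]_n k is Some z then
      Cint (fun y => wt t y * wave (freq om z) y) = 0 else True)) => k.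
    case: unpickle => [z|]; last exact: aeW.
    exact: (wave_complete_slice z Iw w0 wz).
  by apply: ae_imp H => t Ht z; have := Ht (pickle z); rewrite pickleK.
have [Aw _ _ _ _] := CIntg_slice Iw.
have A0 : {ae mu, forall t, {ae lam n, forall y, wt t y = 0}}.
  apply: ae_imp2 Aw vz => t It vt.
  apply: (IH (wt t) (\row_i c ord0 (lift ord0 i)) It _ vt) => y yB.
  apply: w0; rewrite !ball_rVE // => H; apply: yB; rewrite ball_rVE // => i.
  by rewrite mxE; have := H (lift ord0 i); rewrite rcons_rowS.
pose h x := `|cRe (w x)| + `|cIm (w x)|.
have [w1 w2] := Iw.
have Ih : Intg h by apply: IntgD; exact: Intg_abs.
have h0 x : h x = 0 -> w x = 0.
  move=> hx; have a1 := normr_ge0 (cRe (w x)); have a2 := normr_ge0 (cIm (w x)).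
  by apply: eq_cReIm; apply/eqP; rewrite -normr_eq0; apply/eqP; move: hx; rewrite /h; lra.
have [A I E] := Intg_slice Ih.
have E0 : rnint h = 0.
  apply: EFin_inj; rewrite -E -[RHS](integral0 mu setT); apply: ae_eq_integral => //.
    by case/integrableP: I.
  apply: ae_imp2 A A0 => t It tw _; congr EFin; rewrite -[RHS](rnint0 (R := R) n).
  apply: rnint_ae; [exact: Intg_meas|exact: measurable_cst|].
  by apply: ae_imp tw => y; rewrite /h /wt => ->; rewrite !normr0 addr0.
by apply: ae_imp (rnint_eq0 Ih _ E0) => [x /h0|x]//; rewrite addr_ge0.
Qed.
End TrigComplete.

(** * Termwise differentiation of series *)

Section RealSeries.
Context {R : realType}.
Implicit Types (u v B : nat -> R) (M : R).

Definition rser u : R := limn (series u).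

Definition dominated u B := forall k, `|u k| <= B k.
Definition summable_by B M := (forall k, 0 <= B k) /\ forall N, \sum_(0 <= k < N) B k <= M.

Lemma summable_cvg B M : summable_by B M -> cvgn (series B) /\ limn (series B) <= M.
Proof.
move=> [B0 BM]; have c : cvgn (series B).
  apply: nondecreasing_is_cvgn; first exact: nondecreasing_series.
  by exists M => _ [N _ <-]; exact: BM.
by split => //; apply: limr_le => //; apply: nearW.
Qed.

Lemma dominated_series_cvg u B M : summable_by B M -> dominated u B ->
  cvgn (series u) /\ `|rser u| <= M.
Proof.
move=> sB uB; have [B0 _] := sB; have [cB lB] := summable_cvg sB.
have c : cvgn [normed series u] by apply: (@series_le_cvg _ (fun k => `|u k|) B).
split; first exact: normed_cvg.
rewrite (le_trans (lim_series_norm c)) // (le_trans _ lB) //.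
exact: lim_series_le.
Qed.

(** The cut-off [K] depends on the majorant alone, which is the uniformity that [tannery] relies
    on. *)
Lemma rser_tail B M e : summable_by B M -> 0 < e ->
  exists K, forall u, dominated u B -> `|rser u - series u K| <= e.
Proof.
move=> sB e0; have [B0 _] := sB; have [cB _] := summable_cvg sB.
have /cvgrPdist_le/(_ e e0)[K _ HK] := cB.
exists K => u uB; have [cu _] := dominated_series_cvg sB uB.
have := HK K (leqnn K) => {HK}.
have lBK : series B K <= limn (series B).
  by apply: nondecreasing_cvgn_le => //; exact: nondecreasing_series.
rewrite ger0_norm ?subr_ge0 // => HK; apply: le_trans HK.
have cl : (fun N => `|series u N - series u K|) @ \oo --> `|rser u - series u K|.
  by apply: cvg_norm; apply: cvgB => //; exact: cvg_cst.
rewrite -(cvg_lim (@Rhausdorff R) cl); apply: limr_le; first exact/cvgP/cl.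
near=> N.
have KN : (K <= N)%N by near: N; exact: nbhs_infty_ge.
rewrite sub_series_geq // (le_trans (ler_norm_sum _ _ _)) //.
apply: (@le_trans _ _ (\sum_(K <= k < N) B k)); first by apply: ler_sum => k _; exact: uB.
rewrite -sub_series_geq // lerB // .
by apply: nondecreasing_cvgn_le => //; exact: nondecreasing_series.
Unshelve. all: by end_near. Qed.

Lemma series_cvg_term (T : Type) (F : set_system T) {FF : Filter F} (u : T -> nat -> R) l K :
  (forall k, u x k @[x --> F] --> l k) -> series (u x) K @[x --> F] --> series l K.
Proof.
move=> ul; elim: K => [|K IH].
  rewrite (_ : (fun x => _) = fun=> 0); last by apply/funext => x; rewrite /series /= big_geq.
  by rewrite /series /= big_geq //; exact: cvg_cst.
rewrite seriesEnat /= big_nat_recr //=.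
rewrite (_ : (fun x => _) = fun x => series (u x) K + u x K).
  by apply: cvgD => //; move: IH; rewrite seriesEnat.
by apply/funext => x; rewrite seriesEnat /= big_nat_recr.
Qed.

Lemma tannery (T : Type) (F : set_system T) {FF : ProperFilter F} (u : T -> nat -> R) l B M :
  summable_by B M -> (forall k, u x k @[x --> F] --> l k) ->
  (\forall x \near F, dominated (u x) B) -> rser (u x) @[x --> F] --> rser l.
Proof.
move=> sB ul uB.
have lB : dominated l B.
  move=> k; have cl : `|u x k| @[x --> F] --> `|l k| by exact: cvg_norm.
  rewrite -(cvg_lim (@Rhausdorff R) cl); apply: limr_le; first exact/cvgP/cl.
  by apply: filterS uB.
apply/cvgrPdist_le => e e0; have e3 : 0 < e / 3 by lra.
have [K HK] := rser_tail sB e3.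
have C : series (u x) K @[x --> F] --> series l K by exact: series_cvg_term.
have /cvgrPdist_le/(_ _ e3) := C.
apply: filterS2 uB => x uB h; have h1 := HK _ uB; have h2 := HK _ lB.
have -> : rser l - rser (u x) = (rser l - series l K) + (series l K - series (u x) K) - (rser (u x) - series (u x) K).
  by ring.
rewrite (le_trans (ler_normB _ _)) // (_ : e = e / 3 + e / 3 + e / 3); last by field.
by rewrite lerD // (le_trans (ler_normD _ _)) // lerD.
Qed.

Lemma rserD u v : cvgn (series u) -> cvgn (series v) ->
  rser (fun k => u k + v k) = rser u + rser v.
Proof. exact: lim_seriesD. Qed.

Lemma rserZ c u : cvgn (series u) -> rser (fun k => c * u k) = c * rser u.
Proof. exact: lim_seriesZ. Qed.

Lemma rserB u v : cvgn (series u) -> cvgn (series v) ->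
  rser (fun k => u k - v k) = rser u - rser v.
Proof. exact: lim_seriesB. Qed.

Lemma rser_single u K : (forall k, k != K -> u k = 0) -> rser u = u K.
Proof.
move=> u0; apply: cvg_lim => //.
apply: cvg_near_cst; near=> N.
have KN : (K < N)%N by near: N; exact: nbhs_infty_gt.
rewrite seriesEnat /= (bigD1_seq K) ?mem_index_iota ?iota_uniq //= big1 ?addr0 //.
Unshelve. all: by end_near. Qed.
End RealSeries.

(** * Partial derivatives of series *)

Section SeriesOfFunctions.
Context {R : realType} {n : nat}.
Local Notation V := 'rV[R]_n.

Lemma line_in_ball j (x : V) (r h : R) : `|h| < r -> ball x r (h *: ev j + x).
Proof.
move=> hr; rewrite ball_rVE; last by rewrite (le_lt_trans _ hr).
move=> i /=; rewrite row_line opprD addrCA addrN addr0 normrN normrM.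
by apply: le_lt_trans hr; rewrite ler_piMr //; case: eqP => _; rewrite ?normr1 ?normr0.
Qed.

Lemma partial_lipschitz (O : set V) j (f : V -> R) x (r M h : R) : ball x r `<=` O ->
  (forall y, O y -> drv j f y) -> (forall y, O y -> `|partial j f y| <= M) ->
  `|h| < r -> `|f (h *: ev j + x) - f x| <= M * `|h|.
Proof.
move=> xO df Mf hr.
pose g t := f (t *: ev j + x).
have Ot t : `|t| < r -> O (t *: ev j + x).
  by move=> tr; apply: xO; exact: line_in_ball.
have dg (t : R) : `|t| < r -> is_derive t (1 : R) g (partial j f (t *: ev j + x)).
  move=> tr; have L (s : R) : g (s *: (1 : R) + t) = f (s *: ev j + (t *: ev j + x)).
    by rewrite /g [s *: _]mulr1 scalerDl addrA.
  have [[_ E1] E2] := @derive_line R R V g f t 1 (t *: ev j + x) (ev j) L.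
  by split; [apply: E1; apply: df; exact: Ot|exact: E2].
have B (a b : R) : a <= b -> `|a| < r -> `|b| < r -> `|g b - g a| <= M * (b - a).
  move=> ab ar br.
  have cr c : c \in `[a, b]%R -> `|c| < r.
    rewrite in_itv /= => /andP[ac cb]; move: ar br; rewrite !ltr_norml => /andP[? ?] /andP[? ?].
    by apply/andP; split; lra.
  have [||c cab ->] := @MVT_segment R g (fun t => partial j f (t *: ev j + x)) a b ab.
  - by move=> c cab; apply: dg; apply: cr; exact: subset_itv_oo_cc.
  - apply: derivable_within_continuous => c cab.
    by case: (dg c (cr c cab)).
  - rewrite normrM (ger0_norm (x := b - a)) ?subr_ge0 // ler_wpM2r ?subr_ge0 //.
    by apply: Mf; apply: Ot; exact: cr.
have r0 : `|0 : R| < r by rewrite normr0 (le_lt_trans _ hr).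
have -> : f x = g 0 by rewrite /g scale0r add0r.
rewrite -/(g h); have [h0|h0] := leP 0 h.
  by rewrite (le_trans (B _ _ h0 r0 hr)) // subr0 ger0_norm.
by rewrite distrC (le_trans (B _ _ (ltW h0) hr r0)) // sub0r ltr0_norm.
Qed.

(** Dominated convergence for series applied to difference quotients; by the mean value theorem
    these inherit the majorant of the derivatives. *)
Lemma drv_series (O : set V) j (f : nat -> V -> R) (B : nat -> R) M x : open O -> O x ->
  (forall k y, O y -> drv j (f k) y) -> summable_by B M ->
  (forall k y, O y -> `|f k y| <= B k) -> (forall k y, O y -> `|partial j (f k) y| <= B k) ->
  drv j (fun y => rser (fun k => f k y)) x /\
  partial j (fun y => rser (fun k => f k y)) x = rser (fun k => partial j (f k) x).
Proof.
move=> OO Ox df sB fB pB.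
have [r /= r0 xO] : exists2 r : R, 0 < r & ball x r `<=` O.
  by have /nbhs_ballP := open_nbhs_nbhs (conj OO Ox).
pose F y := rser (fun k => f k y).
have cf y : O y -> cvgn (series (fun k => f k y)).
  by move=> Oy; have [] := dominated_series_cvg sB (fun k => fB k y Oy).
have hr : \forall h \near (0 : R)^', `|h| < r by exact: dnbhs0_lt.
have Oh (h : R) : `|h| < r -> O (h *: ev j + x).
  by move=> h1; apply: xO; exact: line_in_ball.
have T : rser (fun k => h^-1 * (f k (h *: ev j + x) - f k x)) @[h --> (0 : R)^'] -->
    rser (fun k => partial j (f k) x).
  apply: (tannery sB) => [k|]; first exact: (df k x Ox).
  apply: filterS hr => h hr k.
  have := partial_lipschitz xO (df k) (pB k) hr.
  (* The filter condition used here does not exclude h = 0, where the inverse is 0 by convention and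
     the quotient vanishes. *)
  have [->|h0] := eqVneq h 0.
    by rewrite invr0 mul0r normr0 => _; have [] := sB.
  by rewrite [h^-1 * _]mulrC normrM normfV ler_pdivrMr // normr_gt0.
have C : h^-1 *: (F (h *: ev j + x) - F x) @[h --> (0 : R)^'] --> rser (fun k => partial j (f k) x).
  apply: cvg_trans T; apply: near_eq_cvg; apply: filterS hr => h hr.
  have ch := cf _ (Oh h hr); have cx := cf x Ox.
  by rewrite rserZ ?rserB //; exact: is_cvg_seriesB.
split; first by apply/cvg_ex; exists (rser (fun k => partial j (f k) x)).
exact: cvg_lim C.
Qed.
(** The summable weights [B] are kept apart from the family [g], which is bounded in C^m uniformly
    in both indices: differentiation touches only [g], and one majorant serves all orders. *)
Lemma UB_series (J : Type) (O : set V) m (g : J -> nat -> V -> R) (B : J -> nat -> R) M :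
  open O -> UB O m (fun (p : J * nat) x => g p.1 p.2 x) -> (forall i, summable_by (B i) M) ->
  UB O m (fun i x => rser (fun k => B i k * g i k x)).
Proof.
move=> OO + sB.
have sBZ i (L : R) : summable_by (fun k => B i k * `|L|) (M * `|L|).
  have [B0 BM] := sB i; split => [k|N]; first by rewrite mulr_ge0.
  by rewrite -mulr_suml ler_wpM2r.
have db i k (L y : R) : `|y| <= L -> `|B i k * y| <= B i k * `|L|.
  have [B0 _] := sB i.
  by move=> yL; rewrite normrM ger0_norm // ler_wpM2l // (le_trans yL) // ler_norm.
have bc h : (exists L : R, forall p x, O x -> `|h p.1 p.2 x| <= L) ->
    (forall (p : J * nat) x, O x -> {for x, continuous (h p.1 p.2)}) ->
    (exists L : R, forall i x, O x -> `|rser (fun k => B i k * h i k x)| <= L) /\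
    (forall i x, O x -> {for x, continuous (fun y => rser (fun k => B i k * h i k y))}).
  move=> [L HL] ch; split.
    exists (M * `|L|) => i x Ox.
    by have [] := dominated_series_cvg (sBZ i L) (fun k => db i k L _ (HL (i, k) x Ox)).
  move=> i x Ox; apply: (@tannery R V (nbhs x) (nbhs_pfilter x) (fun y k => B i k * h i k y) _ _ _ (sBZ i L)) => [k|].
    by apply: cvgM; [exact: cvg_cst|exact: (ch (i, k) x Ox)].
  by apply: filterS (open_nbhs_nbhs (conj OO Ox)) => y Oy k; exact: db (HL (i, k) y Oy).
elim: m g => [|m IH] g.
  by move=> [Bg Cg _]; have [? ?] := bc g Bg Cg.
move=> [Bg Cg [Dg Pg]]; have [? ?] := bc g Bg Cg; split => //.
have [L HL] := Bg.
have dd i j x : O x -> drv j (fun y => rser (fun k => B i k * g i k y)) x /\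
    partial j (fun y => rser (fun k => B i k * g i k y)) x =
    rser (fun k => B i k * partial j (g i k) x).
  move=> Ox; have [L' HL'] := UB_bounded (Pg j).
  have dk k y : O y -> drv j (fun z => B i k * g i k z) y /\
      partial j (fun z => B i k * g i k z) y = B i k * partial j (g i k) y.
    move=> Oy; have dg : drv j (g i k) y := Dg (i, k) j y Oy.
    have dc : drv j (fun=> B i k) y by exact: drv_cst.
    split; first exact: (drvM dc dg).
    by rewrite (partialM dc dg) partial_cst mul0r add0r.
  have [|||E1 E2] := @drv_series O j (fun k y => B i k * g i k y)
      (* A common majorant for the terms and for their derivatives, as [drv_series] requires. *)
      (fun k => B i k * `|Num.max L L'|) (M * `|Num.max L L'|) x OO Ox _ (sBZ i _).
  - by move=> k y Oy; have [] := dk k y Oy.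
  - by move=> k y Oy; apply: db; rewrite le_max (HL (i, k) y Oy).
  - move=> k y Oy; have [_ ->] := dk k y Oy; apply: db.
    by rewrite le_max (HL' (i, k) y Oy) orbT.
  split => //; rewrite E2; congr rser; apply/funext => k.
  by have [_ ->] := dk k x Ox.
split => [i j x Ox|j]; first by have [] := dd i j x Ox.
apply: (eq_UB OO) (IH (fun i k => partial j (g i k)) (Pg j)) => i x Ox.
by have [_ ->] := dd i j x Ox.
Qed.
End SeriesOfFunctions.

(** * Polynomial factors against geometric decay *)

Section Growth.
Context {R : realType}.

(** The N+1 terms of the geometric sum up to q^N are each at least q^N. *)
Lemma linear_geometric (q : R) N : 0 <= q < 1 -> N.+1%:R * q ^+ N <= (1 - q)^-1.
Proof.
move=> /andP[q0 q1]; rewrite -[leRHS]mul1r ler_pdivlMr ?subr_gt0 //.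
apply: (@le_trans _ _ (1 - q ^+ N.+1)); last by rewrite gerBl exprn_ge0.
elim: N => [|N IH]; first by rewrite expr0 expr1; lra.
have e1 : q ^+ N.+1 <= 1 by rewrite exprn_ile1 // ltW.
have e0 : 0 <= q ^+ N.+1 by rewrite exprn_ge0.
rewrite -natr1 mulrDl mul1r mulrDl [q ^+ N.+2]exprS.
have -> : N.+1%:R * q ^+ N.+1 * (1 - q) = q * (N.+1%:R * q ^+ N * (1 - q)).
  by rewrite [q ^+ N.+1]exprS; ring.
have : q * (N.+1%:R * q ^+ N * (1 - q)) <= q * (1 - q ^+ N.+1) by rewrite ler_wpM2l.
have : 0 <= (1 - q) * (1 - q ^+ N.+1) by rewrite mulr_ge0 // subr_ge0 // ltW.
move: (q * (N.+1%:R * q ^+ N * (1 - q))) (q ^+ N.+1) e1 e0 => a b; nra.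
Qed.

(** Writing q as the square of its root spends one half of the decay on one factor N+1 and leaves
    the other half to the induction. *)
Lemma poly_geometric m (q : R) : 0 <= q < 1 ->
  exists K, forall N, N.+1%:R ^+ m * q ^+ N <= K.
Proof.
elim: m q => [|m IH] q q01; have /andP[q0 q1] := q01.
  by exists 1 => N; rewrite expr0 mul1r exprn_ile1 // ltW.
have s01 : 0 <= Num.sqrt q < 1.
  by rewrite sqrtr_ge0 -[ltRHS]sqrtr1 ltr_sqrt.
have [K HK] := IH _ s01; exists ((1 - Num.sqrt q)^-1 * K) => N.
rewrite -{1}(sqr_sqrtr q0) -exprM mulnC exprM exprS expr2.
rewrite (_ : _ * _ = (N.+1%:R * Num.sqrt q ^+ N) * (N.+1%:R ^+ m * Num.sqrt q ^+ N)); last first.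
  by ring.
have /andP[s0 _] := s01.
by apply: ler_pM => //; rewrite ?mulr_ge0 ?exprn_ge0 //; exact: linear_geometric.
Qed.
End Growth.

Section ComplexSeries.
Context {R : realType}.
Local Notation C := R[i].

Definition cser (u : nat -> C) : C := rser (fun k => cRe (u k)) +i* rser (fun k => cIm (u k)).

Lemma CUB_series n (J : Type) (O : set 'rV[R]_n) m (g : J -> nat -> 'rV[R]_n -> C)
    (B : J -> nat -> R) M :
  open O -> CUB O m (fun (p : J * nat) x => g p.1 p.2 x) -> (forall i, summable_by (B i) M) ->
  CUB O m (fun i x => cser (fun k => (B i k)%:C * g i k x)).
Proof.
move=> OO [g1 g2] sB.
have U1 := UB_series (g := fun i k x => cRe (g i k x)) OO g1 sB.
have U2 := UB_series (g := fun i k x => cIm (g i k x)) OO g2 sB.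
split; [apply: (eq_UB OO) U1|apply: (eq_UB OO) U2] => i x _; rewrite /cser /cRe /cIm /=;
  congr rser; apply/funext => k; case: (g i k x) => a b /=; ring.
Qed.

Definition cdominated (u : nat -> C) B := forall k, cabs (u k) <= B k.

Lemma cdominated_part u B : cdominated u B ->
  dominated (fun k => cRe (u k)) B /\ dominated (fun k => cIm (u k)) B.
Proof.
move=> uB; split => k; apply: le_trans (uB k); [exact: cRe_le_cabs|exact: cIm_le_cabs].
Qed.

Lemma cserZ c (u : nat -> C) B M : summable_by B M -> cdominated u B ->
  cser (fun k => c * u k) = c * cser u.
Proof.
move=> sB /cdominated_part[u1 u2].
have [c1 _] := dominated_series_cvg sB u1; have [c2 _] := dominated_series_cvg sB u2.
have z a (v : nat -> R) : cvgn (series v) -> cvgn (series (fun k => a * v k)).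
  exact: is_cvg_seriesZ.
apply: eq_cReIm; rewrite ?cReM ?cImM /cser /= -!rserZ //.
  rewrite -rserB; [|exact: z..]; congr rser; apply/funext => k.
  by rewrite -/(cRe _) cReM.
rewrite -rserD; [|exact: z..]; congr rser; apply/funext => k.
by rewrite -/(cIm _) cImM.
Qed.

Lemma eq_cser (u v : nat -> C) : (forall k, u k = v k) -> cser u = cser v.
Proof. by move=> /funext ->. Qed.

Lemma cser_single (u : nat -> C) K : (forall k, k != K -> u k = 0) -> cser u = u K.
Proof.
move=> u0; apply: eq_cReIm; rewrite /cser /=; rewrite (rser_single (K := K)) // => k /u0 -> //.
Qed.
End ComplexSeries.

(** * Exponentials and powers bounded in C^m *)

Section JointFamilies.
Context {R : realType} {n : nat}.
Local Notation V := 'rV[R]_n.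
Local Notation C := R[i].

Lemma CUB0_intro (I : Type) (O : set V) (h : I -> V -> C) M :
  (forall i x, O x -> cabs (h i x) <= M) ->
  (forall i, CUB O 0 (fun _ : unit => h i)) -> CUB O 0 h.
Proof.
move=> hM ch; split; split => //.
- by exists M => i x Ox; rewrite (le_trans (cRe_le_cabs _)) // hM.
- by move=> i x Ox; have [[_ c _] _] := ch i; exact: (c tt).
- by exists M => i x Ox; rewrite (le_trans (cIm_le_cabs _)) // hM.
- by move=> i x Ox; have [_ [_ c _]] := ch i; exact: (c tt).
Qed.

Lemma CUBS_intro (I : Type) (O : set V) m (h : I -> V -> C) :
  CUB O 0 h -> (forall i j x, O x -> cdrv j (h i) x) ->
  (forall j, CUB O m (fun i => cpartial j (h i))) -> CUB O m.+1 h.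
Proof.
move=> [[b1 c1 _] [b2 c2 _]] dh ph; split; split => //.
  by split => [i j x Ox|j]; [case: (dh i j x Ox)|case: (ph j)].
by split => [i j x Ox|j]; [case: (dh i j x Ox)|case: (ph j)].
Qed.

Lemma CUB_const (I : Type) (O : set V) m (lm : I -> C) M : open O -> (forall i, cabs (lm i) <= M) ->
  CUB O m (fun i _ => lm i).
Proof.
move=> OO lM; apply: (CUB_cst OO) => i; split; [apply: (le_trans (cRe_le_cabs _) (lM i))|apply: (le_trans (cIm_le_cabs _) (lM i))].
Qed.

(** Each derivative costs one factor at most [L i], so coefficients bounded against L^m pay for [m]
    derivatives. *)
Lemma CUB_waves (I : Type) m (lm : I -> C) (w : I -> V) (L : I -> R) M :
  (forall i, 1 <= L i) -> (forall i j, `|w i ord0 j| <= L i) ->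
  (forall i, cabs (lm i) * L i ^+ m <= M) ->
  CUB setT m (fun i x => lm i * wave (w i) x).
Proof.
move=> L1 wL.
have base (mu : I -> C) K : (forall i, cabs (mu i) <= K) -> CUB setT 0 (fun i x => mu i * wave (w i) x).
  move=> muK; apply: (CUB0_intro (M := K)) => [i x _|i].
    by rewrite cabsM [cabs (wave _ _)]cabsE /csq wave_norm sqrtr1 mulr1.
  apply: (CUBM (@openT V)); last exact: CUB_wave.
  by apply: (CUB_const _ (@openT V) (M := cabs (mu i))) => _.
elim: m lm M => [|m IH] lm M lM.
  by apply: (base lm M) => i; rewrite -[cabs _]mulr1 -(expr0 (L i)).
apply: CUBS_intro.
- apply: (base lm M) => i; rewrite (le_trans _ (lM i)) // ler_peMr ?cabs_ge0 //.
  by rewrite exprn_ege1.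
- by move=> i j x _; apply: cdrvM; [exact: cdrv_cst|case: (cpartial_wave (w i) x j)].
- move=> j; apply: (eq_CUB (@openT V)) (IH (fun i => lm i * kap (w i) j) M _) => [i x _|i].
    have [dw Ew] := cpartial_wave (w i) x j.
    by rewrite (cpartialM (cdrv_cst j (lm i) x) dw) cpartial_cst mul0r add0r Ew mulrA.
  rewrite cabsM (le_trans _ (lM i)) // -mulrA ler_wpM2l ?cabs_ge0 // exprS.
  rewrite ler_wpM2r ?exprn_ge0 ?(le_trans ler01) //.
  apply: le_trans (wL i j).
  by rewrite cabsE /csq /kap /cRe /cIm /= expr0n /= add0r sqrrN sqrtr_sqr.
Qed.

Lemma drv_coord k j (x : V) : drv j (fun y : V => y ord0 k) x /\
  partial j (fun y : V => y ord0 k) x = (k == j)%:R.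
Proof.
have [h1 h2] := @is_derive_affine_comp R V id 1 (fun y : V => y ord0 k) x (ev j) (k == j)%:R
  (fun h => row_line x h k j) (is_derive_id _ _).
by split => //; rewrite mulr1 in h2.
Qed.

Lemma UB_coord (I : Type) (O : set V) m k M : open O -> (forall x, O x -> `|x ord0 k| <= M) ->
  UB O m (fun (_ : I) x => x ord0 k).
Proof.
move=> OO HM.
have d j x := drv_coord k j x.
have c x : {for x, continuous (fun y : V => y ord0 k)} by exact: coord_continuous.
case: m => [|m]; split => //; [by exists M|by exists M|].
split => [_ j x _|j]; first by have [] := d j x.
apply: (eq_UB OO) (UB_cst OO m (k := fun=> (k == j)%:R) (M := 1) _) => [_ x _|_].
  by have [_ ->] := d j x.
by case: eqP => _; rewrite ?normr1 ?normr0.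
Qed.

Definition zc (a b : 'I_n) (v : V) : C := v ord0 a +i* v ord0 b.

Lemma CUB_zc (I : Type) (O : set V) m a b r : open O -> (forall v, O v -> cabs (zc a b v) < r) ->
  CUB O m (fun _ : I => zc a b).
Proof.
move=> OO Or; split; [apply: (@UB_coord I O m a r OO)|apply: (@UB_coord I O m b r OO)] => x /Or /ltW; apply: le_trans.
  exact: (cRe_le_cabs (zc a b x)).
exact: (cIm_le_cabs (zc a b x)).
Qed.

Lemma cpartial_zcX (O : set V) a b p r j x : open O -> (forall v, O v -> cabs (zc a b v) < r) -> O x ->
  cdrv j (fun v => zc a b v ^+ p) x /\
  cpartial j (fun v => zc a b v ^+ p) x = ((a == j)%:R +i* (b == j)%:R) * (p%:R * zc a b x ^+ p.-1).
Proof.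
move=> OO Or Ox.
have d : cdrv j (zc a b) x := CUB_cdrv tt j (CUB_zc unit 1 OO Or) Ox.
have E : cpartial j (zc a b) x = (a == j)%:R +i* (b == j)%:R.
  have P k := (drv_coord k j x).2.
  by rewrite /cpartial /zc /cRe /cIm /= !P.
elim: p => [|p [IH1 IH2]].
  rewrite mul0r mulr0 (_ : (fun _ => _) = fun=> 1); last by apply/funext => y; rewrite expr0.
  by split; [exact: cdrv_cst|exact: cpartial_cst].
rewrite (_ : (fun _ => _) = fun v => zc a b v * zc a b v ^+ p); last by apply/funext => y; rewrite exprS.
split; first exact: cdrvM.
rewrite (cpartialM d IH1) IH2 E /=.
case: p {IH1 IH2} => [|p] /=; first by rewrite mul0r !mulr0 addr0 !mulr1.
by rewrite exprS -[p.+2%:R]natr1; ring.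
Qed.

(** Each real derivative of zeta^p brings a factor [p] and lowers the exponent, so the coefficients
    must absorb (p+1)^m on the disc of radius [r]. *)
Lemma CUB_powers (I : Type) (O : set V) m a b r (lm : I -> C) (p : I -> nat) M : open O -> 0 < r ->
  (forall v, O v -> cabs (zc a b v) < r) ->
  (forall i, cabs (lm i) * (p i).+1%:R ^+ m * r ^+ p i <= M) ->
  CUB O m (fun i v => lm i * zc a b v ^+ p i).
Proof.
move=> OO r0 Or.
have base (mu : I -> C) (q : I -> nat) K : (forall i, cabs (mu i) * r ^+ q i <= K) ->
    CUB O 0 (fun i v => mu i * zc a b v ^+ q i).
  move=> muK; apply: (CUB0_intro (M := K)) => [i x Ox|i].
    rewrite cabsM cabsX (le_trans _ (muK i)) // ler_wpM2l ?cabs_ge0 //.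
    by rewrite lerXn2r ?nnegrE ?cabs_ge0 // ltW // Or.
  apply: (CUBM OO); first by apply: (CUB_const _ OO (M := cabs (mu i))) => _.
  elim: (q i) => [|k IH].
    apply: (eq_CUB OO) (CUB_const 0 OO (lm := fun=> 1) (M := 1) _) => [? x _|_]; first by rewrite expr0.
    by rewrite cabs_real ?normr1.
  apply: (eq_CUB OO) (CUBM OO (CUB_zc unit 0 OO Or) IH) => ? x _.
  by rewrite exprS.
elim: m lm p M => [|m IH] lm p M lM.
  by apply: (base lm p M) => i; have := lM i; rewrite expr0 mulr1.
apply: CUBS_intro.
- apply: (base lm p M) => i; rewrite (le_trans _ (lM i)) // ler_wpM2r ?exprn_ge0 ?(ltW r0) //.
  by rewrite ler_peMr ?cabs_ge0 // exprn_ege1 // ler1n.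
- by move=> i j x Ox; apply: cdrvM; [exact: cdrv_cst|case: (cpartial_zcX (p i) j OO Or Ox)].
- move=> j; pose e : C := (a == j)%:R +i* (b == j)%:R.
  (* In the constant, 2 bounds the direction factor [e], and 1/r compensates for the lowered
     exponent. *)
  apply: (eq_CUB OO) (IH (fun i => lm i * (e * (p i)%:R)) (fun i => (p i).-1) (2 * M / r) _) => [i x Ox|i].
    have [dw Ew] := cpartial_zcX (p i) j OO Or Ox.
    by rewrite (cpartialM (cdrv_cst j (lm i) x) dw) cpartial_cst mul0r add0r Ew -/e; ring.
  have e2 : cabs e <= 2.
    apply: le_trans (cabs_le e) _; rewrite /e /cRe /cIm /=.
    by case: eqP => _; case: eqP => _; rewrite ?normr1 ?normr0; lra.
  have M0 : 0 <= M by apply: le_trans (lM i); rewrite !mulr_ge0 ?cabs_ge0 ?exprn_ge0 // ltW.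
  have := lM i; rewrite !cabsM; case: (p i) => [|q] /=.
    by rewrite cabs_real normr0 !(mulr0, mul0r) divr_ge0 // ?mulr_ge0 // ltW.
  move=> lq; rewrite ler_pdivlMr //.
  rewrite (_ : cabs (q.+1%:R : C) = q.+1%:R); last first.
    by rewrite -[q.+1%:R]/(q.+1%:R) -(rmorph_nat (real_complex R)) cabs_real normr_nat.
  have -> : cabs (lm i) * (cabs e * q.+1%:R) * q.+1%:R ^+ m * r ^+ q * r =
      cabs e * (cabs (lm i) * q.+1%:R ^+ m.+1 * r ^+ q.+1) by rewrite !exprS; ring.
  apply: ler_pM => //; first exact: cabs_ge0.
    by rewrite !mulr_ge0 ?cabs_ge0 ?exprn_ge0 // ltW.
  apply: le_trans lq; rewrite ler_wpM2r ?exprn_ge0 ?(ltW r0) // ler_wpM2l ?cabs_ge0 //.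
  by rewrite lerXn2r ?nnegrE ?ler0n // ler_nat.
Qed.
End JointFamilies.

(** * Power series with Fourier series as coefficients *)

Section FourierPowerSeries.
Context {R : realType} {n : nat}.
Local Notation V := 'rV[R]_n.
Local Notation C := R[i].
Local Notation Zn := 'rV[int]_n.

Lemma summable_geometric (q : R) : 0 <= q < 1 -> summable_by (fun N => q ^+ N) (1 - q)^-1.
Proof.
move=> /andP[q0 q1]; split => [N|N]; first by rewrite exprn_ge0.
rewrite -[leRHS]mul1r ler_pdivlMr ?subr_gt0 // mulrC big_mkord -opprB mulNr -subrX1 opprB.
by rewrite gerBl exprn_ge0.
Qed.

(** The lattice is enumerated by its codes. A number that codes no point is sent to the origin here,
    but [latfun] gives it the value 0, so it contributes nothing to sums. *)
Definition latpt (k : nat) : Zn := odflt 0 (pickle_inv k).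
Definition latfun (T : nmodType) (f : Zn -> T) (k : nat) : T := oapp f 0 (pickle_inv k).

Lemma summable_lattice (f : Zn -> R) M : (forall z, 0 <= f z) ->
  (forall A, uniq A -> \sum_(z <- A) f z <= M) -> summable_by (latfun f) M.
Proof.
move=> f0 fM; split => [k|N]; first by rewrite /latfun; case: pickle_inv => //= z.
apply: le_trans (fM (pmap (@pickle_inv Zn) (iota 0 N)) _); last first.
  by apply: (pmap_uniq (@pickle_invK Zn)); exact: iota_uniq.
rewrite /index_iota subn0 big_pmap /latfun.
by apply: ler_sum => k _; case: pickle_inv => [z|] //=.
Qed.

Lemma latfun_pickle (T : nmodType) (f : Zn -> T) z : latfun f (pickle z) = f z.
Proof. by rewrite /latfun pickleK_inv. Qed.

Variables (om : R) (m : nat) (S : R) (c : nat -> Zn -> C).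
Hypothesis om0 : 0 <= om.
Hypothesis cB : forall r, 0 < r < S -> exists B, forall N A, uniq A ->
  \sum_(z <- A) (absn z).+1%:R ^+ m * cabs (c N z) * r ^+ N <= B.

(** Coefficients are taken against exp(-i xi.x), hence synthesis uses the opposite frequency. *)
Definition fterm (N : nat) (x : V) (k : nat) : C :=
  latfun (c N) k * wave (- freq om (latpt k)) x.
Definition fourier_coef_sum N x : C := cser (fterm N x).
Definition fps (z : C) (x : V) : C := cser (fun N => z ^+ N * fourier_coef_sum N x).

Lemma dot_rsub d (w : V) (v : 'rV[R]_(d + n)) : dot (row_mx 0 w) v = dot w (rsubmx v).
Proof.
rewrite /dot big_split_ord /= big1 ?add0r => [|i _]; last by rewrite row_mxEl mxE mul0r.
by apply: eq_bigr => i _; rewrite row_mxEr mxE.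
Qed.

Lemma wave_rsub d (w : V) (v : 'rV[R]_(d + n)) : wave (row_mx 0 w) v = wave w (rsubmx v).
Proof. by rewrite /wave dot_rsub. Qed.

Lemma absn_coord (z : Zn) i : (`|z ord0 i| <= absn z)%N.
Proof. by rewrite /absn (leq_bigmax_cond i). Qed.

Let wt (z : Zn) : R := (absn z).+1%:R.
Let wt1 z : 1 <= wt z. Proof. by rewrite ler1n. Qed.

Lemma latfun_wt (f : Zn -> R) k : latfun (fun z => wt z ^+ m * f z) k = wt (latpt k) ^+ m * latfun f k.
Proof. by rewrite /latfun /latpt; case: pickle_inv => //=; rewrite mulr0. Qed.

Lemma summable_coef r : 0 < r < S -> exists M, forall N,
  summable_by (fun k => wt (latpt k) ^+ m * (cabs (latfun (c N) k) * r ^+ N)) M.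
Proof.
move=> rS; have /andP[r0 _] := rS; have [M HM] := cB rS; exists M => N.
have := @summable_lattice (fun z => wt z ^+ m * (cabs (c N z) * r ^+ N)) M.
have -> : latfun (fun z => wt z ^+ m * (cabs (c N z) * r ^+ N)) =
    (fun k => wt (latpt k) ^+ m * (cabs (latfun (c N) k) * r ^+ N)).
  apply/funext => k; rewrite latfun_wt; congr (_ * _); rewrite /latfun.
  by case: pickle_inv => //=; rewrite cabs0 mul0r.
apply => [z|A uA]; first by rewrite !mulr_ge0 ?cabs_ge0 ?exprn_ge0 // ltW.
by apply: le_trans (HM N A uA); apply: ler_sum => z _; rewrite mulrA.
Qed.

Lemma summableZ (B : nat -> R) M a : 0 <= a -> summable_by B M ->
  summable_by (fun k => a * B k) (a * M).
Proof.
move=> a0 [B0 BM]; split => [k|N]; first by rewrite mulr_ge0.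
by rewrite -mulr_sumr ler_wpM2l.
Qed.

Hypothesis S0 : 0 < S.

Lemma fterm_dominated N : exists B M, summable_by B M /\ forall x, cdominated (fterm N x) B.
Proof.
have hS : 0 < S / 2 < S.
  by apply/andP; split; [rewrite divr_gt0|rewrite ltr_pdivrMr // ltr_pMr // ltr1n].
have [M sM] := summable_coef hS; have /andP[h0 _] := hS.
eexists; eexists; split; first by apply: (summableZ (a := (S / 2) ^- N) _ (sM N)); rewrite invr_ge0 exprn_ge0 // ltW.
move=> x k; rewrite cabsM [cabs (wave _ _)]cabsE /csq wave_norm sqrtr1 mulr1 mulrCA.
rewrite [_ * (_ * (S / 2) ^+ N)]mulrCA mulVf ?mulr1; last by rewrite expf_neq0 // gt_eqF.
by rewrite ler_peMl ?cabs_ge0 // exprn_ege1.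
Qed.

Lemma cabs0_eq0 (z : C) : cabs z = 0 -> z = 0.
Proof.
move=> z0; apply: eq_cReIm; apply/eqP; rewrite -normr_le0 -z0.
  exact: cRe_le_cabs.
exact: cIm_le_cabs.
Qed.

(** Each term is factored as a summable weight wt^m |c| r^N times a phase times an exponential
    divided by wt^m. The second factor is bounded in C^m by [CUB_waves], the first is summable
    uniformly in [N], and [CUB_series] combines them. Functions are lifted to R^(2+n), to be
    multiplied later by powers of zeta. *)
Lemma CUB_coef r : 0 < r < S ->
  CUB setT m (fun N (v : 'rV[R]_(2 + n)) => (r ^+ N)%:C * fourier_coef_sum N (rsubmx v)).
Proof.
move=> rS; have /andP[r0 _] := rS; have [M sM] := summable_coef rS.
(* The phase of the coefficient; it is 0 when the coefficient is 0, in accordance with 0^-1 = 0. *)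
pose u N k : C := latfun (c N) k * ((cabs (latfun (c N) k))^-1)%:C.
pose g N k (v : 'rV[R]_(2 + n)) : C :=
  (u N k * ((wt (latpt k) ^+ m)^-1)%:C) * wave (row_mx 0 (- freq om (latpt k))) v.
have w0 k : 0 < wt (latpt k) ^+ m by rewrite exprn_gt0 // (lt_le_trans ltr01).
have u1 N k : cabs (u N k) <= 1.
  rewrite cabsM cabs_real ger0_norm ?invr_ge0 ?cabs_ge0 //.
  by have [->|n0] := eqVneq (cabs (latfun (c N) k)) 0; rewrite ?mul0r // divff.
have Ug : CUB setT m (fun (p : nat * nat) => g p.1 p.2).
  apply: (@CUB_waves _ _ _ m (fun p : nat * nat => u p.1 p.2 * ((wt (latpt p.2) ^+ m)^-1)%:C)
     (fun p => row_mx 0 (- freq om (latpt p.2))) (fun p => (1 + om) * wt (latpt p.2)) ((1 + om) ^+ m)).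
  - by move=> p; rewrite -[leLHS]mulr1 ler_pM // lerDl.
  - move=> p j; case: (splitP j) => i ji.
      rewrite (_ : j = lshift n i); last exact: val_inj.
      by rewrite row_mxEl mxE normr0 mulr_ge0 ?addr_ge0.
    rewrite (_ : j = rshift 2 i); last exact: val_inj.
    rewrite row_mxEr !mxE normrN normrM ger0_norm // ler_pM // ?lerDr //.
    by rewrite -intr_norm -abszE ler_nat (leq_trans (absn_coord _ _)).
  - move=> p; rewrite cabsM cabs_real ger0_norm ?invr_ge0 ?(ltW (w0 _)) // exprMn.
    rewrite mulrCA -[leRHS]mulr1 ler_wpM2l ?exprn_ge0 ?addr_ge0 //.
    by rewrite -mulrA mulVf ?mulr1 // gt_eqF.
apply: (eq_CUB (@openT _)) (CUB_series (@openT _) Ug sM) => N v _.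
have E k : (wt (latpt k) ^+ m * (cabs (latfun (c N) k) * r ^+ N))%:C * g N k v =
   (r ^+ N)%:C * fterm N (rsubmx v) k.
  have ccE (z : C) : (cabs z)%:C * (z * ((cabs z)^-1)%:C) = z.
    have [z0|z0] := eqVneq (cabs z) 0; last by rewrite mulrCA -rmorphM divff // mulr1.
    by rewrite z0 mul0r; apply/esym; exact: cabs0_eq0.
  have key (z w : C) (W a rn : R) : W != 0 -> a%:C * (z * (a^-1)%:C) = z ->
      (W * (a * rn))%:C * (z * (a^-1)%:C * (W^-1)%:C * w) = rn%:C * (z * w).
    move=> W0 H; have Wi : W%:C * (W^-1)%:C = 1 by rewrite -rmorphM divff.
    rewrite -[in RHS]H -[RHS]mulr1 -Wi !rmorphM; ring.
  by rewrite /fterm /g /u wave_rsub; apply: key => //; exact: lt0r_neq0.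
transitivity (cser (fun k => (r ^+ N)%:C * fterm N (rsubmx v) k)); first exact: eq_cser E.
have [B [K [sB dB]]] := fterm_dominated N.
exact: cserZ sB (dB _).
Qed.
End FourierPowerSeries.

Lemma between (R : realType) (r S : R) : r < S -> exists2 t : R, r < t & t < S.
Proof. by move=> rS; exists ((r + S) / 2); lra. Qed.

(** * Joint C^m regularity of the double series *)

Section JointRegularity.
Context {R : realType} {n : nat}.
Local Notation C := R[i].
Local Notation W := 'rV[R]_(2 + n).

Lemma joint_zc (G : C -> 'rV[R]_n -> C) (v : W) :
  joint G v = G (zc (lshift n ord0) (lshift n ord_max) v) (rsubmx v).
Proof. by rewrite /joint /zc !mxE. Qed.

Lemma open_zc (a b : 'I_(2 + n)) (r : R) : open [set v : W | cabs (zc a b v) < r].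
Proof.
apply: (@open_comp _ _ (fun v : W => cabs (zc a b v)) [set x | x < r]); last exact: open_lt.
move=> v _; apply: (@continuous_comp _ _ _ (fun v : W => v ord0 a ^+ 2 + v ord0 b ^+ 2) Num.sqrt).
  by apply: contD; apply: contM; exact: coord_continuous.
exact: sqrt_continuous.
Qed.

(** [CmR] is a condition at each point on derivatives taken in the whole space, so openness of the
    sets [O] does not enter. *)
Lemma CmR_local d m (D : set 'rV[R]_d) h :
  (forall x, D x -> exists2 O : set 'rV[R]_d, O x & CmR m O h) -> CmR m D h.
Proof.
move=> H l lm; split=> [x Dx|lm' i x Dx]; have [U Ux hU] := H x Dx; have [c d0] := hU l lm.
  exact: c.
exact: d0.
Qed.

Variables (om : R) (m : nat) (S : R) (c : nat -> 'rV[int]_n -> C).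
Hypothesis om0 : 0 <= om.
Hypothesis cB : forall r, 0 < r < S -> exists B, forall N A, uniq A ->
  \sum_(z <- A) (absn z).+1%:R ^+ m * cabs (c N z) * r ^+ N <= B.

(** Two intermediate radii r < r2 < r1 < S: the coefficient functions times r1^N are bounded in C^m,
    the powers (zeta/r2)^N absorb the factor N^m lost by differentiation, and (r2/r1)^N is left as
    the summable weight. *)
Lemma CUB_fps r : 0 < r < S ->
  CUB [set v : W | cabs (zc (lshift n ord0) (lshift n ord_max) v) < r] m
    (fun _ : unit => joint (fps om c)).
Proof.
move=> /andP[r0 rS]; set O := [set v | _]; have OO : open O by exact: open_zc.
have S0 : 0 < S by exact: lt_trans rS.
have [r2 [r1 [rr2 r21 r1S]]] : exists r2 r1, [/\ r < r2, r2 < r1 & r1 < S].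
  by have [r1 rr1 r1S] := between rS; have [r2 rr2 r21] := between rr1; exists r2, r1.
have r20 : 0 < r2 by exact: lt_trans rr2.
have r10 : 0 < r1 by exact: lt_trans r21.
have q01 : 0 <= r2 / r1 < 1 by rewrite divr_ge0 ?ltW //= ltr_pdivrMr // mul1r.
have p01 : 0 <= r / r2 < 1 by rewrite divr_ge0 ?ltW //= ltr_pdivrMr // mul1r.
have r1b : 0 < r1 < S by rewrite r10.
have Uh := CUB_coef om0 cB S0 r1b.
have [K HK] := poly_geometric m p01.
have Up : CUB O m (fun N v => ((r2 ^+ N)^-1)%:C * zc (lshift n ord0) (lshift n ord_max) v ^+ N).
  apply: (@CUB_powers _ _ _ O m _ _ r (fun N => ((r2 ^+ N)^-1)%:C) id K) => // N.
  apply: le_trans (HK N); rewrite cabs_real ger0_norm ?invr_ge0 ?exprn_ge0 ?(ltW r20) //.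
  by rewrite expr_div_n [_^-1 * _]mulrC -mulrA [_^-1 * _]mulrC.
have U := CUBM OO Up (CUB_subset (@subsetT _ O) Uh).
pose g (_ : unit) (N : nat) (v : W) : C := ((r2 ^+ N)^-1)%:C *
  zc (lshift n ord0) (lshift n ord_max) v ^+ N * ((r1 ^+ N)%:C * fourier_coef_sum om c N (rsubmx v)).
have Ug : CUB O m (fun p : unit * nat => g p.1 p.2) by exact: (CUB_reindex (fun p : unit * nat => p.2) U).
apply: (eq_CUB OO) (CUB_series OO Ug (fun _ => summable_geometric q01)) => i v _.
rewrite joint_zc /fps; apply: eq_cser => N; rewrite /g.
have E : ((r2 / r1) ^+ N)%:C * ((r2 ^+ N)^-1)%:C * (r1 ^+ N)%:C = 1.
  rewrite -!rmorphM expr_div_n (_ : _ * _ = 1) ?rmorph1 //.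
  by field; rewrite !expf_neq0 ?gt_eqF.
have key (p q t z h : C) : p * q * t = 1 -> p * (q * z * (t * h)) = z * h.
  by move=> H; rewrite -[RHS]mul1r -H; ring.
exact: key E.
Qed.

Lemma Cm_fps : Cm m (joint_dom S setT) (joint (fps om c)).
Proof.
have H v : joint_dom S setT v -> exists2 O : set W, O v &
    CmR m O (fun x => cRe (joint (fps om c) x)) /\ CmR m O (fun x => cIm (joint (fps om c) x)).
  move=> [vS _].
  have vz : cabs (zc (lshift n ord0) (lshift n ord_max) v) < S by move: vS; rewrite /zc !mxE.
  have v0 := cabs_ge0 (zc (lshift n ord0) (lshift n ord_max) v).
  have [r r1 r2] := between vz.
  have [U1 U2] := CUB_fps (r := r) (introT andP (conj (le_lt_trans v0 r1) r2)).
  by exists [set v | cabs (zc (lshift n ord0) (lshift n ord_max) v) < r] => //; split;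
    [exact: (UB_CmR tt U1)|exact: (UB_CmR tt U2)].
by split; apply: CmR_local => v /H [U Uv [? ?]]; exists U.
Qed.
End JointRegularity.

(** * Fourier expansion on a cube *)

Section Orthogonality.
Context {R : realType}.
Local Notation mu := (@lebesgue_measure R).
Local Notation C := R[i].
Variables (rho om : R).
Hypotheses (rho0 : 0 < rho) (omE : om * rho = pi).

Lemma sin_int_pi (j : int) : sin (j%:~R * pi) = 0 :> R.
Proof.
have N (k : nat) : sin (k%:R * pi) = 0 :> R.
  elim: k => [|k IH]; first by rewrite mul0r sin0.
  by rewrite -natr1 mulrDl mul1r sinD IH sinpi mul0r mulr0 addr0.
case: j => k; first exact: N.
by rewrite NegzE mulrNz mulNr sinN N oppr0.
Qed.

Lemma integral_derive_itv (f F : R -> R) (a b : R) : a < b ->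
  (forall t : R, is_derive t 1 F (f t)) -> continuous f ->
  (\int[mu]_(t in `[a, b]) (f t)%:E = (F b - F a)%:E)%E.
Proof.
move=> ab dF cf; rewrite (@continuous_FTC2 _ f F a b) ?EFinB //.
- exact: continuous_subspaceT.
- have cF t : {for t, continuous F}.
    by apply: differentiable_continuous; apply/derivable1_diffP; exact: ex_derive.
  split => [t _|  |].
  + exact: ex_derive.
  + exact/cvg_at_right_filter/cF.
  + exact/cvg_at_left_filter/cF.
- by move=> t _; rewrite derive1E; apply: derive_val.
Qed.

Lemma trig_period (c : R) (j : int) : j != 0 ->
  (\int[mu]_(t in `[(c - rho)%R, (c + rho)%R]) (cos (om * j%:~R * t))%:E = 0)%E /\
  (\int[mu]_(t in `[(c - rho)%R, (c + rho)%R]) (sin (om * j%:~R * t))%:E = 0)%E.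
Proof.
move=> j0; have om0 : om != 0.
  by apply/eqP => o0; have := @pi_gt0 R; rewrite -omE o0 mul0r ltxx.
set K := om * j%:~R; have K0 : K != 0 by rewrite mulf_neq0 // intr_eq0.
have ab : c - rho < c + rho by rewrite ltrBlDr -addrA ltrDl addr_gt0.
have Ep : K * (c + rho) = K * c + j%:~R * pi by rewrite -omE /K; ring.
have Em : K * (c - rho) = K * c - j%:~R * pi by rewrite -omE /K; ring.
have dF (f f' : R -> R) : (forall t : R, is_derive t (1 : R) f (f' t)) ->
    forall t : R, is_derive t (1 : R) (fun s => K^-1 * f (K * s)) (f' (K * t)).
  move=> df t; have L (h : R) : K * (h *: (1 : R) + t) = h * K + K * t.
    by rewrite [h *: _]mulr1; ring.
  have [d1 d2] := is_derive_affine_comp L (df (K * t)).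
  have Z := is_deriveZ K^-1 (DeriveDef d1 d2).
  by apply: is_derive_eq Z _; rewrite [_ *: _]mulrA mulVf // mul1r.
have cK : continuous (fun t : R => K * t) by exact: mulrl_continuous.
have dc (t : R) : is_derive t (1 : R) (fun t => - cos t) (sin t).
  by have := is_deriveN (is_derive_cos t); rewrite opprK.
have D1 := dF sin cos (@is_derive_sin R); have D2 := dF (fun t => - cos t) sin dc.
split.
  rewrite (integral_derive_itv ab D1).
    by rewrite Ep Em !sinD sinN cosN sin_int_pi; congr EFin; ring.
  by move=> t; apply: continuous_comp; [exact: cK|exact: continuous_cos].
rewrite (integral_derive_itv ab D2).
  by rewrite Ep Em !cosD sinN cosN sin_int_pi; congr EFin; ring.
by move=> t; apply: continuous_comp; [exact: cK|exact: continuous_sin].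
Qed.

Lemma ball_rcons n (c : 'rV[R]_n.+1) t (y : 'rV[R]_n) :
  ball c rho (rcons_row (t, y)) <->
  ball (c ord0 ord0) rho t /\ ball (\row_i c ord0 (lift ord0 i)) rho y.
Proof.
rewrite !ball_rVE //; split => [H|[H1 H2] i].
  split; first by have := H ord0; rewrite rcons_row0.
  by move=> i; rewrite mxE; have := H (lift ord0 i); rewrite rcons_rowS.
have [k ->|->] := unliftP ord0 i; last by rewrite rcons_row0; exact: H1.
by rewrite rcons_rowS; have := H2 k; rewrite mxE.
Qed.

Lemma CIntg_ball n (c : 'rV[R]_n) (z : C) : CIntg (rst (ball c rho) (fun=> z)).
Proof.
have mB : measurable (ball c rho : set (BV n)) by apply: open_measurable_BV; exact: ball_open.
have m1 : measurable_fun setT (\1_(ball c rho) : BV n -> R) by exact: measurable_indic.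
split.
  apply: (@Intg_bounded _ _ _ c rho `|cRe z|) => //.
  - have -> : (fun x => cRe (rst (ball c rho) (fun=> z) x)) = (fun x => \1_(ball c rho) x * cRe z).
      by apply/funext => x; rewrite /rst cReM cRe_real cIm_real mul0r subr0.
    exact: measurable_funM.
  - by move=> x Bx; rewrite rst_out.
  - by move=> x; have [Bx|Bx] := pselect (ball c rho x); [rewrite rst_in|rewrite rst_out // normr0].
apply: (@Intg_bounded _ _ _ c rho `|cIm z|) => //.
- have -> : (fun x => cIm (rst (ball c rho) (fun=> z) x)) = (fun x => \1_(ball c rho) x * cIm z).
    by apply/funext => x; rewrite /rst cImM cRe_real cIm_real mul0r addr0.
  exact: measurable_funM.
- by move=> x Bx; rewrite rst_out.
- by move=> x; have [Bx|Bx] := pselect (ball c rho x); [rewrite rst_in|rewrite rst_out // normr0].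
Qed.

Lemma integral_indic_ball (c0 : R) (f : R -> R) : continuous f ->
  (\int[mu]_t (\1_(ball c0 rho) t * f t)%:E = \int[mu]_(t in `[(c0 - rho)%R, (c0 + rho)%R]) (f t)%:E)%E.
Proof.
move=> cf; have mf : measurable_fun setT (EFin \o f).
  by apply/measurable_EFinP; exact: continuous_measurable_fun.
rewrite (_ : (fun t => _) = (EFin \o f) \_ (ball c0 rho)); last first.
  apply/funext => t; rewrite patchE indicE; case: (t \in _); last by rewrite mul0r.
  by rewrite mul1r.
rewrite -integral_mkcond ball_itv.
rewrite integral_itv_obnd_cbnd; last exact: measurable_funTS.
by rewrite integral_itv_bndo_bndc //; exact: measurable_funTS.
Qed.

(** Induction on the dimension: slicing factors the integral into a one-dimensional trigonometric
    integral over a full period and the same integral in the remaining variables. *)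
Lemma wave_orthogonal n (c : 'rV[R]_n) (z : 'rV[int]_n) :
  Cint (fun x => rst (ball c rho) (fun=> 1) x * wave (freq om z) x) =
  if z == 0 then ((2 * rho) ^+ n)%:C else 0.
Proof.
elim: n c z => [|n IH] c z.
  rewrite (thinmx0 z) eqxx expr0 Cint_dim0 rst_in ?mul1r; last first.
    by rewrite (thinmx0 c); exact: ballxx.
  by rewrite /wave /dot big_ord0 cos0 sin0 oppr0.
set c' := \row_i c ord0 (lift ord0 i).
pose j := z ord0 ord0; pose z' := \row_i z ord0 (lift ord0 i).
have zE : z = zcons j z'.
  apply/rowP => i; rewrite mxE; case: unliftP => [k ->|->] //=; first by rewrite mxE.
have [_ _ _ E1 E2] := CIntg_slice (CIntg_wave (freq om z) (CIntg_ball c 1)).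
have sl t : Cint (fun y => rst (ball c rho) (fun=> 1) (rcons_row (t, y)) * wave (freq om z) (rcons_row (t, y))) =
    (\1_(ball (c ord0 ord0) rho) t : R)%:C * (cos (om * j%:~R * t) +i* - sin (om * j%:~R * t)) *
    (if z' == 0 then ((2 * rho) ^+ n)%:C else 0).
  rewrite -(IH c' z') -CintZ; last exact/CIntg_wave/CIntg_ball.
  apply: eq_Cint => y; rewrite {1}zE wave_zcons indicE.
  have [[B1 B2]|B] := pselect (ball (c ord0 ord0) rho t /\ ball c' rho y).
    by rewrite !rst_in ?(mem_set B1) ?mul1r //; exact/ball_rcons.
  rewrite rst_out; last by move/ball_rcons.
  have [B1|B1] := pselect (ball (c ord0 ord0) rho t); last by rewrite memNset // !mul0r.
  by rewrite [rst (ball c' rho) _ _]rst_out ?mul0r ?mulr0 // => B2; apply: B.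
set K : C := if z' == 0 then _ else _ in sl.
have KI : cIm K = 0 by rewrite /K; case: ifP.
have cC : continuous (fun t : R => cos (om * j%:~R * t)).
  by move=> t; apply: continuous_comp; [exact: mulrl_continuous|exact: continuous_cos].
have cS : continuous (fun t : R => sin (om * j%:~R * t)).
  by move=> t; apply: continuous_comp; [exact: mulrl_continuous|exact: continuous_sin].
have iZ (f : R -> R) k : continuous f -> (\int[mu]_t (\1_(ball (c ord0 ord0) rho) t * f t * k)%:E =
    k%:E * \int[mu]_(t in `[(c ord0 ord0 - rho)%R, (c ord0 ord0 + rho)%R]) (f t)%:E)%E.
  move=> cf; rewrite -(integral_indic_ball _ cf) -integralZl //.
    by apply: eq_integral => t _; rewrite -EFinM mulrC.
  rewrite (_ : (fun t => _) = (EFin \o f) \_ (ball (c ord0 ord0) rho)); last first.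
    apply/funext => t; rewrite patchE indicE; case: (t \in _); last by rewrite mul0r.
    by rewrite mul1r.
  rewrite -integrable_mkcond //; last by rewrite ball_itv; exact: measurable_itv.
  have Ic : mu.-integrable `[(c ord0 ord0 - rho)%R, (c ord0 ord0 + rho)%R] (EFin \o f).
    apply: continuous_compact_integrable; first exact: segment_compact.
    exact: continuous_subspaceT.
  by rewrite ball_itv; apply: integrableS Ic => //; exact: subset_itv_oo_cc.
have {}E1 : (cRe (Cint (fun x => rst (ball c rho) (fun=> 1) x * wave (freq om z) x)))%:E =
    ((cRe K)%:E * \int[mu]_(t in `[(c ord0 ord0 - rho)%R, (c ord0 ord0 + rho)%R]) (cos (om * j%:~R * t))%:E)%E.
  rewrite -E1 -(iZ _ _ cC); apply: eq_integral => t _; rewrite sl.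
  by congr EFin; rewrite !(cReM, cImM) KI cRe_real cIm_real /cRe /cIm /=; ring.
have {}E2 : (cIm (Cint (fun x => rst (ball c rho) (fun=> 1) x * wave (freq om z) x)))%:E =
    ((- cRe K)%:E * \int[mu]_(t in `[(c ord0 ord0 - rho)%R, (c ord0 ord0 + rho)%R]) (sin (om * j%:~R * t))%:E)%E.
  rewrite -E2 -(iZ _ _ cS); apply: eq_integral => t _; rewrite sl.
  by congr EFin; rewrite !(cReM, cImM) KI cRe_real cIm_real /cRe /cIm /=; ring.
have z0E : (z == 0) = (j == 0) && (z' == 0).
  apply/eqP/andP => [z0|[/eqP j0 /eqP z0]].
    by rewrite /j /z' z0 mxE eqxx; split => //; apply/eqP/rowP => i; rewrite !mxE.
  by rewrite zE j0 z0; apply/rowP => i; rewrite !mxE; case: unlift => // k; rewrite mxE.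
have [j0|j0] := eqVneq j 0; last first.
  have [c1 c2] := trig_period (c ord0 ord0) j0.
  rewrite z0E (negbTE j0) /=; rewrite c1 mule0 in E1; rewrite c2 mule0 in E2.
  by case: E1 => E1; case: E2 => E2; exact: eq_cReIm.
have I1 : (\int[mu]_(t in `[(c ord0 ord0 - rho)%R, (c ord0 ord0 + rho)%R]) (cos (om * j%:~R * t))%:E = (2 * rho)%:E)%E.
  under eq_integral do rewrite j0 mulr0 mul0r cos0.
  rewrite integral_cst //= lebesgue_measure_itv /= lte_fin.
  rewrite ltrBlDr -addrA ltrDl addr_gt0 // mul1e -EFinB; congr EFin; ring.
have I2 : (\int[mu]_(t in `[(c ord0 ord0 - rho)%R, (c ord0 ord0 + rho)%R]) (sin (om * j%:~R * t))%:E = 0)%E.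
  by apply: integral0_eq => t _; rewrite j0 mulr0 mul0r sin0.
rewrite I1 -EFinM in E1; rewrite I2 mule0 in E2.
have {}E1 := EFin_inj E1; have {}E2 := EFin_inj E2.
rewrite z0E j0 eqxx andTb; apply: eq_cReIm; [rewrite E1|rewrite E2]; rewrite /K.
  by case: (z' == 0); rewrite ?cRe_real ?cRe0 ?mul0r // exprS mulrC.
by case: (z' == 0).
Qed.
End Orthogonality.

(** * Integrating series term by term *)

Section SeriesIntegral.
Context {R : realType} {n : nat}.
Local Notation V := 'rV[R]_n.
Local Notation C := R[i].
Variables (c : V) (rho : R).
Hypothesis rho0 : 0 < rho.

(** Partial sums are dominated by [M] on the ball and vanish outside it; finite volume of the ball
    makes this majorant integrable. *)
Lemma rnint_rser (u : nat -> V -> R) B M :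
  (forall k, measurable_fun setT (u k : BV n -> R)) ->
  (forall k x, ~ ball c rho x -> u k x = 0) ->
  (forall x, dominated (u^~ x) B) -> summable_by B M ->
  Intg (fun x => rser (u^~ x)) /\
  rnint (fun x => rser (u^~ x)) = rser (fun k => rnint (u k)).
Proof.
move=> mu u0 uB sB; have [B0 BM] := sB.
have cv x : cvgn (series (u^~ x)) by have [] := dominated_series_cvg sB (uB x).
have mS N : measurable_fun setT ((fun x => series (u^~ x) N) : BV n -> R).
  by rewrite /series /=; apply: measurable_sum.
have I k : Intg (u k) by apply: (Intg_bounded rho0 (mu k) (u0 k) (M := B k)) => x; exact: uB.
have ms : measurable_fun setT ((fun x => rser (u^~ x)) : BV n -> R).
  apply: (@measurable_fun_cvg _ (BV n) R setT (fun N (x : BV n) => series (u^~ (x : V)) N) (fun x : BV n => rser (u^~ (x : V)))) => // x _.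
have bs x N : `|series (u^~ x) N| <= M.
  rewrite (le_trans (ler_norm_sum _ _ _)) // (le_trans _ (BM N)) //.
  by apply: ler_sum => k _; exact: uB.
have s0 x : ~ ball c rho x -> rser (u^~ x) = 0.
  move=> Bx; rewrite (@rser_single _ _ 0%N) ?u0 // => k _; exact: u0.
have rM x : `|rser (u^~ x)| <= M by have [] := dominated_series_cvg sB (uB x).
have Is : Intg (fun x => rser (u^~ x)) by exact: (Intg_bounded rho0 ms s0 rM).
split => //; apply/esym/cvg_lim => //.
have mB : measurable (ball c rho : set (BV n)) by apply: open_measurable_BV; exact: ball_open.
have Ib : (lam n).-integrable setT (fun x : BV n => (M * \1_(ball c rho) x)%:E).
  have : Intg (fun x : V => M * \1_(ball c rho) x).
    apply: (@Intg_bounded _ _ _ c rho `|M|) => //.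
    - by apply: measurable_funM => //; exact: measurable_indic.
    - by move=> x Bx; rewrite indicE memNset // mulr0.
    - move=> x; rewrite normrM indicE ler_piMr //.
      by case: (_ \in _); rewrite ?normr1 ?normr0.
  by [].
have E N : Intg (fun x => series (u^~ x) N) /\
    rnint (fun x => series (u^~ x) N) = series (fun k => rnint (u k)) N.
  have S0 (v : nat -> R) : series v 0%N = 0 by rewrite /series /= big_geq.
  have SS (v : nat -> R) k : series v k.+1 = series v k + v k by rewrite /series /= big_nat_recr.
  elim: N => [|N [IH1 IH2]].
    have -> : (fun x => series (u^~ x) 0%N) = fun=> 0 by apply/funext => x; rewrite S0.
    by rewrite S0; split; [exact: Intg_cst0|exact: rnint0].
  have -> : (fun x => series (u^~ x) N.+1) = fun x => series (u^~ x) N + u N x.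
    by apply/funext => x; rewrite SS.
  by rewrite SS; split; [exact: IntgD|rewrite rnintD // IH2].
have c1 N : measurable_fun setT ((fun x => (series (u^~ x) N)%:E) : BV n -> \bar R).
  exact/measurable_EFinP.
have c2 : measurable_fun setT ((fun x => (rser (u^~ x))%:E) : BV n -> \bar R).
  exact/measurable_EFinP.
have c3 : {ae lam n, forall x, setT x -> (series (u^~ x) N)%:E @[N --> \oo] --> (rser (u^~ x))%:E}.
  by apply: aeW => x _; apply: cvg_EFin; [exact: nearW|exact: cv].
have c4 : {ae lam n, forall x N, setT x -> (`|(series (u^~ x) N)%:E| <= (M * \1_(ball c rho) x)%:E)%E}.
  apply: aeW => x N _; rewrite abse_EFin lee_fin indicE.
  have [Bx|Bx] := pselect (ball c rho x); first by rewrite mem_set // mulr1.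
  rewrite memNset // mulr0 /series /= big1 ?normr0 // => k _; exact: u0.
have [_ _ D] := @dominated_convergence _ _ _ (lam n) setT measurableT
  (fun N x => (series (u^~ x) N)%:E) (fun x => (rser (u^~ x))%:E) _ c1 c2 c3 Ib c4.
have fE : (\int[lam n]_x (rser (u^~ x))%:E)%E = (rnint (fun x => rser (u^~ x)))%:E.
  by rewrite /rnint /Rintegral fineK //; exact: integrable_fin_num.
rewrite fE in D; have D' := fine_cvg D.
have -> : series (fun k => rnint (u k)) = fun N => rnint (fun x => series (u^~ x) N).
  by apply/funext => N; have [_ ->] := E N.
exact: D'.
Qed.

Lemma Cint_cser (u : nat -> V -> C) B M :
  (forall k, measurable_fun setT ((fun x => cRe (u k x)) : BV n -> R)) ->
  (forall k, measurable_fun setT ((fun x => cIm (u k x)) : BV n -> R)) ->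
  (forall k x, ~ ball c rho x -> u k x = 0) ->
  (forall x, cdominated (u^~ x) B) -> summable_by B M ->
  CIntg (fun x => cser (u^~ x)) /\
  Cint (fun x => cser (u^~ x)) = cser (fun k => Cint (u k)).
Proof.
move=> m1 m2 u0 uB sB.
have [I1 E1] := @rnint_rser (fun k x => cRe (u k x)) B M m1
  (fun k x h => congr1 (@cRe R) (u0 k x h)) (fun x => (cdominated_part (uB x)).1) sB.
have [I2 E2] := @rnint_rser (fun k x => cIm (u k x)) B M m2
  (fun k x h => congr1 (@cIm R) (u0 k x h)) (fun x => (cdominated_part (uB x)).2) sB.
by split; [split|apply: eq_cReIm].
Qed.
End SeriesIntegral.

(** * Convergence of an absolutely summable Fourier series to its function *)

Section FourierExpansion.
Context {R : realType} {n : nat}.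
Local Notation V := 'rV[R]_n.
Local Notation C := R[i].
Local Notation Zn := 'rV[int]_n.
Variables (c0 : V) (rho om : R).
Hypotheses (rho0 : 0 < rho) (omE : om * rho = pi).
Local Notation Q := (ball c0 rho).

(** An index with point [z] that is not the code of [z] codes nothing, so the value is the default
    0; this prevents the origin from being counted more than once. *)
Lemma latptE (T : nmodType) (f : Zn -> T) k (z : Zn) : latpt k = z -> k != pickle z -> latfun f k = 0.
Proof.
rewrite /latpt /latfun; have := @pickle_invK Zn k; case: (pickle_inv k) => //= y yk <-.
by rewrite yk eqxx.
Qed.

(** The sum of the series, cut off to the cube, has the coefficients of [w] by termwise integration
    and orthogonality; completeness then annihilates the difference. *)
Lemma fourier_expansion (w : V -> C) (c : nat -> Zn -> C) N M : CIntg w ->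
  (forall x, ~ Q x -> w x = 0) ->
  (forall z, c N z = ((2 * rho) ^- n)%:C * Cint (fun x => w x * wave (freq om z) x)) ->
  (forall A, uniq A -> \sum_(z <- A) cabs (c N z) <= M) ->
  {ae lam n, forall x, Q x -> fourier_coef_sum om c N x = w x}.
Proof.
move=> Iw w0 cE cM.
have sB : summable_by (fun k => cabs (latfun (c N) k)) M.
  have -> : (fun k => cabs (latfun (c N) k)) = latfun (fun z => cabs (c N z)).
    by apply/funext => k; rewrite /latfun; case: pickle_inv => //=; rewrite cabs0.
  by apply: summable_lattice => // z; exact: cabs_ge0.
have wc v x : cabs (wave v x) = 1 by rewrite cabsE /csq wave_norm sqrtr1.
have rc x : cabs (rst Q (fun=> 1) x : C) <= 1.
  have [Qx|Qx] := pselect (Q x); first by rewrite rst_in // cabs_real normr1.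
  by rewrite rst_out // cabs0.
(* The shift [v] serves twice: v = 0 gives integrability of the sum, v = freq z gives its
   coefficients. *)
pose u v k x : C := latfun (c N) k * (rst Q (fun=> 1) x * wave (v - freq om (latpt k)) x).
have uI v : CIntg (fun x => cser (u v ^~ x)) /\ Cint (fun x => cser (u v ^~ x)) = cser (fun k => Cint (u v k)).
  have Iu k : CIntg (u v k) by apply/CIntgZ/CIntg_wave/CIntg_ball.
  apply: (@Cint_cser _ _ c0 _ rho0 (u v) _ M _ _ _ _ sB).
  - by move=> k; apply: Intg_meas; case: (Iu k).
  - by move=> k; apply: Intg_meas; case: (Iu k).
  - by move=> k x Qx; rewrite /u rst_out // mul0r mulr0.
  - move=> x k; rewrite /u cabsM [cabs (rst _ _ _ * _)]cabsM wc mulr1.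
    exact: (ler_piMr (cabs_ge0 _) (rc x)).
have uE v x : rst Q (fourier_coef_sum om c N) x * wave v x = cser (u v ^~ x).
  rewrite /rst -mulrA [fourier_coef_sum _ _ _ _ * _]mulrC mulrA.
  rewrite -(cserZ _ sB); last by move=> k; rewrite /fterm cabsM wc mulr1.
  apply: eq_cser => k; rewrite /u /fterm waveD /rst; ring.
have w00 : wave (0 : V) = fun=> 1 :> C by apply/funext => x; rewrite wave0.
have Ih : CIntg (rst Q (fourier_coef_sum om c N)).
  have [+ _] := uI 0; congr CIntg; apply/funext => x.
  by rewrite -uE w00 mulr1.
have d0 := @wave_complete R rho om rho0 omE n (fun x => rst Q (fourier_coef_sum om c N) x + -1 * w x) c0.
have {}d0 : {ae lam n, forall x, rst Q (fourier_coef_sum om c N) x + -1 * w x = 0}.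
  apply: d0.
  - by apply: CIntgD => //; exact: CIntgZ.
  - by move=> x Qx; rewrite rst_out // w0 // mulr0 addr0.
  - move=> z.
    transitivity (Cint (fun x => cser (u (freq om z) ^~ x)) + -1 * Cint (fun x => w x * wave (freq om z) x)).
      rewrite -CintZ; last exact: CIntg_wave.
      rewrite -CintD; [|by case: (uI (freq om z))|by apply: CIntgZ; exact: CIntg_wave].
      by apply: eq_Cint => x; rewrite -uE; ring.
    have [_ ->] := uI (freq om z).
    rewrite (cser_single (K := pickle z)).
      rewrite /u CintZ; last exact/CIntg_wave/CIntg_ball.
      have -> : latpt (pickle z) = z by rewrite /latpt pickleK_inv.
      rewrite latfun_pickle -freqB (wave_orthogonal rho0 omE) subrr eqxx cE.
      rewrite mulrAC -rmorphM mulVf ?expf_neq0 ?mulf_neq0 ?gt_eqF //.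
      by rewrite rmorph1 mul1r mulN1r subrr.
    move=> k kz; rewrite /u CintZ; last exact/CIntg_wave/CIntg_ball.
    rewrite -freqB (wave_orthogonal rho0 omE) subr_eq0.
    case: eqP => [zk|_]; last by rewrite mulr0.
    by rewrite (latptE _ (esym zk)) // mul0r.
apply: ae_imp d0 => x + Qx; rewrite rst_in // mulN1r => /eqP.
by rewrite subr_eq0 => /eqP.
Qed.
End FourierExpansion.

(** * Local L^2 limits *)

Section L2Limits.
Context {R : realType} {n : nat}.
Local Notation V := 'rV[R]_n.
Local Notation C := R[i].

(** Multiplying one factor by 1, -1, i and -i turns the bound on the real part into bounds on both
    parts, each by half of the total. *)
Lemma L2_pair_abs (u v : V -> C) : L2fun u -> L2fun v ->
  cabs (Cint (fun x => u x * v x)) <= nrm2 u + nrm2 v.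
Proof.
move=> Lu Lv.
have P (k : C) : csq k = 1 -> cRe (k * Cint (fun x => u x * v x)) <= (nrm2 u + nrm2 v) / 2.
  move=> k1; have [v1 v2 v3] := Lv; have [Iuv _] := L2_pair Lu Lv.
  have cE x : csq (k * v x) = csq (v x) by rewrite csqM k1 mul1r.
  have Lk : L2fun (fun x => k * v x).
    split; last by apply: eq_Intg v3 => x; rewrite cE.
    - have -> : (fun x => cRe (k * v x)) = (fun x => cRe k * cRe (v x) - cIm k * cIm (v x)).
        by apply/funext => x; rewrite cReM.
      by apply: measurable_funB; apply: measurable_funM.
    - have -> : (fun x => cIm (k * v x)) = (fun x => cRe k * cIm (v x) + cIm k * cRe (v x)).
        by apply/funext => x; rewrite cImM.
      by apply: measurable_funD; apply: measurable_funM.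
  have [_] := L2_pair Lu Lk.
  rewrite [nrm2 (fun x => k * v x)](_ : _ = nrm2 v); last by apply: eq_rnint => x; rewrite cE.
  by rewrite -(CintZ _ Iuv); congr (cRe _ <= _); apply: eq_Cint => x; ring.
apply: le_trans (cabs_le _) _.
set I := Cint _ in P *; set B := _ / 2 in P.
have PQ (x y : R) : x ^+ 2 + y ^+ 2 = 1 -> x * cRe I - y * cIm I <= B.
  by move=> h; have := P (x +i* y) h; rewrite cReM.
have h1 : cRe I <= B by have := PQ 1 0; rewrite expr1n expr0n mul1r mul0r subr0 addr0; exact.
have h2 : - cRe I <= B by have := PQ (-1) 0; rewrite sqrrN expr1n expr0n mulN1r mul0r subr0 addr0; exact.
have h3 : - cIm I <= B by have := PQ 0 1; rewrite expr1n expr0n mul1r mul0r sub0r add0r; exact.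
have h4 : cIm I <= B by have := PQ 0 (-1); rewrite sqrrN expr1n expr0n mulN1r mul0r sub0r opprK add0r; exact.
rewrite (splitr (nrm2 u + nrm2 v)) -/B; apply: lerD; rewrite ler_norml.
  by rewrite h1 lerNl h2.
by rewrite h4 lerNl h3.
Qed.

Definition mrst (B : set V) (f : V -> C) :=
  measurable_fun setT ((fun x => \1_B x * cRe (f x)) : BV n -> R) /\
  measurable_fun setT ((fun x => \1_B x * cIm (f x)) : BV n -> R).

Lemma borel_on_mrst (Om B : set V) f : relcpt Om B -> borel_on Om f -> mrst B f.
Proof.
move=> [oB [_ cB]] [f1 f2]; have BOm : B `<=` Om by move=> x Bx; apply/cB/subset_closure.
by split; exact: measurable_rst_part oB BOm _.
Qed.

Lemma mrstZ B k f : mrst B f -> mrst B (fun x => k * f x).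
Proof.
move=> [f1 f2]; split.
  have -> : (fun x => \1_B x * cRe (k * f x)) = fun x => cRe k * (\1_B x * cRe (f x)) - cIm k * (\1_B x * cIm (f x)).
    by apply/funext => x; rewrite cReM; ring.
  by apply: measurable_funB; apply: measurable_funM.
have -> : (fun x => \1_B x * cIm (k * f x)) = fun x => cRe k * (\1_B x * cIm (f x)) + cIm k * (\1_B x * cRe (f x)).
  by apply/funext => x; rewrite cImM; ring.
by apply: measurable_funD; apply: measurable_funM.
Qed.

Lemma mrst_psum B z (f : nat -> V -> C) N : (forall j, mrst B (f j)) -> mrst B (psum z f N).
Proof.
move=> mf; elim: N => [|N [IH1 IH2]].
  split.
    have -> : (fun x => \1_B x * cRe (psum z f 0 x)) = fun=> 0; last exact: measurable_cst.
    by apply/funext => x; rewrite /psum big_ord0 mulr0.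
  have -> : (fun x => \1_B x * cIm (psum z f 0 x)) = fun=> 0; last exact: measurable_cst.
  by apply/funext => x; rewrite /psum big_ord0 mulr0.
have [m1 m2] := mrstZ (z ^+ N / N`!%:R) (mf N).
split.
  have -> : (fun x => \1_B x * cRe (psum z f N.+1 x)) =
      fun x => \1_B x * cRe (psum z f N x) + \1_B x * cRe (z ^+ N / N`!%:R * f N x).
    by apply/funext => x; rewrite /psum big_ord_recr /= cReD mulrDr.
  exact: measurable_funD.
have -> : (fun x => \1_B x * cIm (psum z f N.+1 x)) =
    fun x => \1_B x * cIm (psum z f N x) + \1_B x * cIm (z ^+ N / N`!%:R * f N x).
  by apply/funext => x; rewrite /psum big_ord_recr /= cImD mulrDr.
exact: measurable_funD.
Qed.

Lemma mrst_csqB (B : set V) (s h : V -> C) : mrst B s -> mrst B h ->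
  measurable_fun setT ((fun x => \1_B x * csq (s x - h x)) : BV n -> R).
Proof.
move=> [s1 s2] [h1 h2].
have -> : (fun x => \1_B x * csq (s x - h x)) = (fun x => (\1_B x * cRe (s x) - \1_B x * cRe (h x)) ^+ 2 +
    (\1_B x * cIm (s x) - \1_B x * cIm (h x)) ^+ 2).
  apply/funext => x; rewrite /csq cReB cImB indicE.
  by case: (x \in B); rewrite ?mul1r // !mul0r subr0 expr0n addr0.
by apply: measurable_funD; apply: measurable_funX; apply: measurable_funB.
Qed.

Lemma sqnorm_integral (B : set V) (s h : V -> C) : mrst B s -> mrst B h ->
  sqnorm B (fun x => s x - h x) = (\int[lam n]_x (\1_B x * csq (s x - h x))%:E)%E.
Proof.
move=> ms mh; rewrite /sqnorm iint_ge0_integral //.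
  by apply/measurable_EFinP; exact: mrst_csqB.
by move=> x; rewrite lee_fin mulr_ge0 // addr_ge0 // sqr_ge0.
Qed.

(** Fatou's lemma applied to |s_N - h|^2: the integral of the pointwise limit is at most the limit 0
    of the L^2 distances. No almost everywhere convergent subsequence has to be extracted. *)
Lemma ae_eq_of_L2_limit (B : set V) (s : nat -> V -> C) (h G : V -> C) :
  (forall N, mrst B (s N)) -> mrst B h ->
  (fun N => sqnorm B (fun x => s N x - h x)) @ \oo --> (0 : \bar R) ->
  {ae lam n, forall x, B x -> (csq (s N x - h x) @[N --> \oo] --> csq (G x - h x))} ->
  {ae lam n, forall x, B x -> h x = G x}.
Proof.
move=> ms mh L A.
pose g N (x : V) := \1_B x * csq (s N x - h x).
have g0 N x : (0 <= (g N x)%:E)%E by rewrite lee_fin mulr_ge0 // csq_ge0.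
have mge N : measurable_fun setT ((fun x => (g N x)%:E) : BV n -> \bar R).
  by apply/measurable_EFinP; exact: mrst_csqB.
have E N : (\int[lam n]_x (g N x)%:E)%E = sqnorm B (fun x => s N x - h x).
  by rewrite sqnorm_integral.
have F := @fatou _ _ _ (lam n) setT measurableT (fun N x => (g N x)%:E) mge (fun N x _ => g0 N x).
pose l (x : BV n) := limn_einf (fun N => (g N x)%:E).
have l0 x : (0 <= l x)%E.
  rewrite /l limn_einf_lim; apply: lime_ge; first exact: is_cvg_einfs.
  by apply: nearW => N; apply: le_ereal_inf_tmp => _ [k _ <-]; exact: g0.
have ml : measurable_fun setT l.
  apply: measurableT_comp => //; apply: (measurable_fun_limn_esup (f := fun N (x : BV n) => (- (g N x)%:E)%E)) => N.
  exact: measurableT_comp.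
have F0 : (\int[lam n]_x l x = 0)%E.
  apply/eqP; rewrite eq_le integral_ge0 // andbT; apply: le_trans F _.
  have -> : (fun N => (\int[lam n]_x (g N x)%:E)%E) = fun N => sqnorm B (fun x => s N x - h x) by apply/funext.
  by have [-> _] := cvg_limn_einf_sup L.
have : ae_eq (lam n) setT l (cst 0%E).
  apply/(ae_eq_integral_abs _ measurableT) => //.
  by rewrite -[RHS]F0; apply: eq_integral => x _; rewrite gee0_abs.
apply: ae_imp2 A => x cx /(_ Logic.I) lx Bx.
have cg : (fun N => (g N x)%:E) @ \oo --> (csq (G x - h x))%:E.
  apply: cvg_EFin; first exact: nearW.
  have -> : fine \o (fun N => (g N x)%:E) = fun N => csq (s N x - h x).
    by apply/funext => N; rewrite /= /g indicE mem_set // mul1r.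
  exact: cx Bx.
move: lx; rewrite /l; have [-> _] := cvg_limn_einf_sup cg => -[] e0.
have : cabs (G x - h x) = 0 by rewrite cabsE e0 sqrtr0.
by move/cabs0_eq0/eqP; rewrite subr_eq0 => /eqP.
Qed.
Lemma sqnorm_le_add (B : set V) (s t h : V -> C) : mrst B s -> mrst B t -> mrst B h ->
  (sqnorm B (fun x => (s x - t x)%R) <=
   2%:E * sqnorm B (fun x => (s x - h x)%R) + 2%:E * sqnorm B (fun x => (t x - h x)%R))%E.
Proof.
move=> ms mt mh; rewrite !sqnorm_integral //.
have ge (u v : V -> C) x : (0 <= (\1_B x * csq (u x - v x))%:E)%E.
  by rewrite lee_fin mulr_ge0 // csq_ge0.
have me (u v : V -> C) : mrst B u -> mrst B v ->
    measurable_fun setT ((fun x => (\1_B x * csq (u x - v x))%:E) : BV n -> \bar R).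
  by move=> mu mv; apply/measurable_EFinP; exact: mrst_csqB.
rewrite -!ge0_integralZl //; [|exact: me..].
rewrite -ge0_integralD //; last 4 first.
- by move=> x _; rewrite mule_ge0.
- by apply: measurable_funeM; exact: me.
- by move=> x _; rewrite mule_ge0.
- by apply: measurable_funeM; exact: me.
apply: ge0_le_integral => //.
- exact: me.
- by apply: emeasurable_funD; apply: measurable_funeM; exact: me.
move=> x _; rewrite -!EFinM -EFinD lee_fin.
rewrite mulrCA [2 * (_ * csq (t x - _))]mulrCA -mulrDr ler_wpM2l //.
rewrite /csq !cReB !cImB.
set a1 := cRe (s x); set a2 := cRe (t x); set a3 := cRe (h x).
set b1 := cIm (s x); set b2 := cIm (t x); set b3 := cIm (h x).
have := sqr_ge0 ((a1 - a3) + (a2 - a3)); have := sqr_ge0 ((b1 - b3) + (b2 - b3)).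
rewrite !expr2; nra.
Qed.

End L2Limits.

(** * Bounds on single terms and on the zero frequency *)

Section TermBounds.
Context {R : realType} {n : nat}.
Local Notation V := 'rV[R]_n.
Local Notation C := R[i].

Lemma L2funZ (k : C) (v : V -> C) : L2fun v ->
  L2fun (fun x => k * v x) /\ nrm2 (fun x => k * v x) = csq k * nrm2 v.
Proof.
move=> [v1 v2 v3].
have cE x : csq k * csq (v x) = csq (k * v x) by rewrite csqM.
split; last by rewrite /nrm2 -(rnintZ _ v3); apply: eq_rnint => x; rewrite cE.
split; last exact: eq_Intg cE (IntgZ (csq k) v3).
- have -> : (fun x => cRe (k * v x)) = (fun x => cRe k * cRe (v x) - cIm k * cIm (v x)).
    by apply/funext => x; rewrite cReM.
  by apply: measurable_funB; apply: measurable_funM.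
- have -> : (fun x => cIm (k * v x)) = (fun x => cRe k * cIm (v x) + cIm k * cRe (v x)).
    by apply/funext => x; rewrite cImM.
  by apply: measurable_funD; apply: measurable_funM.
Qed.

(** A term is the difference of consecutive partial sums. Once both lie within squared distance 1 of
    the limit, its squared norm is at most 2 + 2 = 4; the finitely many earlier norms are added to
    the bound. *)
Lemma L2_terms_bounded (Om Q : set V) (f : nat -> V -> C) (h : V -> C) (z : C) : relcpt Om Q ->
  (forall j, L2loc Om (f j)) -> L2loc Om h -> L2loc_cvg Om (psum z f) h ->
  exists M, forall N, nrm2 (fun x => z ^+ N / N`!%:R * rst Q (f N) x) <= M.
Proof.
move=> rQ Lf [bh _] /(_ Q rQ) L.
have mf j : mrst Q (f j) by apply: (borel_on_mrst rQ); case: (Lf j).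
have mh : mrst Q h by exact: borel_on_mrst rQ bh.
pose u N x := z ^+ N / N`!%:R * rst Q (f N) x.
have Lu N : L2fun (u N).
  have [bf ff] := Lf N; have [Lr _] := L2fun_rst rQ bf (ff Q rQ).
  by have [] := L2funZ (z ^+ N / N`!%:R) Lr.
have E N : (nrm2 (u N))%:E = sqnorm Q (fun x => psum z f N.+1 x - psum z f N x).
  rewrite sqnorm_integral; [|exact: mrst_psum..].
  have [_ _ Iu] := Lu N; rewrite /nrm2 /rnint /Rintegral fineK; last exact: integrable_fin_num.
  apply: eq_integral => x _; congr EFin.
  by rewrite /psum big_ord_recr /= addrAC subrr add0r /u csqM csq_rst [csq (_ * f N x)]csqM mulrCA.
pose a N := sqnorm Q (fun x => psum z f N x - h x).
have nb : nbhs (0 : \bar R) [set y | (y < 1%:E)%E].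
  by apply: open_nbhs_nbhs; split; [exact: open_ereal_lt_ereal|rewrite /= lte_fin].
have [N0 _ HN0] := L _ nb.
have b N : (N0 <= N)%N -> nrm2 (u N) <= 4.
  move=> NN; rewrite -lee_fin E; apply: le_trans (sqnorm_le_add (mrst_psum _ _ mf) (mrst_psum _ _ mf) mh) _.
  have a1 := HN0 N NN; have a2 := HN0 N.+1 (leqW NN).
  rewrite (_ : 4%:E = 2%:E * 1%:E + 2%:E * 1%:E :> \bar R)%E; last by rewrite -!EFinM -EFinD; congr EFin; ring.
  by apply: leeD; apply: lee_wpmul2l => //; exact: ltW.
exists (4 + \sum_(i < N0) nrm2 (u i)) => N.
have n0 i : 0 <= nrm2 (u i) by apply: rnint_ge0 => x; exact: csq_ge0.
have [NN|NN] := leqP N0 N.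
  by rewrite (le_trans (b N NN)) // lerDl sumr_ge0.
rewrite (bigD1 (Ordinal NN)) //= addrCA lerDl addr_ge0 // sumr_ge0 //.
Qed.
End TermBounds.

Section Coefficients.
Context {R : realType} {n : nat}.
Local Notation V := 'rV[R]_n.
Local Notation C := R[i].
Local Notation Zn := 'rV[int]_n.

(** The origin lies outside the range of the elliptic estimate and is bounded separately; uniqueness
    lets it occur at most once. *)
Lemma sum_nonzero (g : Zn -> R) (B B0 : R) : (forall z, 0 <= g z) -> g 0 <= B0 ->
  (forall A : seq (@Zs n), uniq A -> \sum_(z <- A) g (val z) <= B) ->
  forall A : seq Zn, uniq A -> \sum_(z <- A) g z <= B0 + B.
Proof.
move=> g0 g00 gB A uA.
rewrite (bigID (fun z => z == 0)) /=; apply: lerD.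
  rewrite -big_filter; have uF : uniq [seq z <- A | z == 0] by rewrite filter_uniq.
  have : {subset [seq z <- A | z == 0] <= [:: 0]} by move=> z; rewrite mem_filter => /andP[/eqP-> _]; rewrite mem_head.
  move/(uniq_leq_size uF) => /=; case E: [seq z <- A | z == 0] => [|y [|//]] _.
    by rewrite big_nil (le_trans (g0 0)).
  have : y \in [seq z <- A | z == 0] by rewrite E mem_head.
  by rewrite mem_filter big_seq1 => /andP[/eqP-> _].
pose A' : seq (@Zs n) := pmap insub A.
have uA' : uniq A' by exact: pmap_sub_uniq.
apply: le_trans (gB A' uA'); rewrite le_eqVlt; apply/orP; left; apply/eqP.
rewrite /A' big_pmap [LHS]big_mkcond /=; apply: eq_bigr => z _.
by case: insubP => [y -> <-|/negbTE ->].
Qed.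
End Coefficients.

(** A radius strictly between |z| and [S] bounds the coefficients times r^N and leaves the geometric
    factor (|z|/r)^N. *)
Lemma fps_dominated (R : realType) (n m : nat) (om S : R) (c : nat -> 'rV[int]_n -> R[i]) (z : R[i])
    (x : 'rV[R]_n) : 0 <= om ->
  (forall r, 0 < r < S -> exists B, forall N A, uniq A ->
    \sum_(z <- A) (absn z).+1%:R ^+ m * cabs (c N z) * r ^+ N <= B) ->
  cabs z < S -> exists B M, summable_by B M /\
    cdominated (fun N => z ^+ N * fourier_coef_sum om c N x) B.
Proof.
move=> om0 cB zS; have [r zr rS] := between zS.
have r0 : 0 < r by exact: le_lt_trans (cabs_ge0 z) zr.
have rb : 0 < r < S by rewrite r0.
have [U1 U2] := CUB_coef om0 cB (lt_trans r0 rS) rb.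
have [M1 H1] := UB_bounded U1; have [M2 H2] := UB_bounded U2.
have q01 : 0 <= cabs z / r < 1.
  by rewrite divr_ge0 ?cabs_ge0 ?(ltW r0) //= ltr_pdivrMr // mul1r.
have M0 : 0 <= M1 + M2.
  by apply: addr_ge0; [apply: le_trans (H1 0%N 0 Logic.I)|apply: le_trans (H2 0%N 0 Logic.I)].
exists (fun N => (M1 + M2) * (cabs z / r) ^+ N); eexists; split.
  exact: summableZ M0 (summable_geometric q01).
move=> N; have h : cabs ((r ^+ N)%:C * fourier_coef_sum om c N x) <= M1 + M2.
  have := H1 N (row_mx 0 x) Logic.I; have := H2 N (row_mx 0 x) Logic.I; rewrite row_mxKr => h2 h1.
  by apply: le_trans (cabs_le _) _; exact: lerD.
have rN : 0 < r ^+ N by rewrite exprn_gt0.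
rewrite cabsM cabs_real gtr0_norm // in h.
rewrite cabsM cabsX expr_div_n mulrCA ler_wpM2l ?exprn_ge0 ?cabs_ge0 //.
by rewrite ler_pdivlMr // mulrC.
Qed.

Lemma quarter (R : realType) (r : R) : 0 < r -> 2 * (r / 4) < r /\ r / 4 < r.
Proof. by move=> r0; split; lra. Qed.

(** * Local representatives *)

Section LocalExpansion.
Context {R : realType} {n : nat}.
Local Notation V := 'rV[R]_n.
Local Notation C := R[i].
Local Notation Zn := 'rV[int]_n.
Variables (Om : set V) (b : V -> R) (a : V -> 'M[C]_n) (ell : V -> R).
Variables (Lf : nat -> nat -> V -> C) (k m : nat) (S : R) (LF : nat -> C -> V -> C).
Hypotheses (oOm : open Om) (Cb : forall p, CmR p Om b) (b0 : forall x, Om x -> 0 < b x).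
Hypothesis Ca : forall mu nu p, Cm p Om (fun x => a x mu nu).
Hypotheses (cell : {within Om, continuous ell}) (ell0 : forall x, Om x -> 0 < ell x).
Hypothesis Hell : forall x, Om x -> forall xi : 'rV[C]_n,
  ell x * (\sum_(mu < n) (cRe (xi ord0 mu) ^+ 2 + cIm (xi ord0 mu) ^+ 2))
  <= cRe (\sum_(mu < n) \sum_(nu < n) a x mu nu * conjc (xi ord0 mu) * xi ord0 nu).
Hypothesis LfL2 : forall j l, (l <= k)%N -> L2loc Om (Lf l j).
Hypothesis LfW : forall j l, (l < k)%N -> weakL Om a b (Lf l j) (Lf l.+1 j).
Hypothesis LFL2 : forall z l, cabs z < S -> (l <= k)%N -> L2loc Om (LF l z).
Hypothesis LFcvg : forall z l, cabs z < S -> (l <= k)%N -> L2loc_cvg Om (psum z (Lf l)) (LF l z).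
Hypothesis km : (2 * m + n < 4 * k)%N.
Hypothesis S0 : 0 < S.
Variables (x0 : V) (rho : R).
Hypotheses (rho0 : 0 < rho) (rQ : relcpt Om (ball x0 rho)).
Local Notation Q := (ball x0 rho).
Let QOm : Q `<=` Om.
Proof. by move=> x Qx; case: rQ => _ [_ cQ]; apply/cQ/subset_closure. Qed.

(** Boundedness of 1/(b ell) on the compact closure of the cube makes the ellipticity uniform.
    Frequencies are real, so the conjugation in the hypothesis disappears. *)
Lemma elliptic_lower_bound : exists2 dl : R, 0 < dl & forall (th : V) x, Q x ->
  dl * \sum_i th ord0 i ^+ 2 <=
  cRe (\sum_(mu < n) \sum_(nu < n) (b x)%:C * (a x mu nu * (th ord0 mu)%:C * (th ord0 nu)%:C)).
Proof.
have [_ [cQ sQ]] := rQ.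
have cl x : Om x -> {for x, continuous ell}.
  by move=> Ox; move: cell; rewrite continuous_open_subspace // => H; apply: H; exact: mem_set.
have cb x : Om x -> {for x, continuous b} by move=> Ox; have [h _] := @Cb 0%N [::] isT; exact: h.
have p0 x : Om x -> 0 < b x * ell x by move=> Ox; rewrite mulr_gt0 ?b0 ?ell0.
have [M HM] := continuous_compact_bounded (h := fun x => (b x * ell x)^-1) cQ
  (fun x Qx => contV (lt0r_neq0 (p0 x (sQ x Qx))) (contM (cb x (sQ x Qx)) (cl x (sQ x Qx)))).
have M1 : 0 < `|M| + 1 by rewrite ltr_wpDl.
exists (`|M| + 1)^-1; first by rewrite invr_gt0.
move=> th x Qx; have Ox := QOm Qx.
have dl : (`|M| + 1)^-1 <= b x * ell x.
  rewrite -[leRHS]invrK lef_pV2 ?posrE ?invr_gt0 ?p0 //.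
  have := HM x (subset_closure Qx); rewrite ger0_norm ?invr_ge0 ?(ltW (p0 x Ox)) //.
  by move/le_trans; apply; rewrite (le_trans (ler_norm M)) // lerDl.
have s0 : 0 <= \sum_i th ord0 i ^+ 2 by apply: sumr_ge0 => i _; exact: sqr_ge0.
apply: le_trans (ler_wpM2r s0 dl) _; rewrite -mulrA.
have E : cRe (\sum_(mu < n) \sum_(nu < n) (b x)%:C * (a x mu nu * (th ord0 mu)%:C * (th ord0 nu)%:C)) =
   b x * cRe (\sum_(mu < n) \sum_(nu < n) a x mu nu * (th ord0 mu)%:C * (th ord0 nu)%:C).
  rewrite (eq_bigr _ (fun mu _ => esym (mulr_sumr _ _ _ _))) -mulr_sumr cReM cRe_real cIm_real.
  by rewrite mul0r subr0.
rewrite E ler_wpM2l ?(ltW (b0 Ox)) //.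
have := Hell Ox (\row_i (th ord0 i)%:C).
under eq_bigr do rewrite !mxE cRe_real cIm_real expr0n addr0.
congr (_ <= cRe _); apply: eq_bigr => mu _; apply: eq_bigr => nu _.
rewrite !mxE; congr (_ * _ * _).
by rewrite conjcE; apply: eq_cReIm; rewrite /cRe /cIm /= ?oppr0.
Qed.

(** The cutoff is 1 up to distance rho/4 from the centre and supported within rho/2, hence inside
    the cube of half-width rho. *)
Let K := ccube x0 (2 * (rho / 4)).
Let cK : closed K. Proof. exact: ccube_closed. Qed.
Let d0 : 0 < rho / 4. Proof. by rewrite divr_gt0. Qed.
Let KQ : K `<=` Q.
Proof.
by apply: ccube_sub_ball => //; have [] := quarter rho0.
Qed.
(** The spacing for which the exponentials have period 2 rho, the side of [Q]. *)
Let om := pi / rho.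
Let om0 : 0 < om. Proof. by rewrite divr_gt0 // pi_gt0. Qed.
Let omE : om * rho = pi. Proof. by rewrite divfK // gt_eqF. Qed.
Let chi (x : V) : C := (bump x0 (rho / 4) x)%:C.

Lemma dfam_chi I : dfam K (fun _ : I => chi).
Proof.
split => [p|_ x Kx]; last by rewrite /chi bump_eq0.
by apply: (CUB_real (@openT V)); exact: UB_bump.
Qed.

Let Ua : forall I p mu nu, CUB Q p (fun (_ : I) x => a x mu nu).
Proof.
by move=> I p mu nu; have [_ [cQ sQ]] := rQ; have [c1 c2] := Ca mu nu p; split; apply: CmR_UB sQ.
Qed.
Let Ub : forall I p, UB Q p (fun (_ : I) x => b x).
Proof. by move=> I p; have [_ [cQ sQ]] := rQ; apply: CmR_UB sQ. Qed.

Let Lr l j : (l <= k)%N -> L2fun (rst Q (Lf l j)).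
Proof. by move=> lk; have [bf ff] := LfL2 j lk; have [] := L2fun_rst rQ bf (ff Q rQ). Qed.

(** The Fourier coefficient on [Q] of chi f_N / N!: with the factorial and the volume included,
    [fps] is a plain power series in zeta. *)
Definition lcoef (N : nat) (z : Zn) : C := ((2 * rho) ^- n)%:C *
  Cint (fun x => (N`!%:R^-1 * rst Q (Lf 0 N) x * chi x) * wave (freq om z) x).

(** Convergence at the single real point zeta = r bounds the terms for each [l]; a maximum over the
    finitely many l <= k gives one constant. *)
Lemma scaled_terms (r : R) : 0 < r < S -> exists M, forall (N l : nat), (l <= k)%N ->
  L2fun (fun x => (r%:C) ^+ N / N`!%:R * rst Q (Lf l N) x) /\
  nrm2 (fun x => (r%:C) ^+ N / N`!%:R * rst Q (Lf l N) x) <= M.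
Proof.
move=> /andP[r0 rS].
have rc : cabs (r%:C : C) < S by rewrite cabs_real gtr0_norm.
have H l : (l <= k)%N -> exists M, forall N, nrm2 (fun x => (r%:C) ^+ N / N`!%:R * rst Q (Lf l N) x) <= M.
  by move=> lk; apply: (L2_terms_bounded rQ _ (LFL2 rc lk) (LFcvg rc lk)) => j; exact: LfL2.
have [M HM] : exists M, forall l N, (l <= k)%N -> nrm2 (fun x => (r%:C) ^+ N / N`!%:R * rst Q (Lf l N) x) <= M.
  have : forall q, (q <= k)%N -> exists M, forall l N, (l <= q)%N ->
      nrm2 (fun x => (r%:C) ^+ N / N`!%:R * rst Q (Lf l N) x) <= M.
    elim=> [|q IH] qk; first by have [M HM] := H 0%N qk; exists M => l N; rewrite leqn0 => /eqP->.
    have [M1 H1] := IH (ltnW qk); have [M2 H2] := H _ qk.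
    exists (Num.max M1 M2) => l N; rewrite leq_eqVlt => /orP[/eqP->|lq].
      by apply: le_trans (H2 N) _; rewrite le_max lexx orbT.
    by apply: le_trans (H1 l N lq) _; rewrite le_max lexx.
  by move=> /(_ k (leqnn k)).
by exists M => N l lk; split; [have [] := L2funZ ((r%:C) ^+ N / N`!%:R) (Lr N lk)|exact: HM].
Qed.

Lemma lterm_Intg N : CIntg (fun x => N`!%:R^-1 * rst Q (Lf 0 N) x * chi x).
Proof.
have [I _] := L2_pair (Lr N (leq0n k)) (dfam_L2fun rho0 KQ tt (dfam_chi unit)).
by have := CIntgZ N`!%:R^-1 I; congr CIntg; apply/funext => x; rewrite mulrA.
Qed.

Lemma lcoef_bound (r : R) : 0 < r < S -> exists B, forall N A, uniq A ->
  \sum_(z <- A) (absn z).+1%:R ^+ m * cabs (lcoef N z) * r ^+ N <= B.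
Proof.
move=> rS; have /andP[r0 _] := rS; have [M HM] := scaled_terms rS.
have [dl dl0 el] := elliptic_lower_bound.
pose v N l (x : V) : C := (r%:C) ^+ N / N`!%:R * rst Q (Lf l N) x.
have vchain N l (phi : V -> C) : (l < k)%N -> dfam K (fun _ : unit => phi) ->
    Cint (fun x => v N l.+1 x * phi x) = Cint (fun x => v N l x * CLadj a b phi x).
  move=> lk dphi; have W := weakL_rst rho0 cK KQ rQ Ua Ub (Lr N (ltnW lk)) (Lr N lk) (LfW N lk) dphi.
  have dA := dfam_CLadj cK KQ Ua Ub dphi.
  have [I1 _] := L2_pair (Lr N lk) (dfam_L2fun rho0 KQ tt dphi).
  have [I2 _] := L2_pair (Lr N (ltnW lk)) (dfam_L2fun rho0 KQ tt dA).
  transitivity ((r%:C) ^+ N / N`!%:R * Cint (fun x => rst Q (Lf l.+1 N) x * phi x)).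
    by rewrite -(CintZ _ I1); apply: eq_Cint => x; rewrite mulrA.
  by rewrite W -(CintZ _ I2); apply: eq_Cint => x; rewrite mulrA.
(* The data are indexed by [N] and already carry the factor r^N/N!, so the resulting constant is
   uniform in [N]. The initial amplitude is the cutoff, the same for all frequencies. *)
have [B HB] := @fourier_bound R n a b x0 rho K rho0 cK KQ Ua Ub om om0 dl dl0 el nat k m v M km
  (fun N l lk => HM N l lk) vchain (fun=> chi) (dfam_chi (@Zs n)).
have kp : 0 <= (2 * rho) ^- n by rewrite invr_ge0 exprn_ge0 // mulr_ge0 // ltW.
have E N z : cabs (lcoef N z) * r ^+ N =
    (2 * rho) ^- n * cabs (Cint (fun x => v N 0%N x * (wave (freq om z) x * chi x))).
  rewrite /lcoef cabsM cabs_real ger0_norm // -mulrA; congr (_ * _).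
  have -> : Cint (fun x => v N 0%N x * (wave (freq om z) x * chi x)) =
      (r%:C) ^+ N * Cint (fun x => N`!%:R^-1 * rst Q (Lf 0 N) x * chi x * wave (freq om z) x).
    rewrite -CintZ; last exact/CIntg_wave/lterm_Intg.
    by apply: eq_Cint => x; rewrite /v; ring.
  by rewrite cabsM cabsX cabs_real gtr0_norm // mulrC.
(* The first summand bounds the zero frequency; in the second, 2^m passes from the weight |z|^m to
   (|z|+1)^m for nonzero z. *)
exists ((2 * rho) ^- n * (M + nrm2 chi) + 2 ^+ m * (2 * rho) ^- n * B) => N A uA.
apply: (@sum_nonzero _ _ (fun z => (absn z).+1%:R ^+ m * cabs (lcoef N z) * r ^+ N)) => //.
- by move=> z; rewrite !mulr_ge0 ?exprn_ge0 ?cabs_ge0 // ltW.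
- rewrite absn0 expr1n mul1r E ler_wpM2l //.
  have [Lv nv] := HM N 0%N isT.
  have Lc := dfam_L2fun rho0 KQ tt (dfam_chi unit).
  apply: le_trans (le_trans (L2_pair_abs Lv Lc) (lerD nv (lexx _))).
  rewrite le_eqVlt; apply/orP; left; apply/eqP; congr cabs; apply: eq_Cint => x.
  have -> : freq om (0 : Zn) = 0 by rewrite /freq; apply/rowP => i; rewrite !mxE mulr0.
  by rewrite wave0 mul1r.
- move=> A' uA'; rewrite -mulrA; apply: le_trans (ler_wpM2l _ (ler_wpM2l kp (HB N A' uA'))); last first.
    by rewrite exprn_ge0.
  rewrite !mulr_sumr; apply: ler_sum => z _; rewrite -mulrA E.
  have key (p q s t : R) : p * (q * (s * t)) = p * s * (q * t) by ring.
  rewrite [leRHS]key -exprMn.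
  apply: ler_wpM2r; first by rewrite mulr_ge0 ?cabs_ge0.
  rewrite lerXn2r ?nnegrE ?mulr_ge0 //.
  have : (0 < absn (val z))%N by apply: absn_gt0; exact: (valP z).
  by rewrite -natrM ler_nat; lia.
Qed.

(** On the small ball the cutoff is 1, so the partial sums of the given series equal those of [fps]
    almost everywhere there. They converge pointwise to [fps] and in L^2 to F, and the two limits
    agree. *)
Lemma local_expansion : exists H : C -> V -> C,
  Cm m (joint_dom S setT) (joint H) /\
  forall z, cabs z < S -> {ae lam n, forall x, ball x0 (rho / 4) x -> LF 0 z x = H z x}.
Proof.
exists (fps om lcoef); split; first exact: Cm_fps (ltW om0) lcoef_bound.
have A : {ae lam n, forall x, forall N, Q x -> fourier_coef_sum om lcoef N x = N`!%:R^-1 * rst Q (Lf 0 N) x * chi x}.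
  apply: ae_foralln => N.
  have [r r0 rS] := between S0; have rb : 0 < r < S by rewrite r0.
  have [B HB] := lcoef_bound rb.
  apply: (fourier_expansion rho0 omE (M := B / r ^+ N) (lterm_Intg N)) => [x Qx|z|A uA] //.
    by rewrite rst_out // mulr0 mul0r.
  rewrite ler_pdivlMr ?exprn_gt0 // mulr_suml; apply: le_trans (HB N A uA).
  apply: ler_sum => z _; apply: ler_wpM2r; first by rewrite exprn_ge0 // ltW.
  by rewrite ler_peMl ?cabs_ge0 // exprn_ege1 // ler1n.
move=> z zS.
have rB : relcpt Om (ball x0 (rho / 4)).
  have [_ [cQ sQ]] := rQ; have BQ : ball x0 (rho / 4) `<=` Q.
    by apply: le_ball; have [_ /ltW] := quarter rho0.
  have cBQ := closureS BQ.
  split; first exact: ball_open.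
  split; last by move=> y /cBQ /sQ.
  by apply: (subclosed_compact _ cQ) => //; exact: closed_closure.
have [bF _] := LFL2 zS (leq0n k).
have mF := borel_on_mrst rB bF.
have mf j : mrst (ball x0 (rho / 4)) (Lf 0 j).
  by apply: (borel_on_mrst rB); case: (LfL2 j (leq0n k)).
apply: (ae_eq_of_L2_limit (fun N => mrst_psum z N mf) mF (LFcvg zS (leq0n k) rB)).
apply: ae_imp A => x Ax Bx.
have Qx : Q x by apply: le_ball Bx; have [_ /ltW] := quarter rho0.
have hE N : fourier_coef_sum om lcoef N x = N`!%:R^-1 * Lf 0 N x.
  by rewrite (Ax N Qx) rst_in // /chi bump_eq1 ?mulr1 //; exact: ball_sub_ccube.
have pE N : psum z (Lf 0) N x = \sum_(0 <= j < N) z ^+ j * fourier_coef_sum om lcoef j x.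
  by rewrite /psum big_mkord; apply: eq_bigr => j _; rewrite hE mulrA.
have [B [M [sB dB]]] := fps_dominated x (ltW om0) lcoef_bound zS.
have [u1 u2] := cdominated_part dB.
have [c1 _] := dominated_series_cvg sB u1; have [c2 _] := dominated_series_cvg sB u2.
have T1 : cRe (psum z (Lf 0) N x - LF 0 z x) @[N --> \oo] --> cRe (fps om lcoef z x - LF 0 z x).
  rewrite cReB; apply: cvg_trans (cvgB c1 (cvg_cst (cRe (LF 0 z x)))).
  by apply: near_eq_cvg; apply: nearW => N; rewrite cReB pE cRe_sum.
have T2 : cIm (psum z (Lf 0) N x - LF 0 z x) @[N --> \oo] --> cIm (fps om lcoef z x - LF 0 z x).
  rewrite cImB; apply: cvg_trans (cvgB c2 (cvg_cst (cIm (LF 0 z x)))).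
  by apply: near_eq_cvg; apply: nearW => N; rewrite cImB pE cIm_sum.
by rewrite /csq; apply: cvgD; apply: cvgM.
Qed.
End LocalExpansion.

(** * Gluing *)

Section Slicing.
Context {R : realType} {d n : nat}.
Local Notation V := 'rV[R]_n.

Lemma ball_row_mx (w : 'rV[R]_d) (x y : V) e : 0 < e -> ball x e y -> ball (row_mx w x) e (row_mx w y).
Proof.
move=> e0; rewrite !ball_rVE // => xy i; case: (splitP i) => j ij.
  rewrite (_ : i = lshift n j); last exact: val_inj.
  by rewrite !row_mxEl subrr normr0.
rewrite (_ : i = rshift d j); last exact: val_inj.
by rewrite !row_mxEr; exact: xy.
Qed.

Lemma continuous_row_mx (w : 'rV[R]_d) (x : V) : {for x, continuous (fun y : V => row_mx w y)}.
Proof. by apply: cvg_ball_at => e e0; exists e => // y; exact: ball_row_mx. Qed.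

Lemma dpartial_slice (w : 'rV[R]_d) (h : 'rV[R]_(d + n) -> R) l (x : V) :
  dpartial l (fun y => h (row_mx w y)) x = dpartial (map (@rshift d n) l) h (row_mx w x) /\
  forall i, drv (rshift d i) (dpartial (map (@rshift d n) l) h) (row_mx w x) ->
    drv i (dpartial l (fun y => h (row_mx w y))) x.
Proof.
have L i (x' : V) t : row_mx w (t *: ev i + x') = t *: ev (rshift d i) + row_mx w x'.
  apply/rowP => j; rewrite [RHS]mxE [X in _ = X + _]mxE [X in _ = _ * X + _]mxE.
  case: (splitP j) => q jq.
    rewrite (_ : j = lshift n q); last exact: val_inj.
    by rewrite !row_mxEl eq_lrshift andbF mulr0 add0r.
  rewrite (_ : j = rshift d q); last exact: val_inj.
  by rewrite !row_mxEr !mxE (inj_eq (@rshift_inj d n)).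
have D (f : V -> R) g i x' : (forall y, f y = g (row_mx w y)) ->
    (drv i f x' <-> drv (rshift d i) g (row_mx w x')) /\ partial i f x' = partial (rshift d i) g (row_mx w x').
  move=> fg; apply: derive_line => t; by rewrite fg L.
have E l' x' : dpartial l' (fun y => h (row_mx w y)) x' = dpartial (map (@rshift d n) l') h (row_mx w x').
  elim: l' x' => [|i l' IH] x' //=; by have [_] := D _ _ i x' IH.
by split => [|i di]; [exact: E|have [[_ Q] _] := D _ _ i x (E l); exact: Q].
Qed.

Lemma CmR_slice m (D : set 'rV[R]_(d + n)) h (w : 'rV[R]_d) : CmR m D h ->
  CmR m [set x | D (row_mx w x)] (fun x => h (row_mx w x)).
Proof.
move=> H l lm; have [c dd] := H (map (@rshift d n) l) (eq_ind_r (fun q => (q <= m)%N) lm (size_map _ _)).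
split => [x Dx|lm' i x Dx].
  have -> : dpartial l (fun x => h (row_mx w x)) = fun x => dpartial (map (@rshift d n) l) h (row_mx w x).
    by apply/funext => y; have [] := dpartial_slice w h l y.
  apply: (@continuous_comp _ _ _ (fun y : V => row_mx w y)); first exact: continuous_row_mx.
  exact: c.
by have [_] := dpartial_slice w h l x; apply; apply: dd => //; rewrite size_map.
Qed.

End Slicing.

(** * Agreement and gluing of local representatives *)

Section Patching.
Context {R : realType} {n : nat}.
Local Notation V := 'rV[R]_n.
Local Notation C := R[i].

Lemma CmR_eq p m (U : set 'rV[R]_p) (f g : 'rV[R]_p -> R) : open U ->
  (forall x, U x -> f x = g x) -> CmR m U f -> CmR m U g.
Proof.
move=> oU fg Hf.
have E l x : U x -> dpartial l f x = dpartial l g x.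
  elim: l x => [|i l IH] x Ux /=; first exact: fg.
  by apply: near_partial; exact: open_eq_near oU Ux IH.
move=> l lm; have [c dd] := Hf l lm; split => [x Ux|lm' i x Ux].
  by apply: near_continuous (c x Ux); exact: open_eq_near oU Ux (E l).
by apply: near_drv (dd lm' i x Ux); exact: open_eq_near oU Ux (E l).
Qed.

(** If the values differed at [x], they would differ on a ball around it, and balls have positive
    measure by [lam_ball]. *)
Lemma continuous_ae_eq (U : set V) (f g : V -> C) x : open U -> U x ->
  (forall y, U y -> {for y, continuous (fun t => cRe (f t))} /\ {for y, continuous (fun t => cIm (f t))}) ->
  (forall y, U y -> {for y, continuous (fun t => cRe (g t))} /\ {for y, continuous (fun t => cIm (g t))}) ->
  {ae lam n, forall y, U y -> f y = g y} -> f x = g x.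
Proof.
move=> oU Ux cf cg A; apply: contrapT => nfg.
pose h y := (cRe (f y) - cRe (g y)) ^+ 2 + (cIm (f y) - cIm (g y)) ^+ 2.
have hE y : f y = g y -> h y = 0 by move=> e; rewrite /h e !subrr expr0n addr0.
have hx : h x != 0.
  apply/eqP => /eqP; rewrite paddr_eq0 ?sqr_ge0 // !sqrf_eq0 !subr_eq0 => /andP[/eqP e1 /eqP e2].
  by apply: nfg; exact: eq_cReIm.
have [c1 c2] := cf x Ux; have [c3 c4] := cg x Ux.
have cN (q : V -> R) : {for x, continuous q} -> {for x, continuous (fun y => - q y)}.
  by move=> cq; exact: (cvgN cq).
have ch : {for x, continuous h}.
  have d1 := contD c1 (cN _ c3); have d2 := contD c2 (cN _ c4).
  exact: (contD (contM d1 d1) (contM d2 d2)).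
have [e /= e0 He] : exists2 e : R, 0 < e & forall y, ball x e y -> U y /\ h y != 0.
  have nU : \forall y \near x, U y by exact: open_nbhs_nbhs.
  have n0 : nbhs (h x) [set t : R | t != 0] by apply: open_nbhs_nbhs; split => //; exact: open_neq.
  have nh : \forall y \near x, h y != 0 := ch _ n0.
  have /nbhs_ballP[e e0 He] : \forall y \near x, U y /\ h y != 0 by apply: filterS2 nU nh.
  by exists e.
have mB : measurable (ball x e : set (BV n)) by apply: open_measurable_BV; exact: ball_open.
have : (lam n).-negligible (ball x e : set (BV n)).
  apply: negligibleS A => y /He[Uy hy] /= /(_ Uy) /hE h0.
  by rewrite h0 eqxx in hy.
move/(negligibleP (lam n) mB) => B0; have B1 := etrans (esym (lam_ball x e0)) B0.
have /eqP := congr1 fine B1; rewrite /=.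
by rewrite expf_eq0 mulf_eq0 (gt_eqF e0) orbF pnatr_eq0 andbF.
Qed.
Definition zrow (z : C) : 'rV[R]_2 := \row_i (if i == ord0 then cRe z else cIm z).

Lemma joint_row_mx (G : C -> V -> C) z x : joint G (row_mx (zrow z) x) = G z x.
Proof.
rewrite /joint row_mxKl row_mxKr; congr G.
by apply: eq_cReIm; rewrite /zrow !mxE /cRe /cIm /=.
Qed.

Lemma joint_dom_row_mx S (U : set V) z x : joint_dom S U (row_mx (zrow z) x) <-> cabs z < S /\ U x.
Proof.
rewrite /joint_dom /= row_mxKl row_mxKr (_ : _ +i* _ = z) //.
by apply: eq_cReIm; rewrite /zrow !mxE /cRe /cIm /=.
Qed.

Lemma Cm_slice m S (U : set V) (G : C -> V -> C) z : cabs z < S ->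
  Cm m (joint_dom S U) (joint G) -> Cm m U (G z).
Proof.
move=> zS [h1 h2].
have E : [set x | joint_dom S U (row_mx (zrow z) x)] = U.
  by apply/seteqP; split => x /=; rewrite joint_dom_row_mx => // -[].
split.
  have := CmR_slice (zrow z) h1; rewrite E; congr CmR.
  by apply/funext => x; rewrite joint_row_mx.
have := CmR_slice (zrow z) h2; rewrite E; congr CmR.
by apply/funext => x; rewrite joint_row_mx.
Qed.

Lemma Cm_continuous m (U : set V) (h : V -> C) x : Cm m U h -> U x ->
  {for x, continuous (fun t => cRe (h t))} /\ {for x, continuous (fun t => cIm (h t))}.
Proof. by move=> [h1 h2] Ux; have [c1 _] := h1 [::] isT; have [c2 _] := h2 [::] isT; split; [exact: c1|exact: c2]. Qed.

Lemma open_borel_on (U : set V) (h : V -> C) : open U ->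
  (forall x, U x -> {for x, continuous (fun t => cRe (h t))} /\ {for x, continuous (fun t => cIm (h t))}) ->
  borel_on U h.
Proof.
move=> oU ch.
have P (q : V -> R) (A : set R) : open A -> (forall x, U x -> {for x, continuous q}) -> borelRn (U `&` q @^-1` A).
  move=> oA cq; apply: sub_sigma_algebra => /=; rewrite openE => x [Ux Ax]; apply: filterI.
    exact: open_nbhs_nbhs.
  by apply: (cq x Ux); exact: open_nbhs_nbhs.
by split => A oA; apply: P => // x Ux; have [] := ch x Ux.
Qed.

Lemma mrst_open (U : set V) (h : V -> C) : open U -> borel_on U h -> mrst U h.
Proof. by move=> oU [h1 h2]; split; exact: measurable_rst_part oU (@subset_refl _ U) _. Qed.

Variables (Om : set V) (S : R) (m : nat) (F : C -> V -> C).
Hypothesis oOm : open Om.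
Hypothesis bF : forall z, cabs z < S -> borel_on Om (F z).
Hypothesis loc : forall x0, Om x0 -> exists (r : R) (H : C -> V -> C), [/\ 0 < r, ball x0 r `<=` Om,
  Cm m (joint_dom S setT) (joint H) &
  forall z, cabs z < S -> {ae lam n, forall x, ball x0 r x -> F z x = H z x}].

Lemma patching : exists G : C -> V -> C,
  (forall z, cabs z < S -> ae_eq_on Om (G z) (F z) /\ Cm m Om (G z)) /\
  Cm m (joint_dom S Om) (joint G).
Proof.
have ex x0 : exists p : R * (C -> V -> C), Om x0 -> [/\ 0 < p.1, ball x0 p.1 `<=` Om,
    Cm m (joint_dom S setT) (joint p.2) &
    forall z, cabs z < S -> {ae lam n, forall x, ball x0 p.1 x -> F z x = p.2 z x}].
  have [Ox|nO] := pselect (Om x0); last by exists (0, fun _ _ => 0).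
  by have [r [H HH]] := loc Ox; exists (r, H).
have [D HD] := choice ex.
pose G z x := (D x).2 z x.
have agree z x0 x : cabs z < S -> Om x0 -> ball x0 (D x0).1 x -> G z x = (D x0).2 z x.
  move=> zS O0 Bx; have [r0 s0 C0 A0] := HD x0 O0; have Ox := s0 x Bx.
  have [r1 s1 C1 A1] := HD x Ox.
  apply: (@continuous_ae_eq (ball x (D x).1 `&` ball x0 (D x0).1) ((D x).2 z) ((D x0).2 z) x).
  - by apply: openI; exact: ball_open.
  - by split => //; exact: ballxx.
  - by move=> y _; exact: (Cm_continuous (x := y) (Cm_slice zS C1) Logic.I).
  - by move=> y _; exact: (Cm_continuous (x := y) (Cm_slice zS C0) Logic.I).
  - by apply: ae_imp2 (A0 z zS) (A1 z zS) => y h0 h1 [B1 B0]; rewrite -h0 // -h1.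
have CG : Cm m (joint_dom S Om) (joint G).
  have P v : joint_dom S Om v -> exists2 U : set 'rV[R]_(2 + n), U v &
      CmR m U (fun x => cRe (joint G x)) /\ CmR m U (fun x => cIm (joint G x)).
    move=> [vS Ov]; have [r0 s0 [C1 C2] _] := HD _ Ov.
    pose U : set 'rV[R]_(2 + n) := [set v' | cabs (zc (lshift n ord0) (lshift n ord_max) v') < S] `&`
      (@rsubmx _ 1 2 n @^-1` ball (rsubmx v) (D (rsubmx v)).1).
    have oU : open U.
      apply: openI; first exact: open_zc.
      apply: open_comp; last exact: ball_open.
      move=> v' _; apply: cvg_ball_at => e e0; exists e => // w.
      by rewrite !ball_rVE // => H i; rewrite !mxE; exact: H.
    have JE v' : U v' -> joint (D (rsubmx v)).2 v' = joint G v'.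
      by move=> [zS Bv]; rewrite !joint_zc (agree _ (rsubmx v)).
    have UD : U `<=` joint_dom S setT.
      by move=> v' [zS _]; split => //; move: zS; rewrite /zc !mxE.
    exists U.
      by split; [move: vS; rewrite /= /zc !mxE|exact: ballxx].
    have sub (q : 'rV[R]_(2 + n) -> R) : CmR m (joint_dom S setT) q -> CmR m U q.
      by move=> H; apply: CmR_local => w /UD Dw; exists (joint_dom S setT).
    by split; [apply: (CmR_eq oU) (sub _ C1) => w Uw|apply: (CmR_eq oU) (sub _ C2) => w Uw]; rewrite JE.
  by split; apply: CmR_local => v /P [U Uv [? ?]]; exists U.
exists G; split => // z zS; have CGz := Cm_slice zS CG; split => //.
have bG : borel_on Om (G z) by apply: open_borel_on => // x Ox; exact: Cm_continuous CGz Ox.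
have mu1 := mrst_csqB (mrst_open oOm bG) (mrst_open oOm (bF zS)).
(* [ae_eq_on] speaks of the [iint] of an indicator, which is identified with a measure once the
   exceptional set is known to be Borel. *)
set N := [set y | Om y /\ G z y <> F z y].
have NE : N = (fun x => \1_Om x * csq (G z x - F z x)) @^-1` [set t | t != 0].
  apply/seteqP; split => x; rewrite /N /preimage /= indicE.
    move=> [Ox nGF]; rewrite mem_set // mul1r; apply/eqP => c0; apply: nGF.
    have := @cabs0_eq0 _ (G z x - F z x); rewrite cabsE c0 sqrtr0 => /(_ erefl)/eqP.
    by rewrite subr_eq0 => /eqP.
  have [Ox|nO] := pselect (Om x); last by rewrite memNset // mul0r eqxx.
  rewrite mem_set // mul1r => c0; split => // GF; move: c0.
  by rewrite GF subrr /csq expr0n addr0 eqxx.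
have mN : measurable (N : set (BV n)).
  rewrite NE -[X in measurable X]setTI; apply: mu1 => //.
  by apply: measurable_realfun.open_measurable; exact: open_neq.
rewrite /ae_eq_on iint_ge0_integral; last 2 first.
- by apply/measurable_EFinP; exact: measurable_indic.
- by move=> x; rewrite lee_fin.
rewrite integral_indic // setIT.
apply/(negligibleP (lam n) mN).
(* Uncountably many centres are in play; rational cubes contained in their balls cover the
   exceptional set by countably many null pieces. *)
pose P (p : 'rV[rat]_n * nat) := exists2 x0, Om x0 & qcube p.1 p.2 `<=` ball x0 (D x0).1.
pose E k : set V := if unpickle k is Some p then [set x | P p /\ N x /\ qcube p.1 p.2 x] else set0.
have NE' : N `<=` \bigcup_k E k.
  move=> x Nx; have [Ox _] := Nx; have [r0 _ _ _] := HD x Ox.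
  have [q [k [qx qs]]] := qcube_in_open (ball_open x (D x).1) (ballxx x r0).
  exists (pickle (q, k)) => //; rewrite /E pickleK; split => //; by exists x.
apply: (@negligibleS _ _ _ (lam n) (\bigcup_k (E k : set (BV n))) N NE'); apply: negligible_bigcup => k.
rewrite /E; case: unpickle => [p|]; last exact: negligible_set0.
have [[x0 O0 sq]|nP] := pselect (P p); last first.
  by apply: negligibleS (negligible_set0 (lam n)) => x [].
have [_ _ _ A0] := HD x0 O0.
apply: negligibleS (A0 z zS) => x [_ [[_ nGF] qx]] /= /(_ (sq x qx)) FH.
by apply: nGF; rewrite FH (agree z x0) //; exact: sq.
Qed.
End Patching.
Unset Implicit Arguments.

Theorem theoremB2 (R : realType) (n : nat) (Om : set 'rV[R]_n)
  (b : 'rV[R]_n -> R) (a : 'rV[R]_n -> 'M[R[i]]_n) (ell : 'rV[R]_n -> R)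
  (f : nat -> 'rV[R]_n -> R[i]) (Lf : nat -> nat -> 'rV[R]_n -> R[i])
  (k : nat) (S : R)
  (F : R[i] -> 'rV[R]_n -> R[i]) (LF : nat -> R[i] -> 'rV[R]_n -> R[i])
  (m : nat) :
  open Om -> connected Om ->
  (forall p, CmR p Om b) -> (forall x, Om x -> 0 < b x) ->
  (forall mu nu p, Cm p Om (fun x => a x mu nu)) ->
  (forall x, Om x -> (a x)^T = a x) ->
  {within Om, continuous ell} -> (forall x, Om x -> 0 < ell x) ->
  (forall x, Om x -> forall xi : 'rV[R[i]]_n,
     ell x * (\sum_(mu < n) (cRe (xi ord0 mu) ^+ 2 + cIm (xi ord0 mu) ^+ 2))
     <= cRe (\sum_(mu < n) \sum_(nu < n) a x mu nu * conjc (xi ord0 mu) * xi ord0 nu)) ->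
  (0 < k)%N ->
  (* f_j, Lbar f_j, ..., Lbar^k f_j in L^2_loc; Lf l j represents Lbar^l f_j *)
  (forall j, Lf 0%N j = f j) ->
  (forall j l, (l <= k)%N -> L2loc Om (Lf l j)) ->
  (forall j l, (l < k)%N -> weakL Om a b (Lf l j) (Lf l.+1 j)) ->
  L2loc_analytic Om S F ->
  (* (i) *)
  (forall z, cabs z < S -> L2loc Om (F z) /\ L2loc_cvg Om (psum z f) (F z)) ->
  (* (ii); LF l z represents Lbar^l F(z) *)
  (forall z, cabs z < S -> LF 0%N z = F z) ->
  (forall z l, cabs z < S -> (l <= k)%N -> L2loc Om (LF l z)) ->
  (forall z l, cabs z < S -> (l < k)%N -> weakL Om a b (LF l z) (LF l.+1 z)) ->
  (* (iii) *)
  (forall z l, cabs z < S -> (1 <= l <= k)%N ->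
     L2loc_cvg Om (psum z (fun j => Lf l j)) (LF l z)) ->
  (2 * m + n < 4 * k)%N ->
  exists G : R[i] -> 'rV[R]_n -> R[i],
    (forall z, cabs z < S -> ae_eq_on Om (G z) (F z) /\ Cm m Om (G z)) /\
    Cm m (joint_dom S Om) (joint G).
Proof.
move=> oOm _ Cb b0 Ca _ cell ell0 Hell _ Lf0 LfL2 LfW _ Fi LF0 LFL2 LFW Fiii km.
(* For S <= 0 the disc is empty and any function satisfies the claim. *)
have [Sn|S0] := leP S 0.
  have no z : ~ cabs z < S by move=> zS; have := le_lt_trans (cabs_ge0 z) (lt_le_trans zS Sn); rewrite ltxx.
  exists (fun _ _ => 0); split => [z /no//|].
  by split; apply: CmR_local => v [/no].
have LF0c z : cabs z < S -> LF 0%N z = F z by exact: LF0.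
have Lf0f : Lf 0%N = f by apply/funext => j; exact: Lf0.
have cvg z l : cabs z < S -> (l <= k)%N -> L2loc_cvg Om (psum z (Lf l)) (LF l z).
  case: l => [|l] zS lk; first by rewrite Lf0f (LF0c z zS); case: (Fi z zS).
  by apply: Fiii => //; rewrite lk.
apply: (patching oOm) => [z zS|x0 Ox]; first by case: (Fi z zS) => -[].
have [e /= e0 xe] : exists2 e : R, 0 < e & ball x0 e `<=` Om.
  by have /nbhs_ballP := open_nbhs_nbhs (conj oOm Ox).
(* Halving the radius places the closure of the ball inside the domain, as [relcpt] demands. *)
have r0 : 0 < e / 2 by rewrite divr_gt0.
have re : e / 2 < e by rewrite ltr_pdivrMr // ltr_pMr // ltr1n.
have rQ : relcpt Om (ball x0 (e / 2)).
  split; first exact: ball_open.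
  split; first exact: closure_ball_compact.
  by apply: subset_trans xe; apply: subset_trans (@closure_ball_sub _ _ _ _) (ccube_sub_ball e0 re).
have [H [CH AH]] := @local_expansion R n Om b a ell Lf k m S LF oOm Cb b0 Ca cell ell0 Hell LfL2 LfW
  LFL2 cvg km S0 x0 (e / 2) r0 rQ.
exists (e / 2 / 4), H; split => //.
- by rewrite divr_gt0.
- apply: subset_trans xe; apply: le_ball; apply: ltW; apply: lt_trans re.
  by rewrite ltr_pdivrMr // ltr_pMr // ltr1n.
- by move=> z zS; rewrite -(LF0c z zS); exact: AH.
Qed.
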